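(* Suppose that $\bar u\in U_{\mathrm{ad}}$ is a control with state $\bar y:=\mathcal S(\bar u)$ such that the set $\mathbb R_+(U_{\mathrm{ad}}-\bar u)$ is dense in $U$. Then $\bar u$ is a Bouligand stationary point, i.e., it satisfies $$\langle \partial_1\mathcal J(\bar y,\bar y(T),\bar u),\mathcal S'(\bar u;h)\rangle_{L^\infty}+\partial_2\mathcal J(\bar y,\bar y(T),\bar u)\,\mathcal S'(\bar u;h)(T)+\langle\partial_3\mathcal J(\bar y,\bar y(T),\bar u),h\rangle_U\ge 0\quad\forall h\in\mathbb R_+(U_{\mathrm{ad}}-\bar u),$$ if and only if there exist an adjoint state $\bar p\in BV[0,T]$ and a multiplier $\bar\mu\in G_r[0,T]^*$ such that all of the following conditions hold: (1) $\bar p(0)=\bar p(T)=0$ and $\bar p(t)=\bar p(t-)$ for all $t\in[0,T)$; (2) $\bar p(t-)\in K^{\mathrm{ptw}}_{\mathrm{crit}}(\bar y,\bar u)(t)$ for all $t\in[0,T]$; (3) $\langle\bar\mu,z\rangle_{G_r}\ge 0$ for all $z\in\mathcal K^{\mathrm{red,crit}}_{G_r}(\bar y,\bar u)$; (4) $\int_0^T h\,\mathrm d\bar p=\langle\partial_3\mathcal J(\bar y,\bar y(T),\bar u),h\rangle_U$ for all $h\in U$; (5) $-\int_0^T z\,\mathrm d\bar p=\langle\partial_1\mathcal J(\bar y,\bar y(T),\bar u),z\rangle_{L^\infty}+\partial_2\mathcal J(\bar y,\bar y(T),\bar u)\,z(T)-\langle\bar\mu,z\rangle_{G_r}$ for all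 $z\in G_r[0,T]$.
   Context: Fixed data: $T>0$, $r>0$, $Z=[-r,r]$, $y_0\in Z$. Function spaces: $C[0,T]$ and $G[0,T]$ are the real-valued continuous and regulated functions on $[0,T]$ (regulated = uniform limit of step functions), with the supremum norm $\|\cdot\|_\infty$. For $v\in G[0,T]$, $v(t-)$, $v(t+)$ are left and right limits, with conventions $v(0-):=v(0)$, $v(T+):=v(T)$. $G_r[0,T]:=\{v\in G[0,T]: v(t)=v(t+)\ \forall t\in[0,T]\}$ (a closed subspace, with dual $G_r[0,T]^*$ and pairing $\langle\cdot,\cdot\rangle_{G_r}$). $BV[0,T]$ is the space of real-valued functions of bounded variation (genuine functions, not equivalence classes), with norm $|v(0)|+\operatorname{var}(v)$; $CBV[0,T]:=BV[0,T]\cap C[0,T]$. $C([0,T];Z)$ is the set of continuous functions on $[0,T]$ with values in $Z$. Integrals $\int_a^b f\,\mathrm dg$ are Kurzweil–Stieltjes integrals: the value is the number $I$ such that for every $\varepsilon>0$ there is $\delta:[a,b]\to(0,\infty)$ with $|\sum_i f(\tau_i)(g(t_i)-g(t_{i-1}))-I|<\varepsilon$ for every tagged partition $a=t_0<\dots<t_N=b$, $\tau_i\in[t_{i-1},t_i]\subset(\tau_i-\delta(\tau_i),\tau_i+\delta(\tau_i))$. It exists whenever $f,g$ are regulated and at least one of them has bounded variation. Scalar stop operator: $\mathcal S:CBV[0,T]\to CBV[0,T]$ maps $u$ to the (known to exist) unique $y\in CBV[0,T]$ with $\int_0^T(v-y)\,\mathrm d(y-u)\ge0$ for all $v\in C([0,T];Z)$,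 $y(t)\in Z$ for all $t\in[0,T]$, and $y(0)=y_0$. It is known that for all $u,h\in CBV[0,T]$ the pointwise directional derivative $\mathcal S'(u;h)(t):=\lim_{\alpha\to0^+}\frac{\mathcal S(u+\alpha h)(t)-\mathcal S(u)(t)}{\alpha}$ exists for every $t\in[0,T]$ and that $\mathcal S'(u;h)\in BV[0,T]$. Optimal control problem: minimize $\mathcal J(y,y(T),u)$ over $u\in U_{\mathrm{ad}}$, $y=\mathcal S(u)$. Standing assumptions: $U\subset CBV[0,T]$ is a real vector space with a norm $\|\cdot\|_U$, continuously and densely embedded into $(C[0,T],\|\cdot\|_\infty)$; $U_{\mathrm{ad}}$ is a nonempty convex subset of $U$; $\mathcal J:L^\infty(0,T)\times\mathbb R\times U\to\mathbb R$ is Fréchet differentiable, with partial derivatives $\partial_1\mathcal J,\partial_2\mathcal J,\partial_3\mathcal J$, and $\partial_1\mathcal J(y,y(T),u)\in L^1(0,T)$ for all $(y,u)\in CBV[0,T]\times U$, where $L^1(0,T)$ is regarded as a subset of $L^\infty(0,T)^*$ via the canonical embedding (so $\langle f,z\rangle_{L^\infty}=\int_0^T f z\,\mathrm dt$). Here $\partial_2\mathcal J(\cdot)\in\mathbb R$ and $\partial_3\mathcal J(\cdot)\in U^*$. $\mathbb R_+(U_{\mathrm{ad}}-\bar u):=\{\alpha(v-\bar u):\alpha\ge0,\ v\in U_{\mathrm{ad}}\}$. For $u\in CBV[0,T]$, $y=\mathcal S(u)$: $I(y):=\{t\in[0,T]:|y(t)|<r\}$; $B_\pm(y,u):=\{t\in[0,T]: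 y(t)=\pm r$ and there is $\varepsilon>0$ such that $y-u$ is constant on $[t,t+\varepsilon)\}$, with the convention $T\in B_\pm(y,u)$ if $y(T)=\pm r$; $B(y,u):=B_+(y,u)\cup B_-(y,u)$; $A(y,u):=\{t\in[0,T):|y(t)|=r$ and there is no $\varepsilon>0$ such that $y-u$ is constant on $[t,t+\varepsilon)\}$. The pointwise critical cone is $K^{\mathrm{ptw}}_{\mathrm{crit}}(y,u)(t):=\mathbb R$ if $t\in I(y)$, $(-\infty,0]$ if $t\in B_+(y,u)$, $[0,\infty)$ if $t\in B_-(y,u)$, $\{0\}$ if $t\in A(y,u)$. Reduced critical cone: $\mathcal K^{\mathrm{red,crit}}_{G_r}(y,u):=\{z\in G_r[0,T]: z(t)\in K^{\mathrm{ptw}}_{\mathrm{crit}}(y,u)(t)\ \forall t\in[0,T],\ z(0)=0,\ \text{and } z(t)=0\ \forall t\in[0,T]\text{ with }z(t-)\ne z(t)\}$. *)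

(* Defs.v *)
From HB Require Import structures.
From mathcomp Require Import all_boot all_order all_algebra.
From mathcomp Require Import all_classical all_reals all_analysis.
From mathcomp Require Import measurable_realfun ess_sup_inf.
Set Implicit Arguments.
Unset Strict Implicit.
Unset Printing Implicit Defensive.
Import Order.TTheory GRing.Theory Num.Theory.
Import numFieldNormedType.Exports.
Local Open Scope classical_set_scope.
Local Open Scope ring_scope.
Local Open Scope quotient_scope.

(* The library defines the quotients [LspaceType mu p1] without any algebraic
   structure; this section makes them normed modules. *)
Section Lspace_normed_module.
Context d (T : measurableType d) (R : realType).
Variables (mu : {measure set T -> \bar R}) (p : \bar R) (p1 : (1 <= p)%E).

Local Notation Lp := (LspaceType mu p1).
Local Notation Lf := (LfunType mu p1).

Lemma ae_eq_Lnorm (f g : T -> R) : measurable_fun setT f ->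
  measurable_fun setT g -> f = g %[ae mu] ->
  'N[mu]_p[EFin \o f]%E = 'N[mu]_p[EFin \o g]%E.
Proof using p1.
move=> mf mg fg; rewrite unlock /Lnorm.
case: p p1 => [q q1||//].
- have mq (h : T -> R) : measurable_fun setT h ->
      measurable_fun setT (fun x => ((EFin \o (Num.norm \o h)) x `^ q)%E).
    move=> mh; apply: (@measurableT_comp _ _ _ _ _ _ (fun x => x `^ q)%E) => //=.
      exact: measurable_poweR.
    by apply/measurable_EFinP; exact: measurableT_comp.
  congr (_ `^ _)%E; apply: ae_eq_integral => //; [exact: mq|exact: mq|].
  by apply: filterS fg => x /[swap] xT /(_ xT) /= ->.
- move=> _; case: ifPn => // _; apply: eq_ess_sup.
  by apply: filterS fg => x /(_ I) /= ->.
Qed.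

Lemma Lspace_ae_eq (f g : Lp) : (f : T -> R) = g %[ae mu] -> f = g.
Proof.
case: f => f [[ff]]; case: g => g [[fg]] /= efg.
have e : f = g by rewrite -(reprK f) -(reprK g); apply/eqmodP/asboolP.
by move: efg; subst g => _; rewrite (Prop_irrelevance ff fg).
Qed.

(* [LspaceType] is a quotient of functions into [measurableTypeR R], which has
   the sigma-algebra of [R] but another measure display. *)
Definition Lfun_fun (f : Lf) : T -> measurableTypeR R := f.

Fact Lfun_measurableTypeR (f : Lf) : measurable_fun setT (Lfun_fun f).
Proof. exact: (@measurable_funPT _ _ T R f). Qed.

HB.instance Definition _ (f : Lf) :=
  isMeasurableFun.Build _ _ T (measurableTypeR R) (Lfun_fun f)
    (Lfun_measurableTypeR f).

Definition Lspace_pi (f : Lf) : {mfun_ mu, T >-> measurableTypeR R} :=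
  \pi_({mfun_ mu, T >-> measurableTypeR R}) (Lfun_fun f).

Lemma Lspace_piE (f : Lf) : (Lspace_pi f : T -> R) = f %[ae mu].
Proof.
have /eqmodP/asboolP := reprK (Lspace_pi f).
by [].
Qed.

Lemma aeEqMfun_measurable (f : {mfun_ mu, T >-> measurableTypeR R}) :
  measurable_fun setT (f : T -> R).
Proof. exact: (@measurable_funPT _ _ T (measurableTypeR R) (repr f)). Qed.

Lemma Lspace_pi_finite (f : Lf) : finite_norm mu p (Lspace_pi f).
Proof.
rewrite /finite_norm (@ae_eq_Lnorm _ f)//; [exact: Lfunction_finite|exact: aeEqMfun_measurable|].
exact: Lspace_piE.
Qed.

HB.instance Definition _ (f : Lf) :=
  isFinLebesgue.Build d T R mu p p1 (Lspace_pi f) (Lspace_pi_finite f).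

Definition Lspace_of (f : Lf) : Lp := Lspace_pi f.

Lemma Lspace_ofE (f : Lf) : (Lspace_of f : T -> R) = f %[ae mu].
Proof. exact: Lspace_piE. Qed.

Lemma Lspace_repr_Lfun (f : Lp) : (f : T -> R) \in Lfun mu p.
Proof.
apply/andP; split; rewrite inE/=; first exact: aeEqMfun_measurable.
exact: Lebesgue_finite.
Qed.

Definition Lspace_repr (f : Lp) : Lf := Lfun_Sub p1 (Lspace_repr_Lfun f).

Lemma Lspace_reprK : cancel Lspace_repr Lspace_of.
Proof. by move=> f; apply: Lspace_ae_eq; exact: Lspace_ofE. Qed.

Definition Lspace_zero : Lp := Lspace_of 0.
Definition Lspace_opp (f : Lp) : Lp := Lspace_of (- Lspace_repr f).
Definition Lspace_add (f g : Lp) : Lp :=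
  Lspace_of (Lspace_repr f + Lspace_repr g).
Definition Lspace_scale (a : R) (f : Lp) : Lp :=
  Lspace_of (a *: Lspace_repr f).
Definition Lspace_norm (f : Lp) : R := fine 'N[mu]_p[EFin \o f].

Lemma Lspace_zeroE : (Lspace_zero : T -> R) = cst 0 %[ae mu].
Proof. exact: Lspace_ofE. Qed.

Lemma Lspace_oppE f : (Lspace_opp f : T -> R) = \- f %[ae mu].
Proof. exact: Lspace_ofE. Qed.

Lemma Lspace_addE f g : (Lspace_add f g : T -> R) = f \+ g %[ae mu].
Proof. exact: Lspace_ofE. Qed.

Lemma Lspace_scaleE a f :
  (Lspace_scale a f : T -> R) = (fun x => a * f x) %[ae mu].
Proof. exact: Lspace_ofE. Qed.


HB.instance Definition _ := gen_eqMixin Lp.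
HB.instance Definition _ := gen_choiceMixin Lp.

Lemma Lspace_addA : associative Lspace_add.
Proof.
move=> f g h; apply: Lspace_ae_eq.
have := @filterI _ _ (ae_filter_ringOfSetsType mu) _ _ (Lspace_addE f g) (Lspace_addE g h).
move: (Lspace_addE f (Lspace_add g h)) (Lspace_addE (Lspace_add f g) h) => h1 h2 h3.
apply: filterS3 h1 h2 h3 => x + + + xT.
move=> /(_ xT)-> /(_ xT)-> [] /(_ xT) + /(_ xT).
by move=> /= -> ->; rewrite addrA.
Qed.

Lemma Lspace_addC : commutative Lspace_add.
Proof.
move=> f g; apply: Lspace_ae_eq.
move: (Lspace_addE f g) (Lspace_addE g f) => h1 h2.
apply: filterS2 h1 h2 => x + + xT.
by move=> /(_ xT)-> /(_ xT)->; rewrite /= addrC.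
Qed.

Lemma Lspace_add0 : left_id Lspace_zero Lspace_add.
Proof.
move=> f; apply: Lspace_ae_eq.
move: Lspace_zeroE (Lspace_addE Lspace_zero f) => h1 h2.
apply: filterS2 h1 h2 => x + + xT.
by move=> /(_ xT) + /(_ xT)-> => /= ->; rewrite add0r.
Qed.

Lemma Lspace_addN : left_inverse Lspace_zero Lspace_opp Lspace_add.
Proof.
move=> f; apply: Lspace_ae_eq.
move: Lspace_zeroE (Lspace_oppE f) (Lspace_addE (Lspace_opp f) f) => h1 h2 h3.
apply: filterS3 h1 h2 h3 => x + + + xT.
by move=> /(_ xT)-> /(_ xT) + /(_ xT)-> => /= ->; rewrite addNr.
Qed.

HB.instance Definition _ := GRing.isZmodule.Build Lp
  Lspace_addA Lspace_addC Lspace_add0 Lspace_addN.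

Lemma Lspace_scaleA a b f :
  Lspace_scale a (Lspace_scale b f) = Lspace_scale (a * b) f.
Proof.
apply: Lspace_ae_eq.
move: (Lspace_scaleE a (Lspace_scale b f)) (Lspace_scaleE b f)
  (Lspace_scaleE (a * b) f) => h1 h2 h3.
apply: filterS3 h1 h2 h3 => x + + + xT.
by move=> /(_ xT)-> /(_ xT) + /(_ xT)-> => /= ->; rewrite mulrA.
Qed.

Lemma Lspace_scale1 : left_id 1 Lspace_scale.
Proof.
move=> f; apply: Lspace_ae_eq; move: (Lspace_scaleE 1 f).
by apply: filterS => x + xT => /(_ xT)->; rewrite mul1r.
Qed.

Lemma Lspace_scaleDr : right_distributive Lspace_scale +%R.
Proof.
move=> a f g; apply: (@Lspace_ae_eq (Lspace_scale a (Lspace_add f g))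
  (Lspace_add (Lspace_scale a f) (Lspace_scale a g))).
have := @filterI _ _ (ae_filter_ringOfSetsType mu) _ _ (Lspace_scaleE a f) (Lspace_scaleE a g).
have := @filterI _ _ (ae_filter_ringOfSetsType mu) _ _ (Lspace_scaleE a (Lspace_add f g)) (Lspace_addE f g).
move: (Lspace_addE (Lspace_scale a f) (Lspace_scale a g)) => h1 h2 h3.
apply: filterS3 h1 h2 h3 => x + + + xT.
move=> /(_ xT)-> [] /(_ xT)-> /(_ xT) + [] /(_ xT) + /(_ xT).
by move=> /= -> -> ->; rewrite mulrDr.
Qed.

Lemma Lspace_scaleDl f : {morph Lspace_scale^~ f : a b / a + b}.
Proof.
move=> a b; apply: (@Lspace_ae_eq (Lspace_scale (a + b) f)
  (Lspace_add (Lspace_scale a f) (Lspace_scale b f))).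
have := @filterI _ _ (ae_filter_ringOfSetsType mu) _ _ (Lspace_scaleE a f) (Lspace_scaleE b f).
move: (Lspace_scaleE (a + b) f)
  (Lspace_addE (Lspace_scale a f) (Lspace_scale b f)) => h1 h2 h3.
apply: filterS3 h1 h2 h3 => x + + + xT.
move=> /(_ xT)-> /(_ xT)-> [] /(_ xT) + /(_ xT).
by move=> /= -> ->; rewrite mulrDl.
Qed.

HB.instance Definition _ := GRing.Zmodule_isLmodule.Build R Lp
  Lspace_scaleA Lspace_scale1 Lspace_scaleDr Lspace_scaleDl.

Lemma Lspace_norm_of (f : Lf) :
  Lspace_norm (Lspace_of f) = fine 'N[mu]_p[EFin \o f].
Proof.
rewrite /Lspace_norm (@ae_eq_Lnorm _ f)//; last exact: Lspace_ofE.
exact: aeEqMfun_measurable.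
Qed.

Lemma Lspace_ler_normD f g :
  Lspace_norm (f + g) <= Lspace_norm f + Lspace_norm g.
Proof.
by rewrite [f + g]/(Lspace_of _) Lspace_norm_of; exact: ler_LnormD.
Qed.

Lemma Lspace_normrZ a f : Lspace_norm (a *: f) = `|a| * Lspace_norm f.
Proof.
rewrite [a *: f]/(Lspace_of _) Lspace_norm_of.
have /(congr1 fine) := LnormZ (Lspace_repr f) a.
by rewrite -(finite_norm_fine (Lspace_repr f)) -EFinM.
Qed.

Lemma Lspace_normr0_eq0 f : Lspace_norm f = 0 -> f = 0.
Proof.
move=> f0; apply: Lspace_ae_eq.
move: (@fine_Lnormr_eq0 _ _ _ _ _ p1 (Lspace_repr f) f0) Lspace_zeroE => h1 h2.
by apply: filterS2 h1 h2 => x + + xT => /(_ xT) + /(_ xT) ->.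
Qed.

HB.instance Definition _ := Lmodule_isNormed.Build R Lp
  Lspace_ler_normD Lspace_normrZ Lspace_normr0_eq0.

Lemma Lspace_normE (f : Lp) : `|f| = fine 'N[mu]_p[EFin \o f].
Proof. by []. Qed.

End Lspace_normed_module.

Section function_spaces.
Context {R : realType}.
Implicit Types (T t : R) (f g v w z : R -> R).

(* A function on [0, T] is represented by any total function [R -> R] extending
   it: no definition below depends on the values taken outside [0, T]. *)

Definition step_fun T f := exists2 s : seq R, itv_partition 0 T s &
  forall i, (i < size s)%N ->
    {in `](0 :: s)`_i, s`_i[ &, forall x x', f x = f x'}.

Definition regulated T : set (R -> R) := [set v | forall e, 0 < e ->
  exists2 f, step_fun T f & {in `[0, T], forall t, `|v t - f t| <= e}].

Definition contC T : set (R -> R) := [set v | {within `[0, T], continuous v}].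

Definition BV T : set (R -> R) := [set v | bounded_variation 0 T v].

Definition CBV T : set (R -> R) := BV T `&` contC T.

Definition llim v t : R := if t == 0 then v 0 else lim (v x @[x --> t^'-]).

Definition rlim T v t : R := if t == T then v T else lim (v x @[x --> t^'+]).

Definition Gr T : set (R -> R) :=
  [set v | regulated T v /\ {in `[0, T], forall t, v t = rlim T v t}].

Definition supnorm T v : R := sup [set `|v t| | t in `[0, T]].

(* Continuous linear functionals on [Gr T]; boundedness entails that [m z] depends
   only on the restriction of [z] to [0, T]. Values of [m] off [Gr T] are junk. *)
Definition Gr_dual T : set ((R -> R) -> R) := [set m |
  (forall (a : R) z w, Gr T z -> Gr T w ->
     m (fun t => a * z t + w t) = a * m z + m w) /\
  exists C : R, forall z, Gr T z -> `|m z| <= C * supnorm T z].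

End function_spaces.

Section Kurzweil_Stieltjes.
Context {R : realType}.
Implicit Types (a b : R) (f g : R -> R).

Definition tagged_partition a b (n : nat) (t tau : nat -> R) :=
  [/\ t 0%N = a, t n = b, forall i, (i < n)%N -> t i < t i.+1 &
      forall i, (i < n)%N -> t i <= tau i <= t i.+1].

(* [tau i] is the tag of the interval [t i, t i.+1]. *)
Definition fine_partition (delta : R -> R) (n : nat) (t tau : nat -> R) :=
  forall i, (i < n)%N ->
    `[t i, t i.+1] `<=` `](tau i - delta (tau i)), (tau i + delta (tau i))[.

Definition is_KSint a b f g (I : R) := forall e, 0 < e ->
  exists2 delta : R -> R, {in `[a, b], forall x, 0 < delta x} &
    forall n t tau, tagged_partition a b n t tau ->
      fine_partition delta n t tau ->
      `|\sum_(i < n) f (tau i) * (g (t i.+1) - g (t i)) - I| < e.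

Definition KSint a b f g : R := get [set I | is_KSint a b f g I].

End Kurzweil_Stieltjes.

Section stop_operator.
Context {R : realType}.
Variables (T r y0 : R).
Implicit Types (t x : R) (u h v y z : R -> R).

Definition is_stop u y :=
  [/\ CBV T y,
      forall v, contC T v -> {in `[0, T], forall t, v t \in `[- r, r]} ->
        0 <= KSint 0 T (v \- y) (y \- u),
      {in `[0, T], forall t, y t \in `[- r, r]} &
      y 0 = y0].

(* [is_stop u y] determines [y] on [0, T] only. *)
Definition stop u : R -> R := get [set y | is_stop u y].

Definition stop_dd u h t : R :=
  lim ((stop (fun s => u s + alpha * h s) t - stop u t) / alpha
         @[alpha --> 0^'+]).

Definition const_right v t :=
  exists2 e, 0 < e & forall s, t <= s < t + e -> s <= T -> v s = v t.

Definition inactive y : set R := [set t | t \in `[0, T] /\ `|y t| < r].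

(* The sets B_+ and B_- for [c = r] and [c = - r]. *)
Definition biactive (c : R) y u : set R :=
  [set t | [/\ t \in `[0, T], y t = c & t = T \/ const_right (y \- u) t]].

Definition strictly_active y u : set R :=
  [set t | [/\ t \in `[0, T[, `|y t| = r & ~ const_right (y \- u) t]].

Definition Kptw y u t : set R := [set x |
  [\/ inactive y t,
      biactive r y u t /\ x <= 0,
      biactive (- r) y u t /\ 0 <= x
    | strictly_active y u t /\ x = 0]].

Definition Kred y u : set (R -> R) := [set z |
  [/\ Gr T z,
      {in `[0, T], forall t, Kptw y u t (z t)},
      z 0 = 0 &
      {in `[0, T], forall t, llim z t <> z t -> z t = 0}]].

End stop_operator.

Section Linfty.
Context {R : realType}.
Variable T : R.

Definition leb0T : {measure set (measurableTypeR R) -> \bar R} :=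
  mrestr lebesgue_measure (measurable_itv (Interval (BRight 0) (BLeft T))).

Definition Linf : Type := LspaceType leb0T (leey 1).

(* The class of [f] in L^oo(0, T); it is [0] if [f] is not essentially bounded and
   measurable on ]0, T[. *)
Definition to_Linf (f : R -> R) : Linf :=
  Lspace_of (insubd (0 : LfunType leb0T (leey 1)) (f \_ `]0, T[)).

Lemma to_LinfE (f : R -> R) (M : R) :
  measurable_fun (`]0, T[ : set (measurableTypeR R)) f ->
  {in `]0, T[, forall t, `|f t| <= M} ->
  (to_Linf f : R -> R) = f %[ae leb0T].
Proof.
move=> mf fM.
have fL : (f \_ `]0, T[ : measurableTypeR R -> R) \in Lfun leb0T +oo.
  apply/andP; split; rewrite inE/=.
    have [+ _] := @measurable_restrictT _ _ (measurableTypeR R) R `]0, T[ f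
      (measurable_itv _).
    exact.
  rewrite /finite_norm unlock /Lnorm; case: ifPn => // _.
  apply: (@le_lt_trans _ _ (Num.max M 0)%:E); last exact: ltry.
  apply/ess_supP/aeW => t /=; rewrite lee_fin patchE.
  case: ifPn => [|_]; last by rewrite normr0 le_max lexx orbT.
  by rewrite inE/= => tT; rewrite le_max fM.
have h1 := Lspace_ofE (insubd (0 : LfunType leb0T (leey 1)) (f \_ `]0, T[)).
have h2 : (f \_ `]0, T[) = f %[ae leb0T].
  exists (~` `]0, T[); split; first exact: measurableC.
    by rewrite /leb0T/= /mrestr setICl measure0.
  move=> t /= + tT; apply => _.
  by rewrite patchE mem_set.
apply: filterS2 h1 h2 => t + + _ => /(_ Logic.I) + /(_ Logic.I) <-.
by rewrite /to_Linf => ->; rewrite -[LHS]/(val _ t) insubdK.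
Qed.

End Linfty.

Section objective.
Context {R : realType} {T : R} {U : normedModType R}.
Implicit Types (J : Linf T * R * U -> R) (y : Linf T) (b : R) (u : U).

Definition partial1 J y b u : Linf T -> R := 'd (fun z : Linf T => J (z, b, u)) y.

Definition partial2 J y b u : R := derive1 (fun s : R => J (y, s, u)) b.

Definition partial3 J y b u : U -> R := 'd (fun w : U => J (y, b, w)) u.

Definition cone_of (A : set U) u : set U :=
  [set h | exists2 a : R, 0 <= a & exists2 v, A v & h = a *: (v - u)].

End objective.

(* Main.v *)
Require Import Defs.
From HB Require Import structures.
From mathcomp Require Import all_boot all_order all_algebra.
From mathcomp Require Import all_classical all_reals all_analysis.
From mathcomp Require Import measurable_realfun.
From mathcomp Require Import ring lra.
Set Implicit Arguments.
Unset Strict Implicit.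
Unset Printing Implicit Defensive.
Import Order.TTheory GRing.Theory Num.Theory.
Import numFieldNormedType.Exports.
Local Open Scope classical_set_scope.
Local Open Scope ring_scope.

(** The state equation is first freed from its variational inequality.  A function [y]
    is the stop of [u] exactly when it stays in [- r, r] and the play [u - y] moves only in
    the direction of an active constraint: it is nonincreasing wherever [y < r] and
    nondecreasing wherever [- r < y] ([stopsol], [is_stopP]).  In this form the comparison
    and Lipschitz estimates are crossing arguments, and wherever [y < r] the play is a
    running minimum ([stopsol_runmin]).

    The running minimum of [u + x * h] is concave in [x], which yields the one-sided derivative
    [W] of the play ([isW_ex]).  Locally [W] either keeps its value or is reset to the
    direction [h], up to the oscillation of [h] ([W_local]); hence [W] has bounded variation
    with [h] ([W_control]), and the derivative of the stop operator is [h - W].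

    Sufficiency.  Let [z] be the right-continuous version of [h - W].  It lies in the reduced
    critical cone ([rlim_delta_Kred]) and differs from [h - W] at countably many times only,
    so the adjoint equation tested with [z] turns the derivative of the objective into the
    value of the multiplier at [z], which is nonnegative, plus the integral of [h - z] against
    [p].  Here [h - z] is the right-continuous version of [W].  Where the left limit of [p] is
    not zero the play is locally constant, so that [W] is locally monotone, and the sign of
    [p] gives its direction; integration by parts shows that this integral is nonnegative
    ([KSint_rlim_W_ge0], [stationary_of_adjoint]).

    Necessity.  By density the Bouligand inequality holds in all directions of [U].  The
    derivative of the state is bounded by twice the supremum norm of the direction, so the
    inequality for [h] and [- h] bounds the partial derivative in the control by the same
    norm ([stationary_bd]); it therefore extends to all continuous functions ([extend]) and
    is an integral against some [p] of bounded variation ([riesz_KSint]).  Constant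
    directions do not change the state, so the extension kills constants and both end values
    of [p] can be [0].  The sign of [p] at [t] comes from directions that approximate the
    indicator of [t, T] and whose derivatives vanish off shrinking intervals
    ([Kptw_primL]).  The adjoint equation defines the multiplier.  To see that it is
    nonnegative at a [z] of the reduced critical cone, [z] is approximated by continuous
    directions: a soft threshold of [z], cut off near finitely many zeros of [z].  Along those
    the play does not react, so that the derivative of the state is the direction itself
    ([exact_direction]) and the Bouligand inequality is the claim ([multiplier_ge0]). *)

(** * Cousin's lemma as a compactness principle *)

Section Cousin.
Variable R : realType.
Implicit Types (a b : R) (d : R -> R).

Lemma tagged_partition_rcons a b c x n (t tau : nat -> R) d :
  tagged_partition a b n t tau -> fine_partition d n t tau ->
  b < x -> b <= c <= x -> c - d c < b -> x < c + d c ->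
  exists t' tau', tagged_partition a x n.+1 t' tau' /\ fine_partition d n.+1 t' tau'.
Proof.
move=> [ta tb tlt ttau] fine bx bcx cb xc.
exists (fun i => if (i <= n)%N then t i else x), (fun i => if (i < n)%N then tau i else c).
split; first split.
- by rewrite leq0n.
- by rewrite ltnn.
- move=> i; rewrite ltnS => iN; rewrite iN; case: ltnP => [|ni]; first exact: tlt.
  by rewrite (_ : i = n) ?tb//; apply/eqP; rewrite eqn_leq iN.
- move=> i; rewrite ltnS => iN; rewrite iN; case: ltnP => [|ni]; first exact: ttau.
  by rewrite (_ : i = n) ?tb//; apply/eqP; rewrite eqn_leq iN.
move=> i; rewrite ltnS => iN; rewrite iN; case: ltnP => [/fine//|ni].
rewrite (_ : i = n); last by apply/eqP; rewrite eqn_leq iN.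
by rewrite tb => y /=; rewrite !in_itv/= => /andP[by_ yx]; apply/andP; split; lra.
Qed.

(** The supremum of the points up to which a fine partition exists is one of them, and its
    own gauge interval carries the partition beyond it unless it is [b]. *)
Lemma cousin a b d : a < b -> (forall x, a <= x <= b -> 0 < d x) ->
  exists n t tau, tagged_partition a b n t tau /\ fine_partition d n t tau.
Proof.
move=> ab d0.
pose S := [set x | a <= x <= b /\ exists n t tau,
  tagged_partition a x n t tau /\ fine_partition d n t tau].
have Sa : S a.
  by split; [lra|exists 0%N, (fun=> a), (fun=> a)].
have Sb : ubound S b by move=> x [/andP[]].
have hS : has_sup S by split; [exists a|exists b].
set c := sup S.
have ac : a <= c by apply: ub_le_sup => //; exists b.
have cb : c <= b by apply: ge_sup => //; exists a.
have dc : 0 < d c by apply: d0; rewrite ac.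
have [s Ss cs] := sup_adherent dc hS.
have sc : s <= c by apply: ub_le_sup => //; exists b.
case: (Ss) => /andP[as_ sb] [n [t [tau [tp fp]]]].
pose x := Num.min b (c + d c / 2).
have xb : x <= b by rewrite /x ge_min lexx.
have xc : x <= c + d c / 2 by rewrite /x ge_min lexx orbT.
have cx : c <= x by rewrite /x le_min cb; lra.
have := le_trans sc cx; rewrite le_eqVlt => /predU1P[sx|sx].
  suff -> : b = s by exists n, t, tau.
  apply/eqP; rewrite eq_le sb andbT leNgt; apply/negP => sltb.
  have : s < x by rewrite /x lt_min sltb/=; lra.
  lra.
have sCx : s <= c <= x by rewrite sc.
have [|t' [tau' [tp' fp']]] := tagged_partition_rcons tp fp sx sCx cs; first lra.
have Sx : S x by split; [lra|exists n.+1, t', tau'].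
have xc' : x <= c by apply: ub_le_sup => //; exists b.
suff -> : b = x by exists n.+1, t', tau'.
apply/eqP; rewrite eq_le xb andbT leNgt; apply/negP => xltb.
have : c < x by rewrite /x lt_min; lra.
lra.
Qed.

Lemma tagged_partition_nondecr a b n (t tau : nat -> R) :
  tagged_partition a b n t tau ->
  forall i j, (i <= j)%N -> (j <= n)%N -> t i <= t j.
Proof.
move=> [_ _ tlt _] i; elim=> [|j ih]; first by rewrite leqn0 => /eqP ->.
rewrite leq_eqVlt => /predU1P[->//|]; rewrite ltnS => ij jn.
by apply: le_trans (ih ij (ltnW jn)) _; apply/ltW/tlt.
Qed.

Lemma tagged_partition_in a b n (t tau : nat -> R) :
  tagged_partition a b n t tau -> forall i, (i < n)%N ->
  [/\ a <= t i, t i <= tau i, tau i <= t i.+1 & t i.+1 <= b].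
Proof.
move=> tp i iN; have mono := tagged_partition_nondecr tp.
case: tp => ta tb tlt ttau; have /andP[? ?] := ttau _ iN; split => //.
  by rewrite -ta; apply: mono => //; exact: ltnW.
by rewrite -tb; apply: mono.
Qed.

Lemma fine_partition_in d n (t tau : nat -> R) : fine_partition d n t tau ->
  forall i, (i < n)%N -> t i <= t i.+1 -> tau i - d (tau i) < t i /\ t i.+1 < tau i + d (tau i).
Proof.
move=> fp i iN tt; have h := fp i iN; split.
  by have := h (t i); rewrite /= !in_itv/= lexx tt => /(_ isT) /andP[].
by have := h (t i.+1); rewrite /= !in_itv/= lexx tt => /(_ isT) /andP[].
Qed.

Lemma local_choice (P : R -> R -> Prop) a b :
  (forall x, a <= x <= b -> exists2 d : R, 0 < d & P x d) ->
  exists d : R -> R, (forall x, a <= x <= b -> 0 < d x) /\ (forall x, a <= x <= b -> P x (d x)).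
Proof.
move=> h.
have /choice[d hd] : forall x, exists d : R, a <= x <= b -> 0 < d /\ P x d.
  move=> x; case: (boolP (a <= x <= b)) => [/h[d d0 Pd]|_]; first by exists d.
  by exists 0.
by exists d; split => x /hd[].
Qed.

(** This form of Cousin's lemma replaces covering arguments: what passes across a
    neighbourhood of every point passes from [a] to [b]. *)
Lemma chain_induction (Q : R -> Prop) a b : a < b ->
  (forall x, a <= x <= b -> exists2 d : R, 0 < d &
     forall s t, a <= s -> s <= x -> x <= t -> t <= b -> x - d < s -> t < x + d ->
       s < t -> Q s -> Q t) ->
  Q a -> Q b.
Proof.
move=> ab /local_choice[d [d0 hd]] Qa.
have [n [t [tau [tp fp]]]] := cousin ab d0.
have h i : (i <= n)%N -> Q (t i).
  elim: i => [_|i ih iN]; first by case: tp => ->.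
  have [h1 h2 h3 h4] := tagged_partition_in tp iN.
  have tt : t i < t i.+1 by case: tp => _ _ + _; apply.
  have [f1 f2] := fine_partition_in fp iN (ltW tt).
  apply: (hd (tau i) _ (t i) (t i.+1)) => //; first by lra.
  exact/ih/ltnW.
by case: tp => _ <- _ _; exact: h.
Qed.

Lemma chain_trans (Q : R -> R -> Prop) a b : a < b ->
  (forall x, a <= x <= b -> exists2 d : R, 0 < d &
     forall s t, a <= s -> s <= x -> x <= t -> t <= b -> x - d < s -> t < x + d ->
       s < t -> Q s t) ->
  (forall x y, a < x -> x < y -> y <= b -> Q a x -> Q x y -> Q a y) ->
  Q a b.
Proof.
move=> ab h tr.
suff [ab'|//] : b = a \/ Q a b by move: ab; rewrite ab' ltxx.
pattern b; apply: (@chain_induction (fun x => x = a \/ Q a x) a b ab); last by left.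
move=> x xab; have [d d0 hd] := h x xab; exists d => // s t as_ sx xt tb ds dt st.
have Qst : Q s t by apply: hd.
case=> [sa|Qas]; first by right; rewrite -sa.
have : a <= s by [].
rewrite le_eqVlt => /predU1P[sa|asl]; first by right; rewrite sa.
by right; apply: (tr s t).
Qed.

End Cousin.

(** * Continuity, one-sided limits and bounded variation on an interval *)

Section real_functions.
Variable R : realType.
Implicit Types (a b e t s x y l k : R) (f g v w V W p q : R -> R).

(** Continuity within [a, b], in a form to which linear arithmetic applies. *)
Definition cts a b v := forall t, a <= t <= b -> forall e, 0 < e ->
  exists2 d : R, 0 < d & forall s, a <= s <= b -> `|s - t| < d -> `|v s - v t| < e.

Lemma ctsP a b v : {within `[a, b], continuous v} <-> cts a b v.
Proof.
split=> [/subspace_continuousP cv t tab e e0|cv].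
  have := cv t; rewrite /= in_itv/= => /(_ tab)/cvgrPdist_lt/(_ e e0).
  rewrite near_withinE => /nbhs_ballP[d d0 hd]; exists d => // s sab st.
  by rewrite distrC; apply: hd => //=; rewrite /ball/= distrC.
apply/subspace_continuousP => t /=; rewrite in_itv/= => tab.
apply/cvgrPdist_lt => e e0; rewrite near_withinE.
have [d d0 hd] := cv t tab e e0.
apply/nbhs_ballP; exists d => // s st /=; rewrite in_itv/= => sab.
by rewrite distrC; apply: hd => //; rewrite distrC.
Qed.

Lemma cts_sub a b a' b' v : a <= a' -> b' <= b -> cts a b v -> cts a' b' v.
Proof.
move=> aa bb cv t tab e e0; have [|d d0 hd] := cv t _ e e0; first lra.
by exists d => // s sab; apply: hd; lra.
Qed.

Lemma cts_ext a b f g : (forall t, a <= t <= b -> f t = g t) -> cts a b f -> cts a b g.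
Proof.
move=> fg cf t tab e e0; have [d d0 hd] := cf t tab e e0; exists d => // s sab sd.
by rewrite -!fg//; exact: hd.
Qed.

Lemma cts_cst a b c : cts a b (fun=> c).
Proof. by move=> t _ e e0; exists 1 => // s _ _; rewrite subrr normr0. Qed.

Lemma ctsD a b f g : cts a b f -> cts a b g -> cts a b (fun x => f x + g x).
Proof.
move=> cf cg t tab e e0.
have [|d d0 hd] := cf t tab (e / 2); first lra.
have [|d' d'0 hd'] := cg t tab (e / 2); first lra.
exists (Num.min d d'); first by rewrite lt_min d0.
move=> s sab; rewrite lt_min => /andP[/(hd _ sab) h1 /(hd' _ sab) h2].
have := ler_normD (f s - f t) (g s - g t).
by rewrite (_ : f s - f t + (g s - g t) = f s + g s - (f t + g t)); last ring; lra.
Qed.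

Lemma ctsZ a b k f : cts a b f -> cts a b (fun x => k * f x).
Proof.
move=> cf t tab e e0.
have k1 : 0 < `|k| + 1 by rewrite ltr_wpDl.
have [|d d0 hd] := cf t tab (e / (`|k| + 1)); first by rewrite divr_gt0.
exists d => // s sab /(hd _ sab).
rewrite ltr_pdivlMr// -mulrBr normrM => h; apply: le_lt_trans h.
by rewrite mulrC ler_wpM2l//; lra.
Qed.

Lemma ctsN a b f : cts a b f -> cts a b (fun x => - f x).
Proof. by move/(ctsZ (-1)); apply: cts_ext => x _; ring. Qed.

Lemma ctsB a b f g : cts a b f -> cts a b g -> cts a b (fun x => f x - g x).
Proof. by move=> cf cg; apply: ctsD => //; exact: ctsN. Qed.

Lemma cts_comp a b a' b' f g : cts a b f -> cts a' b' g ->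
  (forall x, a <= x <= b -> a' <= f x <= b') -> cts a b (fun x => g (f x)).
Proof.
move=> cf cg fab t tab e e0; have [d d0 hd] := cg (f t) (fab _ tab) e e0.
have [d' d'0 hd'] := cf t tab d d0; exists d' => // s sab sd.
by apply: hd; [exact: fab|exact: hd'].
Qed.

Lemma cts_lip a b k f : (forall x y, a <= x <= b -> a <= y <= b ->
  `|f x - f y| <= k * `|x - y|) -> cts a b f.
Proof.
move=> h t tab e e0; have k1 : 0 < `|k| + 1 by rewrite ltr_wpDl.
exists (e / (`|k| + 1)); first by rewrite divr_gt0.
move=> s sab; rewrite ltr_pdivlMr// => he; apply: le_lt_trans (h _ _ sab tab) _.
apply: le_lt_trans he; rewrite mulrC ler_wpM2l//.
by have := ler_norm k; lra.
Qed.

Lemma cts_bounded a b f : cts a b f ->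
  exists2 M : R, 0 < M & forall t, a <= t <= b -> `|f t| <= M.
Proof.
move=> cf; case: (leP a b) => ab; last first.
  by exists 1 => // t /andP[h1 h2]; have := lt_le_trans ab (le_trans h1 h2); rewrite ltxx.
have /ctsP cf' := cf.
have [c cab hc] := EVT_max ab cf'; have [c' c'ab hc'] := EVT_min ab cf'.
exists (`|f c| + `|f c'| + 1); first by rewrite ltr_wpDl// addr_ge0.
move=> t tab; have := hc t; have := hc' t; rewrite in_itv/= => /(_ tab) h1 /(_ tab) h2.
rewrite ler_norml; have := ler_norm (f c); have := ler_norm (- f c').
rewrite normrN; have := normr_ge0 (f c); have := normr_ge0 (f c') => *; lra.
Qed.

Lemma cts_argmax a b f : a <= b -> cts a b f ->
  exists2 c : R, a <= c <= b & forall t, a <= t <= b -> f t <= f c.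
Proof.
move=> ab /ctsP cf; have [c + hc] := EVT_max ab cf; rewrite in_itv/= => cab.
by exists c => // t tab; apply: hc; rewrite in_itv.
Qed.

Lemma cts_argmin a b f : a <= b -> cts a b f ->
  exists2 c : R, a <= c <= b & forall t, a <= t <= b -> f c <= f t.
Proof.
move=> ab /ctsP cf; have [c + hc] := EVT_min ab cf; rewrite in_itv/= => cab.
by exists c => // t tab; apply: hc; rewrite in_itv.
Qed.

Lemma cts_uniform a b f e : a < b -> cts a b f -> 0 < e ->
  exists2 d : R, 0 < d & forall s t, a <= s <= b -> a <= t <= b -> `|s - t| < d ->
    `|f s - f t| < e.
Proof.
move=> ab cf e0.
suff [d d0 hd] : exists2 d : R, 0 < d &
    forall s t, a <= s -> s <= t -> t <= b -> t - s < d -> `|f s - f t| < e.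
  exists d => // s t sab tab; case: (leP s t) => st.
    by rewrite distrC ger0_norm ?subr_ge0//; apply: hd; lra.
  by rewrite ger0_norm ?subr_ge0 ?ltW// distrC; apply: hd; lra.
pattern b; apply: (@chain_induction _ _ a b ab); last first.
  exists 1 => // s t as_ st ta _; rewrite (_ : s = t) ?subrr ?normr0//; lra.
move=> x xab; have [|d d0 hd] := cf x xab (e / 2); first lra.
exists (d / 2); first lra.
move=> s t as_ sx xt tb ds td st [d' d'0 hd'].
exists (Num.min d' (d / 2)); first by rewrite lt_min d'0; lra.
move=> s' t' as' st' tt'; rewrite lt_min => /andP[h1 h2].
case: (leP t' s) => [t's|st's]; first exact: hd'.
have d1 : `|s' - x| < d by rewrite ltr_norml; lra.
have d2 : `|t' - x| < d by rewrite ltr_norml; lra.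
have := hd s' _ d1; have := hd t' _ d2 => h3 h4.
have := ler_normB (f s' - f x) (f t' - f x).
rewrite (_ : f s' - f x - (f t' - f x) = f s' - f t'); last ring.
by have := h3 ltac:(lra); have := h4 ltac:(lra); lra.
Qed.

Definition right_lim v t l := forall e, 0 < e ->
  exists2 d : R, 0 < d & forall x, t < x < t + d -> `|v x - l| < e.
Definition left_lim v t l := forall e, 0 < e ->
  exists2 d : R, 0 < d & forall x, t - d < x < t -> `|v x - l| < e.

Lemma right_limP v t l : right_lim v t l <-> v x @[x --> t^'+] --> l.
Proof.
split=> [h|/cvgrPdist_lt h e e0].
  apply/cvgrPdist_lt => e /h[d d0 hd]; rewrite near_withinE.
  apply/nbhs_ballP; exists d => // x; rewrite /ball/= ltr_norml => xd tx.
  by rewrite distrC; apply: hd; lra.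
have := h e e0; rewrite near_withinE => /nbhs_ballP[d d0 hd].
exists d => // x xd; rewrite distrC; apply: hd => /=; last lra.
by rewrite /ball/= ltr_norml; lra.
Qed.

Lemma left_limP v t l : left_lim v t l <-> v x @[x --> t^'-] --> l.
Proof.
split=> [h|/cvgrPdist_lt h e e0].
  apply/cvgrPdist_lt => e /h[d d0 hd]; rewrite near_withinE.
  apply/nbhs_ballP; exists d => // x; rewrite /ball/= ltr_norml => xd tx.
  by rewrite distrC; apply: hd; lra.
have := h e e0; rewrite near_withinE => /nbhs_ballP[d d0 hd].
exists d => // x xd; rewrite distrC; apply: hd => /=; last lra.
by rewrite /ball/= ltr_norml; lra.
Qed.

Lemma right_lim_lim v t l : right_lim v t l -> lim (v x @[x --> t^'+]) = l.
Proof. by move/right_limP/cvg_lim; apply. Qed.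

Lemma left_lim_lim v t l : left_lim v t l -> lim (v x @[x --> t^'-]) = l.
Proof. by move/left_limP/cvg_lim; apply. Qed.

Lemma right_lim_cauchy v t :
  (forall e, 0 < e -> exists2 d : R, 0 < d &
     forall x y, t < x < t + d -> t < y < t + d -> `|v x - v y| <= e) ->
  exists l, right_lim v t l.
Proof.
move=> h.
pose S := [set c | exists2 d : R, 0 < d & forall x, t < x < t + d -> c <= v x].
have hS e (e0 : 0 < e) d : 0 < d ->
    (forall x y, t < x < t + d -> t < y < t + d -> `|v x - v y| <= e) ->
    forall x, t < x < t + d -> S (v x - e) /\ ubound S (v x + e).
  move=> d0 hd x xd; split.
    by exists d => // y yd; have := hd x y xd yd; rewrite ler_norml; lra.
  move=> c [d' d'0 hc].
  pose y := t + Num.min d d' / 2.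
  have m0 : 0 < Num.min d d' by rewrite lt_min d0.
  have m1 : Num.min d d' <= d by rewrite ge_min lexx.
  have m2 : Num.min d d' <= d' by rewrite ge_min lexx orbT.
  have h1 : t < y < t + d by rewrite /y; lra.
  have h2 : t < y < t + d' by rewrite /y; lra.
  by have := hd x y xd h1; have := hc _ h2; rewrite ler_norml; lra.
exists (sup S) => e e0.
have e20 : 0 < e / 2 by lra.
have [d d0 hd] := h _ e20; exists d => // x xd.
have [Sx ux] := hS _ e20 _ d0 hd x xd.
have h1 : v x - e / 2 <= sup S by apply: ub_le_sup => //; exists (v x + e / 2).
have h2 : sup S <= v x + e / 2 by apply: ge_sup => //; exists (v x - e / 2).
by rewrite ltr_norml; lra.
Qed.

Lemma right_lim_uniq v t l l' : right_lim v t l -> right_lim v t l' -> l = l'.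
Proof. by move=> /right_lim_lim <- /right_lim_lim. Qed.

Lemma left_lim_opp v t l : right_lim (fun x => v (- x)) (- t) l -> left_lim v t l.
Proof.
move=> h e /h[d d0 hd]; exists d => // x xd.
by have := hd (- x); rewrite opprK; apply; lra.
Qed.

(** [V] dominates the variation of [p].  Bounded variation is only used through such a [V]. *)
Definition control a b V p :=
  forall s t, a <= s -> s <= t -> t <= b -> `|p t - p s| <= V t - V s.

Lemma control_mono a b V p : control a b V p ->
  forall s t, a <= s -> s <= t -> t <= b -> V s <= V t.
Proof. by move=> h s t h1 h2 h3; have := le_trans (normr_ge0 _) (h s t h1 h2 h3); lra. Qed.

Lemma control_self a b V p : control a b V p -> control a b V V.
Proof.
move=> h s t h1 h2 h3; rewrite ger0_norm ?subr_ge0//; exact: (control_mono h).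
Qed.

Lemma BV_control T p : 0 < T -> BV T p -> exists V, control 0 T V p.
Proof.
move=> T0 bv; exists (fun t => fine (total_variation 0 t p)) => s t s0 st tT.
have bvt : total_variation 0 t p \is a fin_num.
  by apply/bounded_variationP; [lra|apply: bounded_variationl bv; lra].
have bvs : total_variation 0 s p \is a fin_num.
  by apply/bounded_variationP; [lra|apply: bounded_variationl bv; lra].
have D := total_variationD p s0 st.
have bvst : total_variation s t p \is a fin_num.
  apply/bounded_variationP; first lra.
  by apply: (@bounded_variationr _ 0) => //; apply: bounded_variationl bv; lra.
rewrite D fineD// addrAC subrr add0r -lee_fin fineK//.
exact: total_variation_ge.
Qed.

Lemma control_BV T V p : 0 < T -> control 0 T V p -> BV T p.
Proof.
move=> T0 h; rewrite /BV/= (_ : p = V \+ (\- (V \- p))); last first.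
  by apply/funext => x /=; ring.
apply: bounded_variationD => //.
  apply: nondecreasing_bounded_variation => x y /=; rewrite !in_itv/= => xT yT xy.
  by apply: (control_mono h); lra.
apply: bounded_variationN.
apply: nondecreasing_bounded_variation => x y /=; rewrite !in_itv/= => xT yT xy.
have := h x y; rewrite ler_norml => /(_ ltac:(lra) xy ltac:(lra)); lra.
Qed.

Lemma controlD a b V W p q : control a b V p -> control a b W q ->
  control a b (fun t => V t + W t) (fun t => p t + q t).
Proof.
move=> h1 h2 s t as_ st tb; have := h1 s t as_ st tb; have := h2 s t as_ st tb => h3 h4.
rewrite (_ : p t + q t - (p s + q s) = (p t - p s) + (q t - q s)); last ring.
by have := ler_normD (p t - p s) (q t - q s); lra.
Qed.

Lemma controlN a b V p : control a b V p -> control a b V (fun t => - p t).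
Proof.
move=> h s t as_ st tb; rewrite (_ : - p t - - p s = - (p t - p s)); last ring.
by rewrite normrN; exact: h.
Qed.

Lemma controlZ a b V p k : control a b V p ->
  control a b (fun t => `|k| * V t) (fun t => k * p t).
Proof.
move=> h s t as_ st tb; rewrite -!mulrBr normrM ler_wpM2l//; exact: h.
Qed.

Lemma control_right_lim a b V p t : control a b V p -> a <= t < b ->
  exists l, right_lim p t l.
Proof.
move=> h tab; apply: right_lim_cauchy => e e0.
pose S : set R := [set V x | x in `]t, b]].
have Sn : S !=set0 by exists (V b), b => //=; rewrite in_itv/=; lra.
have lS : has_lbound S.
  by exists (V t) => z [x]; rewrite /= in_itv/= => xtb <-; apply: (control_mono h); lra.
have [v0 [x0 /= + <-{v0}] hx] := inf_adherent e0 (conj Sn lS).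
rewrite in_itv/= => x0b; exists (x0 - t); first lra.
suff W x y : t < x < t + (x0 - t) -> t < y < t + (x0 - t) -> x <= y -> `|p x - p y| <= e.
  move=> x y xt yt; case: (leP x y) => xy; first exact: W.
  by rewrite distrC; apply: W => //; exact: ltW.
move=> xt yt xy; rewrite distrC; have := h x y; have := control_mono h (s := y) (t := x0).
have : inf S <= V x by apply: ge_inf => //; exists x => //=; rewrite in_itv/=; lra.
move=> h1 h2 h3; have := h2 ltac:(lra) ltac:(lra) ltac:(lra).
have := h3 ltac:(lra) ltac:(lra) ltac:(lra); lra.
Qed.

Lemma control_left_lim a b V p t : control a b V p -> a < t <= b ->
  exists l, left_lim p t l.
Proof.
move=> h tab.
have h' : control (- b) (- a) (fun x => - V (- x)) (fun x => p (- x)).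
  by move=> x y bx xy ya; rewrite distrC; have := h (- y) (- x); lra.
have [|l hl] := control_right_lim h' (t := - t); first lra.
by exists l; exact: left_lim_opp.
Qed.

End real_functions.

(** * Kurzweil-Stieltjes integrals of regulated functions *)

Section KS.
Variable R : realType.
Implicit Types (a b e x y l k : R) (f g v w V W p q : R -> R).

Definition KSsum f g n (t tau : nat -> R) : R := \sum_(i < n) f (tau i) * (g (t i.+1) - g (t i)).

Lemma fine_le a b (d d' : R -> R) n (t tau : nat -> R) : tagged_partition a b n t tau ->
  (forall x, a <= x <= b -> d x <= d' x) -> fine_partition d n t tau -> fine_partition d' n t tau.
Proof.
move=> tp dd fp i iN y /= /(fp i iN) /=; rewrite !in_itv/=.
have [h1 h2 h3 h4] := tagged_partition_in tp iN.
by have := dd (tau i) ltac:(lra); lra.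
Qed.

Lemma cousin2 a b (d d' : R -> R) : a < b ->
  {in `[a, b], forall x, 0 < d x} -> {in `[a, b], forall x, 0 < d' x} ->
  exists n t tau, [/\ tagged_partition a b n t tau, fine_partition d n t tau &
    fine_partition d' n t tau].
Proof.
move=> ab d0 d'0.
have [|n [t [tau [tp fp]]]] := @cousin _ a b (fun x => Num.min (d x) (d' x)) ab.
  by move=> x xab; rewrite lt_min d0 ?d'0// in_itv.
by exists n, t, tau; split => //; apply: (fine_le tp _ fp) => x _; rewrite ge_min lexx ?orbT.
Qed.

Lemma is_KSint_uniq a b f g I J : a < b -> is_KSint a b f g I -> is_KSint a b f g J -> I = J.
Proof.
move=> ab hI hJ; apply/eqP; rewrite -subr_eq0 -normr_eq0 eq_le normr_ge0 andbT.
apply/ler_addgt0Pl => e e0; rewrite addr0.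
have [|d d0 hd] := hI (e / 2); first lra.
have [|d' d'0 hd'] := hJ (e / 2); first lra.
have [n [t [tau [tp fp fp']]]] := cousin2 ab d0 d'0.
have := hd n t tau tp fp; have := hd' n t tau tp fp'.
set S := \sum_(i < n) _ => h1 h2; have := ler_normB (S - J) (S - I).
by rewrite (_ : S - J - (S - I) = I - J); last ring; lra.
Qed.

Lemma KSintE a b f g I : a < b -> is_KSint a b f g I -> KSint a b f g = I.
Proof.
move=> ab hI; apply: (is_KSint_uniq ab _ hI).
exact: (@getPex _ [set I | is_KSint a b f g I] (ex_intro _ I hI)).
Qed.

Lemma is_KSintP a b f g I : a < b -> is_KSint a b f g I -> is_KSint a b f g (KSint a b f g).
Proof. by move=> ab hI; rewrite (KSintE ab hI). Qed.

Lemma is_KSint_ext a b f f' g I : (forall x, a <= x <= b -> f x = f' x) ->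
  is_KSint a b f g I -> is_KSint a b f' g I.
Proof.
move=> ff hI e /hI[d d0 hd]; exists d => // n t tau tp fp.
have := hd n t tau tp fp; congr (`|_ - I| < _); apply: eq_bigr => i _.
by have [h1 h2 h3 h4] := tagged_partition_in tp (ltn_ord i); rewrite ff//; lra.
Qed.

Lemma is_KSint_lin a b f f' g k I I' : is_KSint a b f g I -> is_KSint a b f' g I' ->
  is_KSint a b (fun x => k * f x + f' x) g (k * I + I').
Proof.
move=> hI hI' e e0; have k1 : 0 < `|k| + 1 by rewrite ltr_wpDl.
have [|d d0 hd] := hI (e / 2 / (`|k| + 1)); first by rewrite !divr_gt0.
have [|d' d'0 hd'] := hI' (e / 2); first lra.
exists (fun x => Num.min (d x) (d' x)); first by move=> x xab; rewrite lt_min d0 ?d'0.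
move=> n t tau tp fp.
have /(hd _ _ _ tp) h1 : fine_partition d n t tau.
  by apply: (fine_le tp) fp => x _; rewrite ge_min lexx.
have /(hd' _ _ _ tp) h2 : fine_partition d' n t tau.
  by apply: (fine_le tp) fp => x _; rewrite ge_min lexx orbT.
rewrite (eq_bigr (fun i : 'I_n => k * (f (tau i) * (g (t i.+1) - g (t i))) +
   f' (tau i) * (g (t i.+1) - g (t i)))); last by move=> i _; ring.
rewrite big_split -mulr_sumr/=.
move: h1 h2; set S := \sum_(i < n) _; set S' := \sum_(i < n) _ => h1 h2.
rewrite (_ : _ - _ = k * (S - I) + (S' - I')); last ring.
apply: le_lt_trans (ler_normD _ _) _; rewrite normrM.
move: h1; rewrite ltr_pdivlMr// => h1.
by have : `|k| * `|S - I| <= `|S - I| * (`|k| + 1); [rewrite mulrC ler_wpM2l//; lra|lra].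
Qed.

Lemma tagged_telescope a b n (t tau : nat -> R) g : tagged_partition a b n t tau ->
  \sum_(i < n) (g (t i.+1) - g (t i)) = g b - g a.
Proof.
move=> [<- <- _ _]; elim: n => [|n ih]; first by rewrite big_ord0 subrr.
by rewrite big_ord_recr/= ih; ring.
Qed.

(** The local content of a fine partition: a subinterval [s, t] tagged at [x]. *)
Definition fine_at (d : R -> R) a b x s t :=
  [/\ a <= s, s <= x, x <= t & t <= b] /\ [/\ s < t, x - d x < s & t < x + d x].

Lemma fine_atP a b (d : R -> R) n (t tau : nat -> R) : tagged_partition a b n t tau ->
  fine_partition d n t tau -> forall i, (i < n)%N -> fine_at d a b (tau i) (t i) (t i.+1).
Proof.
move=> tp fp i iN; have [h1 h2 h3 h4] := tagged_partition_in tp iN.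
have tt : t i < t i.+1 by case: tp => _ _ + _; apply.
by have [f1 f2] := fine_partition_in fp iN (ltW tt).
Qed.

(** Tagged terms that agree with the increments of [G] up to [e] times those of [H]
    sum up to the increment of [G]: Stieltjes sums are computed by telescoping. *)
Lemma is_KSint_telescope a b f g G C :
  (forall e, 0 < e -> exists2 d : R -> R, forall x, a <= x <= b -> 0 < d x &
     exists2 H : R -> R, H b - H a <= C & forall x s t, fine_at d a b x s t ->
       `|f x * (g t - g s) - (G t - G s)| <= e * (H t - H s)) ->
  is_KSint a b f g (G b - G a).
Proof.
move=> h e e0; have C1 : 0 < `|C| + 1 by rewrite ltr_wpDl.
have [|d d0 [H HC hd]] := h (e / (`|C| + 1)); first by rewrite divr_gt0.
exists d => [x|n t tau tp fp]; first by rewrite in_itv/=; exact: d0.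
rewrite -(tagged_telescope G tp) -sumrB; apply: le_lt_trans (ler_norm_sum _ _ _) _.
apply: (@le_lt_trans _ _ (\sum_(i < n) e / (`|C| + 1) * (H (t i.+1) - H (t i)))).
  by apply: ler_sum => i _; apply: hd; exact: (fine_atP tp fp).
rewrite -mulr_sumr (tagged_telescope H tp) mulrAC ltr_pdivrMr//.
by rewrite ltr_pM2l//; have := ler_norm C; lra.
Qed.

(** Tagged terms are only bounded below here, which estimates an integral known to exist. *)
Lemma KSint_ge_telescope a b f g G C I : a < b -> is_KSint a b f g I ->
  (forall e, 0 < e -> exists2 d : R -> R, forall x, a <= x <= b -> 0 < d x &
     exists2 H : R -> R, H b - H a <= C & forall x s t, fine_at d a b x s t ->
       (G t - G s) - e * (H t - H s) <= f x * (g t - g s)) ->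
  G b - G a <= I.
Proof.
move=> ab hI h; apply/ler_addgt0Pr => e e0.
have C1 : 0 < `|C| + 1 by rewrite ltr_wpDl.
have [|d d0 [H HC hd]] := h (e / 2 / (`|C| + 1)); first by rewrite !divr_gt0.
have [|d' d'0 hd'] := hI (e / 2); first lra.
have d0' : {in `[a, b], forall x, 0 < d x} by move=> x; rewrite in_itv/=; exact: d0.
have [n [t [tau [tp fp fp']]]] := cousin2 ab d0' d'0.
have := hd' n t tau tp fp'.
suff : G b - G a - e / 2 <= \sum_(i < n) f (tau i) * (g (t i.+1) - g (t i)).
  by rewrite ltr_norml; lra.
apply: (@le_trans _ _ (\sum_(i < n) ((G (t i.+1) - G (t i)) - e / 2 / (`|C| + 1) * (H (t i.+1) - H (t i))))).
  rewrite big_split/= sumrN (tagged_telescope G tp) lerB// -mulr_sumr (tagged_telescope H tp).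
  rewrite mulrAC ler_pdivrMr//.
  by rewrite ler_pM2l ?divr_gt0//; have := ler_norm C; lra.
by apply: ler_sum => i _; apply: hd; exact: (fine_atP tp fp).
Qed.

Lemma KSint_bound_telescope a b f g H I : a < b -> is_KSint a b f g I ->
  (exists2 d : R -> R, forall x, a <= x <= b -> 0 < d x & forall x s t, fine_at d a b x s t ->
     `|f x * (g t - g s)| <= H t - H s) ->
  `|I| <= H b - H a.
Proof.
move=> ab hI [d d0 hd]; apply/ler_addgt0Pr => e e0.
have [d' d'0 hd'] := hI e e0.
have d0' : {in `[a, b], forall x, 0 < d x} by move=> x; rewrite in_itv/=; exact: d0.
have [n [t [tau [tp fp fp']]]] := cousin2 ab d0' d'0.
have := hd' n t tau tp fp'; set S := \sum_(i < n) _ => hS.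
have : `|S| <= H b - H a.
  rewrite -(tagged_telescope H tp); apply: le_trans (ler_norm_sum _ _ _) _.
  by apply: ler_sum => i _; apply: hd; exact: (fine_atP tp fp).
have := ler_normB S (S - I); rewrite opprB addrC subrK; lra.
Qed.

Lemma KSint_bound a b f g V M I : a < b -> control a b V g -> is_KSint a b f g I ->
  (forall x, a <= x <= b -> `|f x| <= M) -> `|I| <= M * (V b - V a).
Proof.
move=> ab cV hI fM; rewrite mulrBr.
apply: (KSint_bound_telescope (H := fun x => M * V x) ab hI); exists (fun=> 1) => //.
move=> x s t [[as_ sx xt tb] _]; rewrite normrM -mulrBr.
by apply: ler_pM => //; [apply: fM; lra|apply: cV; lra].
Qed.

(** The integral is the supremum of the lower bounds valid on all fine enough partitions. *)
Lemma is_KSint_cauchy a b f g : a < b ->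
  (forall e, 0 < e -> exists2 d : R -> R, forall x, a <= x <= b -> 0 < d x &
    forall n t tau n' t' tau', tagged_partition a b n t tau -> fine_partition d n t tau ->
      tagged_partition a b n' t' tau' -> fine_partition d n' t' tau' ->
      `|KSsum f g n t tau - KSsum f g n' t' tau'| <= e) ->
  exists I, is_KSint a b f g I.
Proof.
move=> ab h.
pose S := [set c | exists2 d : R -> R, forall x, a <= x <= b -> 0 < d x &
  forall n t tau, tagged_partition a b n t tau -> fine_partition d n t tau ->
    c <= KSsum f g n t tau].
exists (sup S) => e e0; have e20 : 0 < e / 2 by lra.
have [d d0 hd] := h _ e20; exists d => [x|n t tau tp fp]; first by rewrite in_itv/=; exact: d0.
have Sx : S (KSsum f g n t tau - e / 2).
  exists d => // n' t' tau' tp' fp'; have := hd n t tau n' t' tau' tp fp tp' fp'.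
  by rewrite ler_norml; lra.
have uS : ubound S (KSsum f g n t tau + e / 2).
  move=> c [d' d'0 hc].
  have d0i : {in `[a, b], forall x, 0 < d x} by move=> x; rewrite in_itv/=; exact: d0.
  have d0i' : {in `[a, b], forall x, 0 < d' x} by move=> x; rewrite in_itv/=; exact: d'0.
  have [n' [t' [tau' [tp' fp' fp'']]]] := cousin2 ab d0i d0i'.
  have := hc _ _ _ tp' fp''; have := hd n t tau n' t' tau' tp fp tp' fp'.
  by rewrite ler_norml; lra.
have h1 : KSsum f g n t tau - e / 2 <= sup S by apply: ub_le_sup => //;
  exists (KSsum f g n t tau + e / 2).
have h2 : sup S <= KSsum f g n t tau + e / 2 by apply: ge_sup => //; exists (KSsum f g n t tau - e / 2).
by rewrite -/(KSsum f g n t tau) ltr_norml; lra.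
Qed.

Lemma is_KSint_unif a b f g V : a < b -> control a b V g ->
  (forall e, 0 < e -> exists2 f', exists I, is_KSint a b f' g I &
    forall x, a <= x <= b -> `|f x - f' x| <= e) ->
  exists I, is_KSint a b f g I.
Proof.
move=> ab cV h; apply: is_KSint_cauchy => // e e0.
have V0 : 0 <= V b - V a by rewrite subr_ge0; apply: (control_mono cV); lra.
have V1 : 0 < V b - V a + 1 by lra.
have [|f' [I hI] ff] := h (e / 4 / (V b - V a + 1)); first by rewrite !divr_gt0.
have [|d d0 hd] := hI (e / 4); first lra.
exists d => [x xab|n t tau n' t' tau' tp fp tp' fp']; first by apply: d0; rewrite in_itv.
have D m s sig : tagged_partition a b m s sig -> `|KSsum f g m s sig - KSsum f' g m s sig| <= e / 4.
  move=> tps; rewrite /KSsum -sumrB; apply: le_trans (ler_norm_sum _ _ _) _.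
  apply: (@le_trans _ _ (\sum_(i < m) e / 4 / (V b - V a + 1) * (V (s i.+1) - V (s i)))).
    apply: ler_sum => i _; rewrite -mulrBl normrM.
    have [h1 h2 h3 h4] := tagged_partition_in tps (ltn_ord i).
    by apply: ler_pM => //; [apply: ff; lra|apply: cV; lra].
  rewrite -mulr_sumr (tagged_telescope V tps) mulrAC ler_pdivrMr// ler_pM2l ?divr_gt0//; lra.
have /ltW h1 : `|KSsum f' g n t tau - I| < e / 4 := hd _ _ _ tp fp.
have /ltW h2 : `|KSsum f' g n' t' tau' - I| < e / 4 := hd _ _ _ tp' fp'.
have := D _ _ _ tp; have := D _ _ _ tp'; move: h1 h2.
by rewrite !ler_norml; lra.
Qed.

Lemma is_KSint_cst a b g k : is_KSint a b (fun=> k) g (k * g b - k * g a).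
Proof.
apply: (@is_KSint_telescope _ _ _ _ (fun x => k * g x) 0) => e e0.
exists (fun=> 1) => //; exists (fun=> 0); first by rewrite subrr.
by move=> x s t _; rewrite -mulrBr subrr normr0 subrr mulr0.
Qed.

(** The gauge forces [c] to be a tag wherever it is met, and then the sum telescopes up to
    the left limit of [g] at [c]. *)
Lemma is_KSint_indic_lt a b g V c : a < b -> control a b V g ->
  exists I, is_KSint a b (fun x => if x < c then 1 else 0) g I.
Proof.
move=> ab cV; case: (leP c a) => [ca|ac].
  exists (0 * g b - 0 * g a); apply: is_KSint_ext (is_KSint_cst a b g 0) => x xab.
  by rewrite ltNge (_ : c <= x)//; lra.
case: (ltP b c) => [bc|cb].
  exists (1 * g b - 1 * g a); apply: is_KSint_ext (is_KSint_cst a b g 1) => x xab.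
  by rewrite (_ : x < c)//; lra.
have [|l hl] := control_left_lim cV (t := c); first lra.
eexists; apply: (@is_KSint_telescope _ _ _ _ (fun x => if x < c then g x else l) 1) => e e0.
have [d0 d00 hd0] := hl e e0.
exists (fun x => if x == c then d0 else `|x - c|).
  by move=> x _; case: eqVneq => // xc; rewrite normr_gt0 subr_eq0.
exists (fun x => if x < c then 0 else 1).
  by rewrite ltNge cb ac/= subr0.
move=> x s t [[as_ sx xt tb] [st ds dt]].
move: ds dt; case: eqVneq => [xc|xc] ds dt.
  subst x; rewrite ltxx [t < c]ltNge xt/= mul0r sub0r normrN.
  have := sx; rewrite le_eqVlt => /predU1P[->|sc]; first by rewrite ltxx !subrr normr0 mulr0.
  by rewrite sc subr0 mulr1 distrC; apply/ltW/hd0; lra.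
move: ds dt; case: (ltgtP x c) xc => // xc _.
  rewrite ltr0_norm ?subr_lt0// => ds dt.
  have tc : t < c by lra.
  have sc : s < c by lra.
  by rewrite tc sc mul1r !subrr normr0 mulr0.
rewrite gtr0_norm ?subr_gt0// => ds dt.
have tc : (t < c) = false by apply/negbTE; rewrite -leNgt; lra.
have sc : (s < c) = false by apply/negbTE; rewrite -leNgt; lra.
by rewrite tc sc mul0r !subrr normr0 mulr0.
Qed.

Lemma is_KSint_indic_le a b g V c : a < b -> control a b V g ->
  exists I, is_KSint a b (fun x => if x <= c then 1 else 0) g I.
Proof.
move=> ab cV; case: (ltP c a) => [ca|ac].
  exists (0 * g b - 0 * g a); apply: is_KSint_ext (is_KSint_cst a b g 0) => x xab.
  by rewrite leNgt (_ : c < x)//; lra.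
case: (leP b c) => [bc|cb].
  exists (1 * g b - 1 * g a); apply: is_KSint_ext (is_KSint_cst a b g 1) => x xab.
  by rewrite (_ : x <= c)//; lra.
have [|l hl] := control_right_lim cV (t := c); first lra.
eexists; apply: (@is_KSint_telescope _ _ _ _ (fun x => if x <= c then g x else l) 1) => e e0.
have [d0 d00 hd0] := hl e e0.
exists (fun x => if x == c then d0 else `|x - c|).
  by move=> x _; case: eqVneq => // xc; rewrite normr_gt0 subr_eq0.
exists (fun x => if x <= c then 0 else 1).
  by rewrite [b <= c]leNgt cb ac/= subr0.
move=> x s t [[as_ sx xt tb] [st ds dt]].
move: ds dt; case: eqVneq => [xc|xc] ds dt.
  subst x; rewrite lexx sx mul1r subr0.
  have := xt; rewrite le_eqVlt => /predU1P[->|sc]; first by rewrite lexx !subrr normr0 mulr0.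
  rewrite [t <= c]leNgt sc/= mulr1 (_ : g t - g s - (l - g s) = g t - l); last ring.
  by apply/ltW/hd0; lra.
move: ds dt; case: (ltgtP x c) xc => // xc _.
  rewrite ltr0_norm ?subr_lt0// => ds dt.
  have tc : t <= c by lra.
  have sc : s <= c by lra.
  by rewrite tc sc mul1r !subrr normr0 mulr0.
rewrite gtr0_norm ?subr_gt0// => ds dt.
have tc : (t <= c) = false by apply/negbTE; rewrite -ltNge; lra.
have sc : (s <= c) = false by apply/negbTE; rewrite -ltNge; lra.
by rewrite tc sc mul0r !subrr normr0 mulr0.
Qed.

(** Up to uniform limits, a regulated function is a combination of the functions [x < c] and
    [x <= c], constants included. *)
Lemma regulated_ind T (Q : (R -> R) -> Prop) :
  (forall k, Q (fun=> k)) ->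
  (forall f c k, Q f -> Q (fun x => k * (if x < c then 1 else 0) + f x)) ->
  (forall f c k, Q f -> Q (fun x => k * (if x <= c then 1 else 0) + f x)) ->
  (forall f, (forall e, 0 < e -> exists2 g, Q g & forall x, 0 <= x <= T -> `|f x - g x| <= e) -> Q f) ->
  forall f, regulated T f -> Q f.
Proof.
move=> Q0 Q1 Q2 Q3 f rf; apply: Q3 => e e0.
have [g [s sT gs] fg] := rf e e0.
suff [h Qh [_ gh]] : exists2 h, Q h & (forall x, x <= 0 -> h x = g 0) /\ forall x, 0 <= x <= T ->
  h x = g x.
  by exists h => // x xT; rewrite gh//; apply: fg; rewrite in_itv.
have {gs} : forall i, (i < size s)%N -> forall x y, (0 :: s)`_i < x < s`_i ->
    (0 :: s)`_i < y < s`_i -> g x = g y.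
  by move=> i iN x y xi yi; apply: (gs i iN); rewrite in_itv.
move: sT.
suff H a : itv_partition a T s -> (forall i, (i < size s)%N ->
    forall x y, (a :: s)`_i < x < s`_i -> (a :: s)`_i < y < s`_i -> g x = g y) ->
  exists2 h, Q h & (forall x, x <= a -> h x = g a) /\ (forall x, a <= x <= T -> h x = g x).
  exact: H.
elim: s a => [|c s ih] a.
  move=> /itv_partition_nil -> _; exists (fun=> g T) => //; split => // x xT.
  by congr g; lra.
move=> /[dup] aT /itv_partition_cons cT gs.
have [|h Qh [h1 h2]] := ih c cT; first by move=> i iN; exact: (gs i.+1).
have ac : a < c by case: aT => /= /andP[].
set m := g ((a + c) / 2).
exists (fun x => (g a - m) * (if x <= a then 1 else 0) + ((m - g c) * (if x < c then 1 else 0) + h x)).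
  exact/Q2/Q1.
split=> x xa.
  by rewrite xa (le_lt_trans xa ac) h1; [ring|lra].
case: (leP x a) => xa'.
  have -> : x = a by lra.
  by rewrite ac h1; [ring|lra].
case: (ltP x c) => xc.
  rewrite h1; last lra.
  rewrite (_ : m = g x); first ring.
  by rewrite /m; apply: (gs 0%N) => //=; lra.
by rewrite h2; [ring|lra].
Qed.

Lemma addBl (x y z : R) : x + y - (x + z) = y - z.
Proof. by ring. Qed.

Lemma regulated_right_lim T v : regulated T v -> forall t, 0 <= t < T -> exists l, right_lim v t l.
Proof.
move: v; apply: regulated_ind.
- by move=> k t _; exists k => e e0; exists 1 => // x _; rewrite subrr normr0.
- move=> f c k hf t tT; have [l hl] := hf t tT.
  exists (k * (if t < c then 1 else 0) + l) => e /hl[d d0 hd].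
  case: (ltP t c) => tc.
    exists (Num.min d (c - t)); first by rewrite lt_min d0; lra.
    move=> x /andP[tx]; rewrite -ltrBlDl lt_min => /andP[xd xc].
    by rewrite (_ : x < c) ?addBl; [apply: hd; lra|lra].
  exists d => // x xd; rewrite (_ : (x < c) = false) ?addBl; first exact: hd.
  by apply/negbTE; rewrite -leNgt; lra.
- move=> f c k hf t tT; have [l hl] := hf t tT.
  exists (k * (if t < c then 1 else 0) + l) => e /hl[d d0 hd].
  case: (ltP t c) => tc.
    exists (Num.min d (c - t)); first by rewrite lt_min d0; lra.
    move=> x /andP[tx]; rewrite -ltrBlDl lt_min => /andP[xd xc].
    by rewrite (_ : x <= c) ?addBl; [apply: hd; lra|lra].
  exists d => // x xd; rewrite (_ : (x <= c) = false) ?addBl; first exact: hd.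
  by apply/negbTE; rewrite -ltNge; lra.
- move=> f h t tT; apply: right_lim_cauchy => e e0.
  have [|g /(_ t tT)[l hl] fg] := h (e / 4); first lra.
  have [|d d0 hd] := hl (e / 4); first lra.
  exists (Num.min d (T - t)); first by rewrite lt_min d0; lra.
  move=> x y; rewrite -!ltrBlDl !lt_min => /andP[tx /andP[xd xT]] /andP[ty /andP[yd yT]].
  have := fg x ltac:(lra); have := fg y ltac:(lra).
  have /ltW := hd x ltac:(lra); have /ltW := hd y ltac:(lra).
  by rewrite !ler_norml; lra.
Qed.

Lemma regulated_left_lim T v : regulated T v -> forall t, 0 < t <= T -> exists l, left_lim v t l.
Proof.
move=> rv t tT.
suff [l hl] : exists l, right_lim (fun x => v (- x)) (- t) l by exists l; exact: left_lim_opp.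
move: v rv; apply: regulated_ind.
- by move=> k; exists k => e e0; exists 1 => // x _; rewrite subrr normr0.
- move=> f c k [l hl].
  exists (k * (if t <= c then 1 else 0) + l) => e /hl[d d0 hd].
  case: (leP t c) => tc.
    exists d => // x xd; rewrite (_ : - x < c) ?addBl; first exact: hd.
    lra.
  exists (Num.min d (t - c)); first by rewrite lt_min d0; lra.
  move=> x /andP[tx]; rewrite -ltrBlDl lt_min => /andP[xd xc].
  by rewrite (_ : (- x < c) = false) ?addBl; [apply: hd|apply/negbTE; rewrite -leNgt]; lra.
- move=> f c k [l hl].
  exists (k * (if t <= c then 1 else 0) + l) => e /hl[d d0 hd].
  case: (leP t c) => tc.
    exists d => // x xd; rewrite (_ : - x <= c) ?addBl; first exact: hd.
    lra.
  exists (Num.min d (t - c)); first by rewrite lt_min d0; lra.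
  move=> x /andP[tx]; rewrite -ltrBlDl lt_min => /andP[xd xc].
  by rewrite (_ : (- x <= c) = false) ?addBl; [apply: hd|apply/negbTE; rewrite -ltNge]; lra.
- move=> f h; apply: right_lim_cauchy => e e0.
  have [|g [l hl] fg] := h (e / 4); first lra.
  have [|d d0 hd] := hl (e / 4); first lra.
  exists (Num.min d t); first by rewrite lt_min d0; lra.
  move=> x y; rewrite -!ltrBlDl !lt_min => /andP[tx /andP[xd xT]] /andP[ty /andP[yd yT]].
  have := fg (- x) ltac:(lra); have := fg (- y) ltac:(lra).
  have /ltW := hd x ltac:(lra); have /ltW := hd y ltac:(lra).
  by rewrite !ler_norml; lra.
Qed.

Lemma regulated_bounded T v : regulated T v ->
  exists2 M : R, 0 <= M & forall t, 0 <= t <= T -> `|v t| <= M.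
Proof.
move: v; apply: regulated_ind.
- by move=> k; exists `|k|.
- move=> f c k [M M0 hM]; exists (`|k| + M) => [|t tT]; first by rewrite addr_ge0.
  apply: le_trans (ler_normD _ _) _; rewrite lerD ?hM// normrM ler_piMr//.
  by case: ifP; rewrite ?normr1 ?normr0.
- move=> f c k [M M0 hM]; exists (`|k| + M) => [|t tT]; first by rewrite addr_ge0.
  apply: le_trans (ler_normD _ _) _; rewrite lerD ?hM// normrM ler_piMr//.
  by case: ifP; rewrite ?normr1 ?normr0.
- move=> f /(_ 1 ltr01)[g [M M0 hM] fg]; exists (M + 1); first lra.
  move=> t tT; have := fg t tT; have := hM t tT.
  by rewrite !ler_norml; lra.
Qed.

Lemma regulated_KSint T v g V : 0 < T -> control 0 T V g -> regulated T v ->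
  exists I, is_KSint 0 T v g I.
Proof.
move=> T0 cV; move: v; apply: regulated_ind.
- by move=> k; exists (k * g T - k * g 0); exact: is_KSint_cst.
- move=> f c k [I hI]; have [J hJ] := is_KSint_indic_lt c T0 cV.
  by exists (k * J + I); exact: is_KSint_lin.
- move=> f c k [I hI]; have [J hJ] := is_KSint_indic_le c T0 cV.
  by exists (k * J + I); exact: is_KSint_lin.
- by move=> f h; apply: (is_KSint_unif T0 cV).
Qed.

Lemma lims_regulated T v : 0 < T ->
  (forall t, 0 <= t < T -> exists l, right_lim v t l) ->
  (forall t, 0 < t <= T -> exists l, left_lim v t l) -> regulated T v.
Proof.
move=> T0 hr hl e e0.
pose Q c := exists2 f, step_fun c f & forall x, 0 <= x <= c -> `|v x - f x| <= e.
suff [f sf hf] : Q T by exists f => // x; rewrite in_itv/=; exact: hf.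
have ext s t l : s < t -> (forall x, s < x < t -> `|v x - l| <= e) -> Q s -> Q t.
  move=> st vl [f [ss [sp /eqP sl] fs] vf].
  exists (fun y => if y <= s then f y else if y < t then l else v t).
    exists (rcons ss t); first by split; [rewrite rcons_path sp sl|rewrite last_rcons].
    have le_s i : (i <= size ss)%N -> (0 :: ss)`_i <= s.
      have so : sorted <=%R (0 :: ss).
        by rewrite /=; apply: sub_path sp => ? ?; exact: ltW.
      have := sorted_leq_nth le_trans lexx 0 so => /(_ i (size ss)); rewrite !inE/= => h iN.
      rewrite -sl (last_nth 0); apply: h => //; exact: ltnW.
    move=> i; rewrite size_rcons ltnS leq_eqVlt => /predU1P[->|iN].
      rewrite -rcons_cons !nth_rcons/= ltnSn ltnn eqxx -(last_nth 0) sl => x y.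
      by rewrite !in_itv/= !ltNge => /andP[/negbTE -> /negbTE ->] /andP[/negbTE -> /negbTE ->].
    rewrite -rcons_cons !nth_rcons/= iN ltnS (ltnW iN) => x y.
    rewrite !in_itv/= => xi yi.
    have := le_s i.+1 iN => /= hs.
    rewrite !ifT; [|lra|lra].
    by apply: (fs i) => //; rewrite in_itv.
  move=> x xt; case: (leP x s) => xs; first by apply: vf; lra.
  by case: (ltP x t) => xt'; [apply: vl; lra|rewrite (_ : x = t) ?subrr ?normr0 ?ltW//; lra].
apply: (@chain_induction _ Q 0 T T0); last first.
  exists v; last by move=> x _; rewrite subrr normr0 ltW.
  by exists [::] => //; split.
move=> x xT.
have [d d0 hd] : exists2 d : R, 0 < d & forall t, x < t -> t <= T -> t < x + d -> exists l,
  forall y, x < y < t -> `|v y - l| <= e.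
  case: (ltP x T) => xT'; last by exists 1 => // t xt tT; exfalso; lra.
  have [|l /(_ e e0)[d d0 hd]] := hr x; first lra.
  by exists d => // t xt tT tx; exists l => y yt; apply/ltW/hd; lra.
have [d' d'0 hd'] : exists2 d : R, 0 < d & forall t, t < x -> 0 <= t -> x - d < t -> exists l,
  forall y, t < y < x -> `|v y - l| <= e.
  case: (ltP 0 x) => xT'; last by exists 1 => // t xt tT; exfalso; lra.
  have [|l /(_ e e0)[d' d'0 hd']] := hl x; first lra.
  by exists d' => // t xt tT tx; exists l => y yt; apply/ltW/hd'; lra.
exists (Num.min d d'); first by rewrite lt_min d0.
move=> s t s0 sx xt tT; rewrite ltrBlDl -ltrBlDr -ltrBlDl !lt_min => /andP[xs1 xs2] /andP[xt1 xt2] st Qs.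
have Qx : Q x.
  move: sx; rewrite le_eqVlt => /predU1P[<-//|sx].
  by have [|l hl'] := hd' s sx s0; [lra|exact: ext hl' Qs].
move: xt; rewrite le_eqVlt => /predU1P[<-//|xt].
by have [|l hl'] := hd t xt tT; [lra|exact: ext hl' Qx].
Qed.

Lemma control_regulated T V v : 0 < T -> control 0 T V v -> regulated T v.
Proof.
by move=> T0 cV; apply: lims_regulated => // t tT;
  [exact: control_right_lim cV tT|exact: control_left_lim cV tT].
Qed.

Lemma cts_right_lim a b v t : cts a b v -> a <= t < b -> right_lim v t (v t).
Proof.
move=> cv tab e e0; have [|d d0 hd] := cv t _ e e0; first lra.
exists (Num.min d (b - t)); first by rewrite lt_min d0; lra.
move=> x /andP[tx]; rewrite -ltrBlDl lt_min => /andP[xd xb].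
by apply: hd; [|rewrite ger0_norm]; lra.
Qed.

Lemma cts_left_lim a b v t : cts a b v -> a < t <= b -> left_lim v t (v t).
Proof.
move=> cv tab e e0; have [|d d0 hd] := cv t _ e e0; first lra.
exists (Num.min d (t - a)); first by rewrite lt_min d0; lra.
move=> x /andP[]; rewrite ltrBlDl -ltrBlDr lt_min => /andP[xd xb] xt.
by apply: hd; [|rewrite ltr0_norm]; lra.
Qed.

Lemma cts_regulated T v : 0 < T -> cts 0 T v -> regulated T v.
Proof.
by move=> T0 cv; apply: lims_regulated => // t tT; exists (v t);
  [exact: cts_right_lim cv tT|exact: cts_left_lim cv tT].
Qed.

End KS.

(** * The stop operator by monotonicity of the play *)

Section stop.
Variable R : realType.
Implicit Types (a b c e s t x l k T r M : R) (f g u v w y V W p q : R -> R).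

(** The stop of [u] without an integral: the play [u - y] can increase only while [y] touches
    [r] and can decrease only while [y] touches [- r].  This makes sense for every continuous
    [u], also of unbounded variation. *)
Definition stopsol T r u y :=
  [/\ cts 0 T y, forall t, 0 <= t <= T -> - r <= y t <= r,
    (forall s t, 0 <= s -> s <= t -> t <= T -> (forall x, s <= x <= t -> y x < r) ->
      u t - y t <= u s - y s) &
    (forall s t, 0 <= s -> s <= t -> t <= T -> (forall x, s <= x <= t -> - r < y x) ->
      u s - y s <= u t - y t)].

Lemma stopsol_opp T r u y : stopsol T r u y -> stopsol T r (fun t => - u t) (fun t => - y t).
Proof.
move=> [cy yr d1 d2]; split.
- exact: ctsN.
- by move=> t /yr; lra.
- move=> s t s0 st tT h; have := d2 s t s0 st tT.
  by move=> /(_ ltac:(move=> x /h; lra)); lra.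
- move=> s t s0 st tT h; have := d1 s t s0 st tT.
  by move=> /(_ ltac:(move=> x /h; lra)); lra.
Qed.

(** After the last point at which [f <= 0], the function is positive and hence cannot exceed
    its values just after that point, which are arbitrarily small. *)
Lemma no_crossing a b f : a <= b -> cts a b f -> f a <= 0 ->
  (forall s t, a <= s -> s < t -> t <= b -> (forall x, s <= x <= t -> 0 < f x) -> f t <= f s) ->
  f b <= 0.
Proof.
move=> ab cf fa h; rewrite leNgt; apply/negP => fb.
pose S := [set x | a <= x <= b /\ f x <= 0].
have Sa : S a by split => //; rewrite lexx.
have uS : ubound S b by move=> x [/andP[]].
have hS : has_sup S by split; [exists a|exists b].
set c := sup S.
have ac : a <= c by apply: ub_le_sup => //; exists b.
have cb : c <= b by apply: ge_sup => //; exists a.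
have above x : c < x -> x <= b -> 0 < f x.
  move=> cx xb; rewrite ltNge; apply/negP => fx.
  have : x <= c by apply: ub_le_sup; [exists b|split => //; lra].
  lra.
have fc : f c <= 0.
  apply/ler_addgt0Pr => e e0; rewrite add0r.
  have [|d d0 hd] := cf c _ e e0; first lra.
  have [s [sab fs] cs] := sup_adherent d0 hS.
  have sc : s <= c by apply: ub_le_sup => //; exists b.
  rewrite -/c in cs.
  by have := hd s sab ltac:(rewrite ltr_norml; lra); rewrite ltr_norml; lra.
have cltb : c < b.
  by rewrite lt_neqAle cb andbT; apply/eqP => cb'; move: fc fb; rewrite cb'; lra.
suff : f b <= f c by lra.
apply/ler_addgt0Pr => e e0; have [|d d0 hd] := cf c _ e e0; first lra.
pose s := c + Num.min d (b - c) / 2.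
have m0 : 0 < Num.min d (b - c) by rewrite lt_min d0; lra.
have m1 : Num.min d (b - c) <= d by rewrite ge_min lexx.
have m2 : Num.min d (b - c) <= b - c by rewrite ge_min lexx orbT.
have := h s b; rewrite /s => /(_ ltac:(lra) ltac:(lra) ltac:(lra)).
move=> /(_ ltac:(move=> x xx; apply: above; lra)).
by have := hd s; rewrite /s => /(_ ltac:(lra) ltac:(rewrite ltr_norml; lra)); rewrite ltr_norml; lra.
Qed.

(** While the gap between the two plays exceeds [M], the first output is below [r] and the
    second one above [- r], so that the gap cannot grow. *)
Lemma stopsol_compare T r u1 u2 y1 y2 a b M : cts 0 T u1 -> cts 0 T u2 ->
  stopsol T r u1 y1 -> stopsol T r u2 y2 -> 0 <= a -> a <= b -> b <= T ->
  (u1 a - y1 a) - (u2 a - y2 a) <= M -> (forall x, a <= x <= b -> u1 x - u2 x <= M) ->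
  (u1 b - y1 b) - (u2 b - y2 b) <= M.
Proof.
move=> cu1 cu2 [cy1 yr1 d1 _] [cy2 yr2 _ d2] a0 ab bT ha huM.
rewrite -subr_le0.
apply: (@no_crossing a b (fun x => (u1 x - y1 x) - (u2 x - y2 x) - M)) => //; last 2 first.
- by rewrite subr_le0.
- move=> s t as_ st tb h.
  have h1 x : s <= x <= t -> y1 x < r.
    by move=> xst; have := h x xst; have := huM x; have := yr2 x; lra.
  have h2 x : s <= x <= t -> - r < y2 x.
    by move=> xst; have := h x xst; have := huM x; have := yr1 x; lra.
  have := d1 s t ltac:(lra) ltac:(lra) ltac:(lra) h1.
  have := d2 s t ltac:(lra) ltac:(lra) ltac:(lra) h2; lra.
apply: (@cts_sub _ 0 T) => //.
by apply: ctsB; [apply: ctsB; exact: ctsB|exact: cts_cst].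
Qed.

Lemma stopsol_lip_from T r u1 u2 y1 y2 a b M : cts 0 T u1 -> cts 0 T u2 ->
  stopsol T r u1 y1 -> stopsol T r u2 y2 -> 0 <= a -> a <= b -> b <= T ->
  `|(u1 a - y1 a) - (u2 a - y2 a)| <= M -> (forall x, a <= x <= b -> `|u1 x - u2 x| <= M) ->
  `|(u1 b - y1 b) - (u2 b - y2 b)| <= M.
Proof.
move=> c1 c2 s1 s2 a0 ab bT; rewrite !ler_norml => h hu.
have := stopsol_compare c1 c2 s1 s2 a0 ab bT (M := M).
have := stopsol_compare c2 c1 s2 s1 a0 ab bT (M := M).
move=> /(_ ltac:(lra) ltac:(move=> x /hu; rewrite ler_norml; lra)) ?.
by move=> /(_ ltac:(lra) ltac:(move=> x /hu; rewrite ler_norml; lra)) ?; lra.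
Qed.

Lemma stopsol_lip T r u1 u2 y1 y2 M : cts 0 T u1 -> cts 0 T u2 ->
  stopsol T r u1 y1 -> stopsol T r u2 y2 -> y1 0 = y2 0 ->
  (forall x, 0 <= x <= T -> `|u1 x - u2 x| <= M) ->
  forall t, 0 <= t <= T -> `|y1 t - y2 t| <= 2 * M.
Proof.
move=> c1 c2 s1 s2 y0 h t tT.
have h0 : `|u1 0 - y1 0 - (u2 0 - y2 0)| <= M.
  by have := h 0 ltac:(lra); rewrite !ler_norml y0; lra.
have ht x : 0 <= x <= t -> `|u1 x - u2 x| <= M by move=> xt; apply: h; lra.
have t0 : 0 <= t by lra.
have tT2 : t <= T by lra.
have := stopsol_lip_from c1 c2 s1 s2 (lexx 0) t0 tT2 h0 ht.
by have := h t tT; rewrite !ler_norml; lra.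
Qed.

Lemma stopsol_uniq T r u y1 y2 : cts 0 T u ->
  stopsol T r u y1 -> stopsol T r u y2 -> y1 0 = y2 0 ->
  forall t, 0 <= t <= T -> y1 t = y2 t.
Proof.
move=> cu s1 s2 y0 t tT; have := stopsol_lip cu cu s1 s2 y0 (M := 0).
move=> /(_ ltac:(move=> x _; rewrite subrr normr0 lexx//) t tT).
by rewrite mulr0 normr_le0 subr_eq0 => /eqP.
Qed.

(** While [y1 > y2], the first play cannot decrease and the second one cannot increase, so that
    [y1 - y2] does not grow. *)
Lemma stopsol_le T r u1 u2 y1 y2 : cts 0 T u1 -> cts 0 T u2 ->
  stopsol T r u1 y1 -> stopsol T r u2 y2 -> y1 0 = y2 0 ->
  (forall s t, 0 <= s -> s <= t -> t <= T -> u2 s - u1 s <= u2 t - u1 t) ->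
  forall t, 0 <= t <= T -> y1 t <= y2 t.
Proof.
move=> cu1 cu2 [cy1 yr1 _ d1] [cy2 yr2 d2 _] y0 hu b bT.
rewrite -subr_le0.
apply: (@no_crossing 0 b (fun x => y1 x - y2 x)); [lra| |lra|].
  by apply: (@cts_sub _ 0 T); [lra|lra|exact: ctsB].
move=> s t as_ st tb h.
have h1 x : s <= x <= t -> - r < y1 x.
  by move=> xst; have := h x xst; have := yr2 x; lra.
have h2 x : s <= x <= t -> y2 x < r.
  by move=> xst; have := h x xst; have := yr1 x; lra.
have := d1 s t ltac:(lra) ltac:(lra) ltac:(lra) h1.
have := d2 s t ltac:(lra) ltac:(lra) ltac:(lra) h2.
have := hu s t; lra.
Qed.

Lemma cts_cat a b c f g : a <= b -> b <= c -> cts a b f -> cts b c g -> f b = g b ->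
  cts a c (fun x => if x <= b then f x else g x).
Proof.
move=> ab bc cf cg fg t tac e e0.
case: (ltgtP t b) => tb.
- have [|d d0 hd] := cf t _ e e0; first lra.
  exists (Num.min d (b - t)); first by rewrite lt_min d0; lra.
  move=> s sac; rewrite lt_min => /andP[sd]; rewrite ltr_norml => sb.
  by rewrite (_ : s <= b); [apply: hd => //; lra|lra].
- have [|d d0 hd] := cg t _ e e0; first lra.
  exists (Num.min d (t - b)); first by rewrite lt_min d0; lra.
  move=> s sac; rewrite lt_min => /andP[sd]; rewrite ltr_norml => sb.
  by rewrite (_ : (s <= b) = false); [apply: hd => //; lra|apply/negbTE; rewrite -ltNge; lra].
- subst t; have [|d d0 hd] := cf b _ e e0; first lra.
  have [|d' d'0 hd'] := cg b _ e e0; first lra.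
  exists (Num.min d d'); first by rewrite lt_min d0.
  move=> s sac; rewrite lt_min => /andP[sd sd'].
  by case: (leP s b) => sb; [apply: hd => //; lra|rewrite fg; apply: hd' => //; lra].
Qed.

Lemma running_min a b u : a < b -> cts a b u -> exists m : R -> R,
  [/\ forall t, a <= t <= b -> forall s, a <= s <= t -> m t <= u s,
      forall t, a <= t <= b -> exists2 s, a <= s <= t & m t = u s & cts a b m].
Proof.
move=> ab cu.
have /choice[m hm] : forall t, exists m, a <= t <= b ->
    (forall s, a <= s <= t -> m <= u s) /\ exists2 s, a <= s <= t & m = u s.
  move=> t; case: (boolP (a <= t <= b)) => [tab|_]; last by exists 0.
  have [at_ tb] := andP tab.
  have [s sat hs] := cts_argmin at_ (cts_sub (lexx a) tb cu).
  by exists (u s) => _; split => //; exists s.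
have h1 t : a <= t <= b -> forall s, a <= s <= t -> m t <= u s by move=> /hm[].
have h2 t : a <= t <= b -> exists2 s, a <= s <= t & m t = u s by move=> /hm[].
exists m; split => //.
suff H e : 0 < e -> exists2 d : R, 0 < d & forall s t, a <= s -> s <= t -> t <= b ->
    t - s < d -> `|m s - m t| < e.
  move=> t tab e /H[d d0 hd]; exists d => // s sab; rewrite ltr_norml => sd.
  by case: (leP s t) => st; [|rewrite distrC]; apply: hd; lra.
move=> e0; have [d d0 hd] := cts_uniform ab cu e0; exists d => // s t as_ st tb sd.
have mts : m t <= m s.
  by have [|x xs ->] := h2 s; [lra|apply: h1; lra].
have [|x xt mt] := h2 t; first lra.
rewrite ger0_norm ?subr_ge0//; case: (leP x s) => xs.
  by have := h1 s ltac:(lra) x ltac:(lra); lra.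
have := h1 s ltac:(lra) s ltac:(lra).
have := hd s x ltac:(lra) ltac:(lra).
by rewrite !ltr_norml => /(_ ltac:(lra)); lra.
Qed.

(** As long as [u] oscillates by at most [r], an output that starts at [y a <= 0] needs no
    push at [r].  Only the lower constraint acts, and the play is a running minimum. *)
Lemma stopsol_extend_up r u y a b : 0 < r -> 0 <= a -> a < b -> cts 0 b u ->
  (forall x x', a <= x <= b -> a <= x' <= b -> u x - u x' <= r) ->
  y a <= 0 -> stopsol a r u y ->
  exists2 y', stopsol b r u y' & y' 0 = y 0.
Proof.
move=> r0 a0 ab cu osc ya [cy yr d1 d2].
have cu' : cts a b u by apply: cts_sub cu; lra.
have [m [m1 m2 cm]] := running_min ab cu'.
have [w wdef] : exists w, forall t, w t = Num.min (u a - y a) (m t + r).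
  by exists (fun t => Num.min (u a - y a) (m t + r)).
have wle t : w t <= u a - y a by rewrite wdef ge_min lexx.
have wle' t : w t <= m t + r by rewrite wdef ge_min lexx orbT.
have wE t : w t = u a - y a \/ w t = m t + r.
  by rewrite wdef; case: (leP (u a - y a) (m t + r)); [left|right].
have ma : m a = u a.
  by have [|s sa ->] := m2 a; [lra|congr u; lra].
have wa : w a = u a - y a.
  by rewrite wdef ma min_l//; have := yr a; lra.
have mmono s t : a <= s -> s <= t -> t <= b -> m t <= m s.
  by move=> as_ st tb; have [|x xs ->] := m2 s; [lra|apply: m1; lra].
have wmono s t : a <= s -> s <= t -> t <= b -> w t <= w s.
  move=> as_ st tb; have := mmono s t as_ st tb; have := wle t; have := wle' t.
  by case: (wE s) => ->; lra.
have cw : cts a b w.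
  move=> t tab e e0; have [d d0 hd] := cm t tab e e0; exists d => // s sab sd.
  have := hd s sab sd; rewrite !ltr_norml.
  have := wle t; have := wle' t; have := wle s; have := wle' s.
  by case: (wE s) => ->; case: (wE t) => ->; lra.
have [y' ydef] : exists y', forall t, y' t = if t <= a then y t else u t - w t.
  by exists (fun t => if t <= a then y t else u t - w t).
have y'l t : t <= a -> y' t = y t by rewrite ydef => ->.
have y'r t : a <= t -> y' t = u t - w t.
  rewrite le_eqVlt => /predU1P[<-|at_]; first by rewrite y'l// wa; ring.
  by rewrite ydef leNgt at_.
have y'bd t : a <= t <= b -> - r <= y' t <= r.
  move=> tab; rewrite y'r; last lra.
  have := wle' t; have := m1 t tab t ltac:(lra).
  have := osc t a ltac:(lra) ltac:(lra).
  have [s sat ms] := m2 t tab; have := osc t s ltac:(lra) ltac:(lra).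
  by case: (wE t) => ->; lra.
have new1 s t : a <= s -> s <= t -> t <= b -> u t - y' t <= u s - y' s.
  by move=> as_ st tb; have := wmono s t as_ st tb; rewrite !y'r; lra.
have new2 s t : a <= s -> s <= t -> t <= b -> (forall x, s <= x <= t -> - r < y' x) ->
    u s - y' s <= u t - y' t.
  move=> as_ st tb h; rewrite !y'r; [|lra..].
  suff : w s <= w t by lra.
  case: (wE t) => [->//|wt]; rewrite wt.
  have [|x xat mx] := m2 t; first lra.
  case: (leP x s) => xs.
    by apply: le_trans (wle' s) _; rewrite lerD2r mx; apply: m1; lra.
  have := h x; rewrite y'r; last lra.
  have := wmono x t; rewrite wt mx; lra.
exists y'; last by rewrite y'l.
split.
- have ua : y a = u a - w a by rewrite wa; ring.
  by apply: cts_ext (cts_cat a0 (ltW ab) cy (ctsB cu' cw) ua) => t _; rewrite ydef.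
- by move=> t tb; case: (leP t a) => ta; [rewrite y'l//; apply: yr; lra|apply: y'bd; lra].
- move=> s t s0 st tb h; case: (leP t a) => ta.
    rewrite !y'l; [|lra..]; apply: d1 => // x xst.
    by have := h x xst; rewrite y'l//; lra.
  case: (leP a s) => sa; first exact: new1.
  have := new1 a t (lexx _) ltac:(lra) tb.
  have := d1 s a s0 ltac:(lra) (lexx _); rewrite (y'l s) ?(y'l a)//; last lra.
  move=> /(_ ltac:(move=> x xx; have := h x; rewrite y'l; lra)); lra.
- move=> s t s0 st tb h; case: (leP t a) => ta.
    rewrite !y'l; [|lra..]; apply: d2 => // x xst.
    by have := h x xst; rewrite y'l//; lra.
  case: (leP a s) => sa; first exact: new2.
  have := new2 a t (lexx _) ltac:(lra) tb.
  have := d2 s a s0 ltac:(lra) (lexx _); rewrite (y'l s) ?(y'l a)//; last lra.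
  move=> /(_ ltac:(move=> x xx; have := h x; rewrite y'l; lra)) h1.
  by move=> /(_ ltac:(move=> x xx; apply: h; lra)); lra.
Qed.

Lemma stopsol_extend r u y a b : 0 < r -> 0 <= a -> a < b -> cts 0 b u ->
  (forall x x', a <= x <= b -> a <= x' <= b -> u x - u x' <= r) ->
  stopsol a r u y ->
  exists2 y', stopsol b r u y' & y' 0 = y 0.
Proof.
move=> r0 a0 ab cu osc sy; case: (leP (y a) 0) => ya.
  exact: (stopsol_extend_up r0 a0 ab cu osc ya sy).
have [| |y' sy' y'0] := stopsol_extend_up r0 a0 ab (ctsN cu) _ _ (stopsol_opp sy).
- by move=> x x' xab x'ab; have := osc x' x x'ab xab; lra.
- lra.
exists (fun t => - y' t); last by rewrite y'0 opprK.
have := stopsol_opp sy'; congr stopsol; apply/funext => t; exact: opprK.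
Qed.

Lemma stopsol_ex T r u (y0 : R) : 0 < T -> 0 < r -> - r <= y0 <= r -> cts 0 T u ->
  exists2 y, stopsol T r u y & y 0 = y0.
Proof.
move=> T0 r0 y0r cu.
apply: (@chain_induction _ (fun c => exists2 y, stopsol c r u y & y 0 = y0) 0 T T0); last first.
  exists (fun=> y0) => //; split => //; first exact: cts_cst.
    by move=> s t s0 st tT _; rewrite (_ : s = t)//; lra.
  by move=> s t s0 st tT _; rewrite (_ : s = t)//; lra.
move=> x xT; have [|d d0 hd] := cu x xT (r / 2); first lra.
exists d => // s t s0 sx xt tT ds dt st [y sy y0E].
have [|z z' zst z'st|y' sy' y'0] := stopsol_extend r0 s0 st _ _ sy.
- by apply: cts_sub cu; lra.
- have := hd z ltac:(lra) ltac:(rewrite ltr_norml; lra).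
  have := hd z' ltac:(lra) ltac:(rewrite ltr_norml; lra).
  by rewrite !ltr_norml; lra.
by exists y' => //; rewrite y'0.
Qed.

Lemma stopsol_local T r u y t : 0 < r -> stopsol T r u y -> 0 <= t <= T ->
  exists2 d : R, 0 < d & (forall x, 0 <= x <= T -> `|x - t| < d -> y x < r) \/
    (forall x, 0 <= x <= T -> `|x - t| < d -> - r < y x).
Proof.
move=> r0 [cy yr _ _] tT; have [d d0 hd] := cy t tT r r0; exists d => //.
case: (leP (y t) 0) => yt; [left|right] => x xT xd;
  by have := hd x xT xd; rewrite ltr_norml; lra.
Qed.

(** Near every time only one of the two constraints can act, so that the play is locally
    monotone. *)
Lemma stopsol_BV T r u y : 0 < T -> 0 < r -> stopsol T r u y -> BV T u -> BV T y.
Proof.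
move=> T0 r0 sy /(BV_control T0)[V hV].
suff : BV T (fun t => u t - y t).
  move=> /(BV_control T0)[W hW].
  apply: (@control_BV _ T (fun t => V t + W t) y T0).
  have := controlD hV (controlN hW); congr control; apply/funext => t; ring.
have [cy yr d1 d2] := sy.
pose Q c := c = 0 \/ exists V, control 0 c V (fun t => u t - y t).
suff [TT|[W hW]] : Q T; [lra|exact: control_BV hW|].
apply: (@chain_induction _ Q 0 T T0); last by left.
move=> x xT; have [d d0 hd] := stopsol_local r0 sy xT; exists d => // s t s0 sx xt tT ds dt st Qs.
right.
have [W0 hW0] : exists W, control 0 s W (fun t => u t - y t).
  case: Qs => [->|//]; exists (fun=> 0) => a b a0 ab b0.
  by rewrite (_ : a = b) ?subrr ?normr0//; lra.
have [W1 hW1] : exists W, control s t W (fun t => u t - y t).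
  case: hd => hd.
    exists (fun t => - (u t - y t)) => a b a0 ab b0.
    have h : u b - y b <= u a - y a.
      by apply: d1; [lra..|] => z zab; apply: hd; [|rewrite ltr_norml]; lra.
    by rewrite ler_norml; lra.
  exists (fun t => u t - y t) => a b a0 ab b0.
  have h : u a - y a <= u b - y b.
    by apply: d2; [lra..|] => z zab; apply: hd; [|rewrite ltr_norml]; lra.
  by rewrite ler_norml; lra.
exists (fun z => if z <= s then W0 z else W0 s + (W1 z - W1 s)) => a b a0 ab bt.
case: (leP b s) => bs.
  by rewrite (_ : a <= s); [exact: hW0|lra].
case: (leP a s) => as_; last first.
  rewrite (_ : _ - (W0 s + _) = W1 b - W1 a); last ring.
  by apply: hW1; lra.
have := hW0 a s a0 as_ (lexx _); have := hW1 s b (lexx _) ltac:(lra) bt.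
have := ler_normD (u b - y b - (u s - y s)) (u s - y s - (u a - y a)).
by rewrite addrA subrK; lra.
Qed.

End stop.

(** * Equivalence with the variational inequality *)

Section variational_inequality.
Variable R : realType.
Implicit Types (a b c e s t x l k T r M : R) (f g u v w y V W p q : R -> R).

Lemma stopsol_near_lt T r u y t : stopsol T r u y -> 0 <= t <= T -> y t < r ->
  exists2 d : R, 0 < d & forall s x, 0 <= s -> s <= x -> x <= T -> t - d < s -> x < t + d ->
    (forall z, s <= z <= x -> y z < r) /\ u x - y x <= u s - y s.
Proof.
move=> [cy yr d1 _] tT yt; have [|d d0 hd] := cy t tT (r - y t); first lra.
exists d => // s x s0 sx xT ds dx.
have h z : s <= z <= x -> y z < r.
  move=> /andP[sz zx]; have zT : 0 <= z <= T by rewrite (le_trans s0 sz) (le_trans zx xT).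
  have : `|z - t| < d by rewrite ltr_distl (lt_le_trans ds sz) (le_lt_trans zx dx).
  by move=> /(hd z zT); rewrite ltr_norml ltrD2r => /andP[].
by split => //; apply: d1.
Qed.

Lemma stopsol_near_gt T r u y t : stopsol T r u y -> 0 <= t <= T -> - r < y t ->
  exists2 d : R, 0 < d & forall s x, 0 <= s -> s <= x -> x <= T -> t - d < s -> x < t + d ->
    (forall z, s <= z <= x -> - r < y z) /\ u s - y s <= u x - y x.
Proof.
move=> sy tT yt; have [|d d0 hd] := stopsol_near_lt (stopsol_opp sy) tT; first lra.
exists d => // s x s0 sx xT ds dx; have [h1 h2] := hd s x s0 sx xT ds dx.
by split => [z /h1|]; lra.
Qed.

(** In a fine sum every term is nonnegative: the play is constant near tags with [|y| < r],
    and at a tag with [y = r], where [v - y <= 0], it can only increase. *)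
Lemma stopsol_VI T r u y v I : 0 < T -> 0 < r -> stopsol T r u y ->
  (forall t, 0 <= t <= T -> - r <= v t <= r) ->
  is_KSint 0 T (v \- y) (y \- u) I -> 0 <= I.
Proof.
move=> T0 r0 sy vr hI; rewrite -(subrr 0).
apply: (@KSint_ge_telescope _ 0 T _ _ (fun=> 0) 0 I T0 hI) => e e0.
have /local_choice[d [d0 hd]] : forall x, 0 <= x <= T -> exists2 d : R, 0 < d &
    forall s t, 0 <= s -> s <= x -> x <= t -> t <= T -> x - d < s -> t < x + d ->
      0 <= (v \- y) x * ((y \- u) t - (y \- u) s).
  move=> x xT; have vx := vr x xT; have [_ yr _ _] := sy; have yx := yr x xT.
  have [d1 d10 hd1] : exists2 d : R, 0 < d & forall s t, 0 <= s -> s <= x -> x <= t -> t <= T ->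
    x - d < s -> t < x + d ->
      y x < r -> u t - y t <= u s - y s.
    case: (ltP (y x) r) => yxr; last by exists 1.
    have [d d0 hd] := stopsol_near_lt sy xT yxr; exists d => // s t s0 sx xt tT ds dt _.
    by have [] := hd s t s0 (le_trans sx xt) tT ds dt.
  have [d2 d20 hd2] : exists2 d : R, 0 < d & forall s t, 0 <= s -> s <= x -> x <= t -> t <= T ->
    x - d < s -> t < x + d ->
      - r < y x -> u s - y s <= u t - y t.
    case: (ltP (- r) (y x)) => yxr; last by exists 1.
    have [d d0 hd] := stopsol_near_gt sy xT yxr; exists d => // s t s0 sx xt tT ds dt _.
    by have [] := hd s t s0 (le_trans sx xt) tT ds dt.
  exists (Num.min d1 d2); first by rewrite lt_min d10.
  move=> s t s0 sx xt tT; rewrite ltrBlDl -ltrBlDr -ltrBlDl !lt_min => /andP[ds1 ds2] /andP[dt1 dt2] /=.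
  have h1 := hd1 s t s0 sx xt tT ltac:(lra) ltac:(lra).
  have h2 := hd2 s t s0 sx xt tT ltac:(lra) ltac:(lra).
  case: (ltP (y x) r) h1 => yxr h1; case: (ltP (- r) (y x)) h2 => yxr' h2.
  - have E : y t - u t - (y s - u s) = 0 by have := h1 isT; have := h2 isT; lra.
    by rewrite E mulr0.
  - by apply: mulr_ge0; have := h1 isT; lra.
  - by rewrite -mulrNN; apply: mulr_ge0; have := h2 isT; lra.
  - lra.
exists d => //; exists (fun=> 0); first by rewrite subrr.
move=> x s t [[s0 sx xt tT] [st ds dt]]; rewrite !subrr mulr0 subrr.
by apply: hd => //; lra.
Qed.

(** Chain rule for the primitive of [o * (1 - o)], with the error that telescoping needs. *)
Lemma bump_primitive (o p q e : R) : 0 <= o <= 1 -> 0 <= p <= 1 -> 0 <= q <= 1 ->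
  `|p - o| <= e -> `|q - o| <= e ->
  `|o * (1 - o) * (p - q) - ((p ^+ 2 / 2 - p ^+ 3 / 3) - (q ^+ 2 / 2 - q ^+ 3 / 3))|
    <= 3 * e * `|p - q|.
Proof.
move=> o1 p1 q1 po qo.
rewrite (_ : _ - _ = (o * (1 - o) - ((p + q) / 2 - (p ^+ 2 + p * q + q ^+ 2) / 3)) * (p - q));
  last first.
  by field.
rewrite normrM ler_wpM2r//.
have e0 : 0 <= e by apply: le_trans po.
have h1 : `|(p - o) * (p + o)| <= e * 2.
  rewrite normrM; apply: ler_pM => //; rewrite ger0_norm; lra.
have h2 : `|(q - o) * (q + o)| <= e * 2.
  rewrite normrM; apply: ler_pM => //; rewrite ger0_norm; lra.
have h3 : `|(p - o) * q| <= e * 1.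
  rewrite normrM; apply: ler_pM => //; rewrite ger0_norm; lra.
have h4 : `|o * (q - o)| <= 1 * e.
  rewrite normrM; apply: ler_pM => //; rewrite ger0_norm; lra.
rewrite (_ : _ - _ = - ((p - o) / 2 + (q - o) / 2) + ((p - o) * (p + o) + (p - o) * q + o * (q - o) + (q - o) * (q + o)) / 3); last by field.
by move: h1 h2 h3 h4 po qo; rewrite !ler_norml; lra.
Qed.

Definition clamp a b t := Num.max a (Num.min b t).

Section clamp.
Variables (p q : R).
Hypothesis pq : p <= q.

Lemma clamp_in t : p <= clamp p q t <= q.
Proof. by rewrite /clamp le_max lexx/= ge_max pq/= ge_min lexx. Qed.

Lemma clamp_l t : t <= p -> clamp p q t = p.
Proof. by move=> tp; rewrite /clamp max_l// ge_min tp orbT. Qed.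

Lemma clamp_r t : q <= t -> clamp p q t = q.
Proof. by move=> tq; rewrite /clamp min_l// max_r. Qed.

Lemma clamp_id t : p <= t <= q -> clamp p q t = t.
Proof. by move=> /andP[h1 h2]; rewrite /clamp min_r// max_r. Qed.

Lemma clamp_incr s t : s <= t -> clamp p q s <= clamp p q t <= clamp p q s + (t - s).
Proof.
move=> st; have h0 : 0 <= t - s by rewrite subr_ge0.
have /andP[s1 s2] := clamp_in s; have /andP[t1 t2] := clamp_in t.
case: (leP t p) => tp; first by rewrite !clamp_l ?lexx ?lerDl// (le_trans st).
case: (leP q s) => qs; first by rewrite !clamp_r ?lexx ?lerDl// (le_trans qs).
have tE : clamp p q t <= t by rewrite /clamp ge_max (ltW tp) ge_min lexx orbT.
have sE : s <= clamp p q s by rewrite /clamp le_max le_min (ltW qs) lexx orbT.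
apply/andP; split; last by rewrite addrA lerBrDr [leRHS]addrC lerD.
case: (leP s p) => sp; first by rewrite (clamp_l sp).
rewrite (clamp_id (t := s)) ?(ltW sp) ?(ltW qs)//.
by rewrite /clamp !le_max !le_min (ltW qs) st orbT.
Qed.

Lemma cts_clamp a b : cts a b (clamp p q).
Proof.
apply: (@cts_lip _ _ _ 1) => s t _ _; rewrite mul1r.
have H x x' : x <= x' -> `|clamp p q x' - clamp p q x| <= `|x' - x|.
  by move=> xx; have /andP[h1 h2] := clamp_incr xx; rewrite !ger0_norm ?subr_ge0// lerBlDl.
case: (leP s t) => [st|/ltW/H//].
by rewrite (distrC s) (distrC (clamp p q s)); exact: H.
Qed.

End clamp.

(** If the play decreased on an interval on which [- r < y], then let [om] be the play,
    rescaled so as to run from [1] at its maximum to [0] at its later minimum.  The test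
    function [y - k * om * (1 - om)] is admissible for small [k > 0], and its integral is
    [- k / 6] times the decrease of the play. *)
Lemma VI_stopsol_up T r u y : 0 < T -> 0 < r -> cts 0 T u -> BV T u -> cts 0 T y -> BV T y ->
  (forall t, 0 <= t <= T -> - r <= y t <= r) ->
  (forall v I, cts 0 T v -> (forall t, 0 <= t <= T -> - r <= v t <= r) ->
     is_KSint 0 T (v \- y) (y \- u) I -> 0 <= I) ->
  forall a b, 0 <= a -> a <= b -> b <= T -> (forall x, a <= x <= b -> - r < y x) ->
      u a - y a <= u b - y b.
Proof.
move=> T0 r0 cu bu cy bY yr VI a b a0 ab bT hy; rewrite leNgt; apply/negP => wba.
have [w wE] : exists w, forall t, w t = u t - y t by exists (fun t => u t - y t).
rewrite -!wE in wba.
have cw : cts 0 T w by apply: cts_ext (ctsB cu cy) => t _; rewrite wE.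
have [V hV] : exists V, control 0 T V w.
  have [V1 h1] := BV_control T0 bu; have [V2 h2] := BV_control T0 bY.
  exists (fun t => V1 t + V2 t); rewrite (_ : w = fun t => u t - y t); last exact/funext.
  exact: controlD h1 (controlN h2).
have [a1 /andP[a1a a1b] ha1] := cts_argmax ab (cts_sub a0 bT cw).
have a10 : 0 <= a1 := le_trans a0 a1a.
have [b1 /andP[b1a b1b] hb1] := cts_argmin a1b (cts_sub a10 bT cw).
have b1T : b1 <= T := le_trans b1b bT.
have c12 : w b1 < w a1.
  have := ha1 a; rewrite lexx ab => /(_ isT); have := hb1 b; rewrite lexx a1b => /(_ isT).
  by move=> h1 h2; exact: le_lt_trans h1 (lt_le_trans wba h2).
have a1b1 : a1 < b1 by rewrite lt_neqAle b1a andbT; apply/eqP => E; move: c12; rewrite E ltxx.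
have D0 : 0 < w a1 - w b1 by rewrite subr_gt0.
pose cl := clamp a1 b1.
have clab t : a1 <= cl t <= b1 := clamp_in b1a t.
have cl0T t : 0 <= cl t <= T.
  by have /andP[h1 h2] := clab t; rewrite (le_trans a10 h1) (le_trans h2 b1T).
(* the play [w], stopped at its maximum and minimum and rescaled from [1] to [0] *)
have [om omE] : exists om, forall t, om t = (w (cl t) - w b1) / (w a1 - w b1) by exists (fun t =>
  (w (cl t) - w b1) / (w a1 - w b1)).
have om01 t : 0 <= om t <= 1.
  have /andP[h1 h2] := clab t; rewrite omE ler_pdivrMr// mul1r lerD2r divr_ge0 ?(ltW D0)//=.
    by apply: ha1; rewrite (le_trans a1a h1) (le_trans h2 b1b).
  by rewrite subr_ge0; apply: hb1; rewrite h1 (le_trans h2 b1b).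
have com : cts 0 T om.
  have cc : cts 0 T (fun t => w (cl t))
    by exact: (@cts_comp _ 0 T 0 T cl w (@cts_clamp a1 b1 b1a 0 T) cw (fun x _ => cl0T x)).
  have := ctsZ (w a1 - w b1)^-1 (ctsB cc (@cts_cst R 0 T (w b1))).
  by apply: cts_ext => t _; rewrite omE mulrC.
have oml t : t <= a1 -> om t = 1 by move=> ta; rewrite omE /cl clamp_l// divff// gt_eqF.
have omr t : b1 <= t -> om t = 0 by move=> tb; rewrite omE /cl clamp_r// subrr mul0r.
have [psi psiE] : exists psi, forall t, psi t = om t * (1 - om t) by exists (fun t => om t * (1 - om t)).
have psi01 t : 0 <= psi t <= 1.
  have /andP[h1 h2] := om01 t; rewrite psiE mulr_ge0 ?subr_ge0//=.
  by rewrite mulr_ile1 ?subr_ge0// gerBl.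
have psil t : t <= a1 -> psi t = 0 by move=> ta; rewrite psiE oml// subrr mulr0.
have psir t : b1 <= t -> psi t = 0 by move=> tb; rewrite psiE omr// mul0r.
have cpsi : cts 0 T psi.
  have cq : cts 0 1 (fun x => x * (1 - x)).
    apply: (@cts_lip _ _ _ 1) => p q p1 q1; rewrite mul1r.
    rewrite (_ : _ - _ = (1 - p - q) * (p - q)); last ring.
    by rewrite normrM ler_piMl// ler_norml; lra.
  have := cts_comp com cq (fun t _ => om01 t).
  by apply: cts_ext => t _; rewrite psiE.
have [m0 /andP[m0a m0b] hm0] := cts_argmin (ltW a1b1) (cts_sub a10 b1T cy).
(* the largest [k] such that [y - k] stays above [- r] between [a1] and [b1] *)
have [k k0 kE] : exists2 k, 0 < k & k = y m0 + r.
  exists (y m0 + r) => //; rewrite -ltrBlDr sub0r; apply: hy.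
  by rewrite (le_trans a1a m0a) (le_trans m0b b1b).
have kpsi t : 0 <= k * psi t <= k.
  by have /andP[h1 h2] := psi01 t; rewrite mulr_ge0 ?(ltW k0)//= ler_piMr// ltW.
have [v vE] : exists v, forall t, v t = y t - k * psi t by exists (fun t => y t - k * psi t).
have cv : cts 0 T v by apply: cts_ext (ctsB cy (ctsZ k cpsi)) => t _; rewrite vE.
have vr t : 0 <= t <= T -> - r <= v t <= r.
  move=> tT; have /andP[y1 y2] := yr t tT; have /andP[k1 k2] := kpsi t; rewrite vE.
  rewrite (le_trans _ y2) ?gerBl// andbT.
  case: (leP t a1) => ta; first by rewrite psil// mulr0 subr0.
  case: (leP b1 t) => tb; first by rewrite psir// mulr0 subr0.
  rewrite lerBrDr (le_trans (_ : _ <= y m0))//; last by apply: hm0; rewrite !ltW.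
  by rewrite addrC -lerBrDr opprK -kE.
pose Gp x : R := x ^+ 2 / 2 - x ^+ 3 / 3.
have Dk : 0 < k * (w a1 - w b1) by rewrite mulr_gt0.
have : 0 <= k * (w a1 - w b1) * Gp (om T) - k * (w a1 - w b1) * Gp (om 0).
  apply: (VI v) => //; apply: (@is_KSint_telescope _ _ _ _ _ (fun t =>
    k * (w a1 - w b1) * Gp (om t)) (V b1 - V a1)) => e e0.
  have e'0 : 0 < e / (3 * k) by rewrite divr_gt0// mulr_gt0.
  have /local_choice[d1 [d10 hd1]] : forall x, 0 <= x <= T -> exists2 d : R, 0 < d &
      forall s, 0 <= s <= T -> `|s - x| < d -> `|om s - om x| < e / (3 * k).
    by move=> x xT; apply: com.
  pose d2 x := if (a1 < x) && (x < b1) then Num.min (x - a1) (b1 - x) else 1.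
  exists (fun x => Num.min (d1 x) (d2 x)).
    move=> x xT; rewrite lt_min d10//= /d2; case: ifPn => // /andP[h1 h2].
    by rewrite lt_min !subr_gt0 h1.
  have mono := control_mono hV.
  exists (V \o cl) => [/=|x s t [[s0 sx xt tT] [st]]].
    have /andP[h1 h2] := clab T; have /andP[h3 h4] := clab 0.
    by apply: lerB; apply: mono => //; [exact: le_trans h1|exact: le_trans h4 b1T].
  have near z : `|z - x| < Num.min (d1 x) (d2 x) -> `|z - x| < d1 x /\ `|z - x| < d2 x.
    by rewrite lt_min => /andP[].
  move=> ds dt; have [|ds1 ds2] := near s; first by rewrite ler0_norm ?subr_le0// opprB ltrBlDr -ltrBlDl.
  have [|dt1 dt2] := near t; first by rewrite ger0_norm ?subr_ge0// ltrBlDl.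
  have -> : (v \- y) x * ((y \- u) t - (y \- u) s) = k * (w a1 - w b1) * (psi x * (om t - om s)).
    rewrite /= (_ : v x - y x = - (k * psi x)); last by rewrite vE; ring.
    rewrite (_ : y t - u t - (y s - u s) = - (w t - w s)); last by rewrite !wE; ring.
    case: (leP x a1) => xa; first by rewrite psil//; ring.
    case: (leP b1 x) => xb; first by rewrite psir//; ring.
    move: ds2 dt2; rewrite /d2 xa xb !lt_min !ltr_norml !opprB =>
      /andP[/andP[s1 _] /andP[_ s4]] /andP[/andP[t1 _] /andP[_ t4]].
    rewrite !omE /cl !clamp_id; [by field; rewrite gt_eqF| |].
      by move: s1; rewrite ltrD2r => /ltW ->; rewrite (le_trans sx (ltW xb)).
    by rewrite (le_trans (ltW xa) xt) /=; move: t4; rewrite ltrD2r => /ltW ->.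
  rewrite -mulrBr psiE -mulrBr normrM gtr0_norm//.
  have /ltW h1 := hd1 x (ltac:(by rewrite (le_trans s0 sx) (le_trans xt tT))) t (ltac:(by rewrite tT (le_trans s0 (ltW st)))) dt1.
  have /ltW h2 := hd1 x (ltac:(by rewrite (le_trans s0 sx) (le_trans xt tT))) s (ltac:(by rewrite s0 (le_trans (ltW st) tT))) ds1.
  have h3 := bump_primitive (om01 x) (om01 t) (om01 s) h1 h2.
  apply: (@le_trans _ _ (k * (w a1 - w b1) * (3 * (e / (3 * k)) * `|om t - om s|))).
    by rewrite ler_pM2l.
  have -> : k * (w a1 - w b1) * (3 * (e / (3 * k)) * `|om t - om s|) = e * ((w a1 - w b1) * `|om t - om s|).
    by field; rewrite gt_eqF.
  rewrite ler_pM2l// -{1}(gtr0_norm D0) -normrM !omE.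
  rewrite (_ : (w a1 - w b1) * _ = w (cl t) - w (cl s)); last by field; rewrite gt_eqF.
  have /andP[h4 _] := cl0T s; have /andP[_ h5] := cl0T t.
  by apply: hV => //; have /andP[] := clamp_incr b1a (ltW st).
rewrite omr ?oml ?(le_trans b1b)// /Gp !expr0n/= !expr1n !mul0r subrr mulr0 sub0r oppr_ge0 leNgt => /negP; apply.
by rewrite mulr_gt0// (_ : 1 / 2 - 1 / 3 = 6^-1 :> R) ?invr_gt0//; field.
Qed.

Lemma VI_stopsol T r u y : 0 < T -> 0 < r -> cts 0 T u -> BV T u -> cts 0 T y -> BV T y ->
  (forall t, 0 <= t <= T -> - r <= y t <= r) ->
  (forall v I, cts 0 T v -> (forall t, 0 <= t <= T -> - r <= v t <= r) ->
     is_KSint 0 T (v \- y) (y \- u) I -> 0 <= I) ->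
  stopsol T r u y.
Proof.
move=> T0 r0 cu bu cy bY yr VI; split => //; last exact: VI_stopsol_up VI.
move=> a b a0 ab bT hy.
have BVN f : BV T f -> BV T (fun t => - f t) by exact: bounded_variationN.
have := @VI_stopsol_up T r (fun t => - u t) (fun t =>
  - y t) T0 r0 (ctsN cu) (BVN _ bu) (ctsN cy) (BVN _ bY).
move=> /(_ ltac:(move=> t /yr; lra)) H.
suff : - u a - - y a <= - u b - - y b by lra.
apply: H => //; last by move=> x /hy; lra.
move=> v I cv vr hI; apply: (VI (fun t => - v t)); first exact: ctsN.
  by move=> t /vr; lra.
move=> e /hI[d d0 hd]; exists d => // n t tau tp fp; have := hd n t tau tp fp.
by congr (`|_ - I| < _); apply: eq_bigr => i _ /=; ring.
Qed.

Lemma CBVP T u : CBV T u <-> BV T u /\ cts 0 T u.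
Proof. by split => -[h /ctsP]. Qed.

Lemma is_stopP T r (y0 : R) u y : 0 < T -> 0 < r -> CBV T u ->
  is_stop T r y0 u y <-> [/\ BV T y, stopsol T r u y & y 0 = y0].
Proof.
move=> T0 r0 /CBVP[bu cu].
have ex v y' : BV T y' -> cts 0 T y' -> cts 0 T v -> exists I, is_KSint 0 T (v \- y') (y' \- u) I.
  move=> by' cy' cv; have [V1 h1] := BV_control T0 bu; have [V2 h2] := BV_control T0 by'.
  apply: (regulated_KSint T0 (controlD h2 (controlN h1))).
  by apply: cts_regulated => //; exact: ctsB.
split=> [[/CBVP[bY cy] VI yr yE]|[bY sy yE]].
  split => //; apply: VI_stopsol => //.
  move=> v I cv vr hI; rewrite -(KSintE T0 hI); apply: VI; first exact/ctsP.
  by move=> t; rewrite !in_itv/=; exact: vr.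
have [cy yr _ _] := sy.
split => //.
- exact/CBVP.
- move=> v /ctsP cv vr; have [I hI] := ex v y bY cy cv.
  rewrite (KSintE T0 hI); apply: (stopsol_VI T0 r0 sy _ hI).
  by move=> t tT; have := vr t; rewrite !in_itv/=; exact.
Qed.

Lemma stopP T r (y0 : R) u : 0 < T -> 0 < r -> - r <= y0 <= r -> CBV T u ->
  [/\ BV T (stop T r y0 u), stopsol T r u (stop T r y0 u) & stop T r y0 u 0 = y0].
Proof.
move=> T0 r0 y0r cu; apply/(is_stopP _ _ T0 r0 cu).
have /CBVP[bu cu'] := cu.
have [y sy y0E] := stopsol_ex T0 r0 y0r cu'.
have H : is_stop T r y0 u y by apply/is_stopP => //; split => //; exact: stopsol_BV sy bu.
exact: (@getPex _ [set y | is_stop T r y0 u y] (ex_intro _ y H)).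
Qed.

End variational_inequality.

(** * Existence of the directional derivative *)

Section one_sided.
Variable R : realType.
Implicit Types (a b c e s t x l k T r M : R) (f g u v w y V W p q X A B : R -> R).

(** Properties of all small positive perturbation parameters. *)
Definition ev (P : R -> Prop) := exists2 d : R, 0 < d & forall x, 0 < x < d -> P x.

Lemma ev_and (P Q : R -> Prop) : ev P -> ev Q -> ev (fun x => P x /\ Q x).
Proof.
move=> [d d0 hd] [d' d'0 hd']; exists (Num.min d d'); first by rewrite lt_min d0.
by move=> x /andP[x0]; rewrite lt_min => /andP[h1 h2]; split; [apply: hd|apply: hd']; rewrite x0.
Qed.

Lemma ev_impl (P Q : R -> Prop) : (forall x, 0 < x -> P x -> Q x) -> ev P -> ev Q.
Proof. by move=> PQ [d d0 hd]; exists d => // x /[dup] /andP[x0 _] /hd; exact: PQ. Qed.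

Lemma ev_lim X l e : right_lim X 0 l -> 0 < e -> ev (fun x => `|X x - l| < e).
Proof. by move=> hX e0; have [d d0 hd] := hX e e0; exists d => // x xd; apply: hd; rewrite add0r. Qed.

Lemma lim_ev X l : (forall e, 0 < e -> ev (fun x => `|X x - l| < e)) -> right_lim X 0 l.
Proof. by move=> h e /h[d d0 hd]; exists d => // x; rewrite add0r; exact: hd. Qed.

Lemma ev_false : ~ ev (fun=> False).
Proof. by move=> [d d0 /(_ (d / 2))]; apply; lra. Qed.

Lemma right_lim_le X l c : right_lim X 0 l -> ev (fun x => X x <= c) -> l <= c.
Proof.
move=> hX hc; rewrite leNgt; apply/negP => lc.
have := ev_and hc (ev_lim hX (e := l - c) ltac:(lra)) => /(ev_impl (Q := fun=> False)) H.
by apply: ev_false; apply: H => x _ [h1]; rewrite ltr_norml; lra.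
Qed.

Lemma right_limN X l : right_lim X 0 l -> right_lim (fun x => - X x) 0 (- l).
Proof. by move=> h e /h[d d0 hd]; exists d => // x /hd; rewrite -opprD normrN. Qed.

Lemma right_lim_ge X l c : right_lim X 0 l -> ev (fun x => c <= X x) -> c <= l.
Proof.
move=> /right_limN hX hc; rewrite -lerN2; apply: (right_lim_le hX).
by apply: ev_impl hc => x _; rewrite lerN2.
Qed.

Lemma right_lim_ev_eq X X' l : right_lim X 0 l -> ev (fun x => X x = X' x) -> right_lim X' 0 l.
Proof.
move=> hX hE; apply: lim_ev => e e0.
by apply: ev_impl (ev_and hE (ev_lim hX e0)) => x _ [->].
Qed.

Lemma right_lim_eq X X' l l' : right_lim X 0 l -> right_lim X' 0 l' ->
  ev (fun x => X x = X' x) -> l = l'.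
Proof. by move=> h h' hE; apply: right_lim_uniq h'; exact: right_lim_ev_eq hE. Qed.

Lemma right_limB X X' l l' : right_lim X 0 l -> right_lim X' 0 l' ->
  right_lim (fun x => X x - X' x) 0 (l - l').
Proof.
move=> h h'; apply: lim_ev => e e0.
apply: ev_impl (ev_and (ev_lim h (e := e / 2) _) (ev_lim h' (e := e / 2) _)); [|lra|lra].
by move=> x _ []; rewrite !ltr_norml; lra.
Qed.

Lemma right_lim_cst l : right_lim (fun=> l) 0 l.
Proof. by move=> e e0; exists 1 => // x _; rewrite subrr normr0. Qed.

Lemma right_lim_norm_le X l c : right_lim X 0 l -> ev (fun x => `|X x| <= c) -> `|l| <= c.
Proof.
move=> hX hc; rewrite ler_norml; apply/andP; split.
  by apply: (right_lim_ge hX); apply: ev_impl hc => x _; rewrite ler_norml => /andP[].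
by apply: (right_lim_le hX); apply: ev_impl hc => x _; rewrite ler_norml => /andP[].
Qed.

(** Right derivative at [0] of a function of the perturbation parameter. *)
Definition rderiv A l := right_lim (fun x => (A x - A 0) / x) 0 l.

Lemma rderiv_near A l : rderiv A l -> forall e, 0 < e -> ev (fun x => `|A x - A 0| < e).
Proof.
move=> h e e0; have [d d0 hd] := ev_lim h ltr01.
have l1 : 0 < `|l| + 1 by rewrite ltr_wpDl.
exists (Num.min d (e / (`|l| + 1))); first by rewrite lt_min d0 divr_gt0.
move=> x /andP[x0]; rewrite lt_min => /andP[xd]; rewrite ltr_pdivlMr// => xe.
have := hd x ltac:(lra) => h1.
have : `|(A x - A 0) / x| < `|l| + 1.
  by have := ler_normD ((A x - A 0) / x - l) l; rewrite subrK; lra.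
rewrite normrM normfV (gtr0_norm x0) ltr_pdivrMr// mulrC => h2.
exact: lt_trans h2 xe.
Qed.

Lemma rderiv_min A B (p q : R) : rderiv A p -> rderiv B q ->
  exists l, rderiv (fun x => Num.min (A x) (B x)) l.
Proof.
wlog AB : A B p q / A 0 <= B 0.
  move=> H hA hB; case: (leP (A 0) (B 0)) => AB; first exact: H AB hA hB.
  have [l hl] := H B A q p (ltW AB) hB hA.
  by exists l; move: hl; congr rderiv; apply/funext => x; rewrite minC.
move=> hA hB; move: AB; rewrite le_eqVlt => /predU1P[AB|AB].
  exists (Num.min p q); apply: lim_ev => e e0.
  apply: ev_impl (ev_and (ev_lim hA e0) (ev_lim hB e0)) => x x0 [h1 h2].
  rewrite -AB minxx (_ : (_ - _) / x = Num.min ((A x - A 0) / x) ((B x - B 0) / x)); last first.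
    rewrite -AB; case: (leP (A x) (B x)) => h; first by rewrite min_l// ler_pM2r ?invr_gt0//; lra.
    by rewrite min_r// ler_pM2r ?invr_gt0//; lra.
  move: h1 h2; rewrite !ltr_norml; set X := _ / x; set X' := (B x - _) / x.
  by case: (leP X X') => h3; case: (leP p q) => h4; lra.
exists p; apply: (right_lim_ev_eq hA).
have m0 : 0 < (B 0 - A 0) / 2 by lra.
apply: ev_impl (ev_and (rderiv_near hA m0) (rderiv_near hB m0)) => x x0 [].
rewrite !ltr_norml => h1 h2.
by rewrite !min_l//; lra.
Qed.

(** The minimum over a compact interval is concave in the perturbation parameter,
    so its difference quotients are monotone. *)
Lemma rderiv_running_min a b u h m H :
  (forall x, 0 <= x -> forall s, a <= s <= b -> m x <= u s + x * h s) ->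
  (forall x, 0 <= x -> exists2 s, a <= s <= b & m x = u s + x * h s) ->
  (forall s, a <= s <= b -> `|h s| <= H) ->
  exists l, rderiv m l.
Proof.
move=> m1 m2 hH.
pose q x := if x == 0 then H else (m x - m 0) / x.
have mono x x' : 0 <= x -> x <= x' -> q x' <= q x.
  rewrite le_eqVlt => /predU1P[<-|x0] xx.
    rewrite /q eqxx; case: eqVneq => // x'0.
    have x'p : 0 < x' by rewrite lt_neqAle eq_sym x'0.
    have [s sab ms] := m2 0 (lexx _).
    rewrite ler_pdivrMr//; have := m1 x' xx s sab; rewrite ms mul0r => h1.
    have := hH s sab; rewrite ler_norml => /andP[_ h2].
    have : x' * h s <= x' * H by rewrite ler_pM2l.
    by rewrite (mulrC H); lra.
  have x'p : 0 < x' by lra.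
  rewrite /q !gt_eqF// ler_pdivrMr// mulrAC ler_pdivlMr//.
  have [s sab ms] := m2 x (ltW x0).
  have h1 := m1 x' (ltW x'p) s sab; have h2 := m1 0 (lexx _) s sab.
  have : x * m x' <= x * (u s + x' * h s) by rewrite ler_pM2l.
  have : (x' - x) * m 0 <= (x' - x) * (u s + 0 * h s) by apply: ler_wpM2l; lra.
  by rewrite ms; lra.
have cq : control 0 1 (fun x => - q x) q.
  move=> s t s0 st t1; have := mono s t s0 st => h1.
  by rewrite ler_norml; lra.
have [|l hl] := control_right_lim cq (t := 0); first by rewrite lexx ltr01.
exists l; apply: (right_lim_ev_eq hl); exists 1 => // x /andP[x0 _].
by rewrite /q gt_eqF.
Qed.

End one_sided.

Section directional_derivative.
Variable R : realType.
Implicit Types (a b c e s t x l k T r M : R) (f g h u v w y V W p q X A B : R -> R).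
Implicit Types (Y : R -> R -> R).

(** Outputs [Y x] for the perturbed inputs [u + x * h] with a common initial value. *)
Definition stopfam T r u h Y := forall x, 0 <= x ->
  stopsol T r (fun t => u t + x * h t) (Y x) /\ Y x 0 = Y 0 0.

Definition wfam u h Y x t : R := u t + x * h t - Y x t.

Lemma stopfam_opp T r u h Y : stopfam T r u h Y ->
  stopfam T r (fun t => - u t) (fun t => - h t) (fun x t => - Y x t).
Proof.
move=> hY x x0; have [h1 h2] := hY x x0; split; last by rewrite h2.
have := stopsol_opp h1; congr stopsol; apply/funext => t; ring.
Qed.

Lemma stopfam0 T r u h Y : stopfam T r u h Y -> stopsol T r u (Y 0).
Proof.
by move=> hY; have [+ _] := hY 0 (lexx _); congr stopsol; apply/funext => t; rewrite mul0r addr0.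
Qed.

Lemma wfam0 u h Y t : wfam u h Y 0 t = u t - Y 0 t.
Proof. by rewrite /wfam mul0r addr0. Qed.

(** Where the upper constraint is inactive, the play operator is the running minimum of
    its initial value and of [v + r]. *)
Lemma stopsol_runmin T r v y a b : cts 0 T v -> stopsol T r v y -> 0 <= a -> a <= b -> b <= T ->
  (forall x, a <= x <= b -> y x < r) ->
  [/\ v b - y b <= v a - y a, forall s, a <= s <= b -> v b - y b <= v s + r &
      v b - y b = v a - y a \/ exists2 s, a <= s <= b & v b - y b = v s + r].
Proof.
move=> cv [cy yr d1 d2] a0 ab bT yab.
have mono s t : a <= s -> s <= t -> t <= b -> v t - y t <= v s - y s.
  by move=> as_ st tb; apply: d1; [lra..|move=> x xst; apply: yab; lra].
have le1 s : a <= s <= b -> v b - y b <= v s + r.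
  move=> sab; have := mono s b ltac:(lra) ltac:(lra) (lexx _).
  by have := yr s; lra.
split => //; first exact: mono.
have [s sab hs] := cts_argmin ab (cts_sub a0 bT cv).
pose M := Num.min (v a - y a) (v s + r).
have M1 : M <= v a - y a by rewrite /M ge_min lexx.
have M2 : M <= v s + r by rewrite /M ge_min lexx orbT.
have ME : M = v a - y a \/ M = v s + r.
  by rewrite /M; case: (leP (v a - y a) (v s + r)); [left|right].
have MM : M <= v b - y b.
  rewrite -subr_le0; apply: (@no_crossing _ a b (fun t => M - (v t - y t))) => //.
  - apply: ctsB; first exact: cts_cst.
    by apply: (@cts_sub _ 0 T) => //; exact: ctsB.
  - lra.
  - move=> s' t as' st tb hpos.
    suff : v s' - y s' <= v t - y t by lra.
    apply: d2; [lra..|] => x xst; have := hpos x xst.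
    by have := hs x; lra.
have := mono a b (lexx _) ab (lexx _); have := le1 s sab.
case: ME => ME; [left; lra|right; exists s => //; lra].
Qed.

Section fam.
Variables (T r : R) (u h : R -> R) (Y : R -> R -> R).
Hypotheses (T0 : 0 < T) (r0 : 0 < r) (cu : cts 0 T u) (ch : cts 0 T h).
Hypothesis hY : stopfam T r u h Y.
Let w := wfam u h Y.

Lemma ctsuh x : cts 0 T (fun t => u t + x * h t).
Proof. by apply: ctsD => //; exact: ctsZ. Qed.

Lemma fam_lip H : (forall t, 0 <= t <= T -> `|h t| <= H) -> forall x t, 0 <= x -> 0 <= t <= T ->
  `|w x t - w 0 t| <= x * H /\ `|Y x t - Y 0 t| <= 2 * (x * H).
Proof.
move=> hH x t x0 tT; have [s1 s2] := hY x0; have [s3 s4] := hY (lexx 0).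
have t0 : 0 <= t by lra.
have tT' : t <= T by lra.
have d s : 0 <= s <= t -> `|u s + x * h s - (u s + 0 * h s)| <= x * H.
  move=> st; rewrite (_ : _ - _ = x * h s); last ring.
  by rewrite normrM ger0_norm// ler_wpM2l//; apply: hH; lra.
have i0 : `|u 0 + x * h 0 - Y x 0 - (u 0 + 0 * h 0 - Y 0 0)| <= x * H.
  rewrite s2 (_ : _ - _ = x * h 0); last ring.
  by rewrite normrM ger0_norm// ler_wpM2l//; apply: hH; lra.
have h1 := stopsol_lip_from (@ctsuh x) (@ctsuh 0) s1 s3 (lexx 0) t0 tT' i0 d.
split; first exact: h1.
have h2 := d t ltac:(lra).
by move: h1 h2; rewrite !ler_norml; lra.
Qed.

Lemma fam_bound : exists2 H : R, 0 < H & forall x t, 0 <= x -> 0 <= t <= T ->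
  `|w x t - w 0 t| <= x * H /\ `|Y x t - Y 0 t| <= 2 * (x * H).
Proof.
have [H H0 hH] := cts_bounded ch; exists H => //; exact: fam_lip.
Qed.

Lemma fam_lt_r a b : 0 <= a -> a <= b -> b <= T -> (forall t, a <= t <= b -> Y 0 t < r) ->
  ev (fun x => forall t, a <= t <= b -> Y x t < r).
Proof.
move=> a0 ab bT hr; have [cy _ _ _] := stopfam0 hY.
have [m mab hm] := cts_argmax ab (cts_sub a0 bT cy).
have := hr m mab => mr.
have [H H0 hH] := fam_bound.
exists ((r - Y 0 m) / (2 * H)); first by rewrite divr_gt0//; lra.
move=> x /andP[x0]; rewrite ltr_pdivlMr; last lra.
move=> xH t tab; have := hm t tab.
have [_] := hH x t (ltW x0) ltac:(lra); rewrite ler_norml; lra.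
Qed.

(** [l] is the one-sided derivative, in the parameter, of the play at time [t]. *)
Definition isW t l := rderiv (w^~ t) l.

Lemma isW_0 : isW 0 (h 0).
Proof.
apply: lim_ev => e e0; exists 1 => // x /andP[x0 _].
have [_ s2] := hY (ltW x0).
rewrite /w /wfam s2 (_ : (_ - _) / x = h 0) ?subrr ?normr0//.
by field; rewrite gt_eqF.
Qed.

(** By [stopsol_runmin] the play at [b] is the minimum of the play at [a] and of a running
    minimum of the input, and both have one-sided derivatives in the parameter. *)
Lemma isW_step a b l : 0 <= a -> a <= b -> b <= T -> (forall t, a <= t <= b -> Y 0 t < r) ->
  isW a l -> exists l', isW b l'.
Proof.
move=> a0 ab bT hr hl.
have /choice[m hm] : forall x, exists m, 0 <= x ->
    (forall s, a <= s <= b -> m <= u s + x * h s) /\ exists2 s, a <= s <= b & m = u s + x * h s.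
  move=> x; have [s sab hs] := cts_argmin ab (cts_sub a0 bT (@ctsuh x)).
  by exists (u s + x * h s) => _; split => //; exists s.
have [H H0 hH] := cts_bounded ch.
have [|||q hq] := @rderiv_running_min _ a b u h m H.
- by move=> x /hm[].
- by move=> x /hm[].
- by move=> s sab; apply: hH; lra.
have hq' : rderiv (fun x => m x + r) q.
  by move: hq; congr right_lim; apply/funext => x; congr (_ / _); ring.
have [l' hl'] := rderiv_min hl hq'; exists l'.
have E x : 0 <= x -> (forall t, a <= t <= b -> Y x t < r) -> Num.min (w x a) (m x + r) = w x b.
  move=> x0 hx; have [m1 [s sab ms]] := hm x x0; have [s1 _] := hY x0.
  have [h1 h2 h3] := stopsol_runmin (@ctsuh x) s1 a0 ab bT hx.
  have h4 : w x b <= m x + r by rewrite ms; exact: h2.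
  have h5 : w x b <= w x a by [].
  case: h3 => [h3|[s' s'ab h3]].
    have -> : w x a = w x b by rewrite /w /wfam h3.
    by rewrite min_l.
  have : m x + r <= w x b by rewrite /w /wfam h3 lerD2r; exact: m1.
  by move=> h6; rewrite (_ : m x + r = w x b) ?min_r//; lra.
apply: (right_lim_ev_eq hl'); apply: ev_impl (fam_lt_r a0 ab bT hr) => x x0 hx.
by rewrite !E// ltW.
Qed.

End fam.

Lemma isW_opp u h Y t l : isW u h Y t l ->
  isW (fun t => - u t) (fun t => - h t) (fun x t => - Y x t) t (- l).
Proof.
move=> /right_limN; congr right_lim; apply/funext => x.
by rewrite /wfam; ring.
Qed.

Lemma isW_oppK u h Y t l : isW (fun t => - u t) (fun t => - h t) (fun x t => - Y x t) t l ->
  isW u h Y t (- l).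
Proof.
move=> /right_limN; congr right_lim; apply/funext => x.
by rewrite /wfam; ring.
Qed.

(** Near every time only one constraint can act, and reflection exchanges the two. *)
Lemma isW_ex T r u h Y : 0 < r -> cts 0 T u -> cts 0 T h -> stopfam T r u h Y ->
  forall t, 0 <= t <= T -> exists l, isW u h Y t l.
Proof.
move=> r0 cu ch hY t tT.
have [t0|t0] := eqVneq t 0; first by exists (h 0); rewrite t0; exact: (isW_0 hY).
have {}t0 : 0 < t by rewrite lt_neqAle eq_sym t0; lra.
apply: (@chain_induction _ (fun t => exists l, isW u h Y t l) 0 t t0); last first.
  by exists (h 0); exact: (isW_0 hY).
move=> x xt; have [d d0 hd] := stopsol_local r0 (stopfam0 hY) (t := x) ltac:(lra).
exists d => // a b a0 ax xb bt da db ab [l hl].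
case: hd => hd.
  apply: (isW_step cu ch hY a0 (ltW ab) _ _ hl); first lra.
  by move=> s sab; apply: hd; [|rewrite ltr_norml]; lra.
have [|s sab|l' hl'] := isW_step (ctsN cu) (ctsN ch) (stopfam_opp hY) a0 (ltW ab) _ _ (isW_opp hl).
- lra.
- suff : - r < Y 0 s by lra.
  by apply: hd; [|rewrite ltr_norml]; lra.
by exists (- l'); exact: isW_oppK.
Qed.

End directional_derivative.

(** * Structure of the directional derivative *)

Section derivative_structure.
Variable R : realType.
Implicit Types (a b c e s t x l k T r M o : R) (f g h u v w y V W p q X A B : R -> R).
Implicit Types (Y : R -> R -> R).

Definition isWfun T u h Y W := forall t, 0 <= t <= T -> isW u h Y t (W t).

Lemma isWfun_opp T u h Y W : isWfun T u h Y W ->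
  isWfun T (fun t => - u t) (fun t => - h t) (fun x t => - Y x t) (fun t => - W t).
Proof. by move=> hW t tT; apply: isW_opp; exact: hW. Qed.

Lemma isW_quotient u h Y t l e : isW u h Y t l -> 0 < e ->
  ev (fun x => `|wfam u h Y x t - wfam u h Y 0 t - x * l| <= x * e).
Proof.
move=> hl e0; apply: ev_impl (ev_lim hl e0) => x x0 /ltW.
have -> : wfam u h Y x t - wfam u h Y 0 t - x * l = x * ((wfam u h Y x t - wfam u h Y 0 t) / x - l).
  by field; rewrite gt_eqF.
by rewrite normrM gtr0_norm// => h1; rewrite ler_pM2l.
Qed.

Lemma isW_le u h Y t l k : isW u h Y t l ->
  ev (fun x => wfam u h Y x t - wfam u h Y 0 t <= x * k) -> l <= k.
Proof.
move=> hl hk; apply: (right_lim_le hl); apply: ev_impl hk => x x0.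
by rewrite ler_pdivrMr// mulrC.
Qed.

Lemma isW_ge u h Y t l k : isW u h Y t l ->
  ev (fun x => x * k <= wfam u h Y x t - wfam u h Y 0 t) -> k <= l.
Proof.
move=> hl hk; apply: (right_lim_ge hl); apply: ev_impl hk => x x0.
by rewrite ler_pdivlMr// mulrC.
Qed.

Lemma isW_eq u h Y s t l l' : isW u h Y s l -> isW u h Y t l' ->
  ev (fun x => wfam u h Y x s - wfam u h Y 0 s = wfam u h Y x t - wfam u h Y 0 t) -> l = l'.
Proof.
by move=> hl hl' hE; apply: (right_lim_eq hl hl'); apply: ev_impl hE => x _ ->.
Qed.

Section upper.
Variables (T r : R) (u h : R -> R) (Y : R -> R -> R) (W : R -> R).
Hypotheses (cu : cts 0 T u) (ch : cts 0 T h).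
Hypotheses (hY : stopfam T r u h Y) (hW : isWfun T u h Y W).
Let w := wfam u h Y.

Let runmin a b : 0 <= a -> a <= b -> b <= T -> forall x, 0 <= x -> (forall t, a <= t <= b ->
  Y x t < r) ->
  [/\ w x b <= w x a, forall s, a <= s <= b -> w x b <= u s + x * h s + r &
      w x b = w x a \/ exists2 s, a <= s <= b & w x b = u s + x * h s + r].
Proof.
move=> a0 ab bT x x0 hx; have [s1 _] := hY x0.
exact: (stopsol_runmin (@ctsuh _ _ _ _ cu ch x) s1 a0 ab bT hx).
Qed.

Let WaP a b : 0 <= a -> a <= b -> b <= T -> isW u h Y a (W a).
Proof. by move=> a0 ab bT; apply: hW; rewrite a0 (le_trans ab bT). Qed.
Let WbP a b : 0 <= a -> a <= b -> b <= T -> isW u h Y b (W b).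
Proof. by move=> a0 ab bT; apply: hW; rewrite bT (le_trans a0 ab). Qed.

Lemma W_nonincr a b : 0 <= a -> a <= b -> b <= T ->
  (forall x, a <= x <= b -> Y 0 x < r) -> w 0 a = w 0 b -> W b <= W a.
Proof.
move=> a0 ab bT hr wab; have WaP' := WaP a0 ab bT; have WbP' := WbP a0 ab bT; have rm := runmin a0 ab bT.
rewrite -subr_ge0; apply: (right_lim_ge (right_limB WaP' WbP')).
apply: ev_impl (fam_lt_r cu ch hY a0 ab bT hr) => x x0 hx.
rewrite -/w -mulrBl; apply: divr_ge0; last exact: ltW.
by have [h1 _ _] := rm _ (ltW x0) hx; lra.
Qed.

(** The play operator has just been driven by the constraint: its derivative is that
    of the input, up to the oscillation of the direction. *)
Lemma W_reset a b o : 0 <= a -> a <= b -> b <= T ->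
  (forall x, a <= x <= b -> Y 0 x < r) -> w 0 b < w 0 a -> (forall x, a <= x <= b ->
    `|h x - h b| <= o) ->
  `|W b - h b| <= o.
Proof.
move=> a0 ab bT hr wba ho; have WaP' := WaP a0 ab bT; have WbP' := WbP a0 ab bT; have rm :=
  runmin a0 ab bT.
have m0 : 0 < (w 0 a - w 0 b) / 2 by lra.
have [h1 h2 h3] := rm _ (lexx 0) hr.
have [s0 s0ab hs0] : exists2 s, a <= s <= b & w 0 b = u s + r.
  case: h3 => [|[s sab]]; first lra.
  by rewrite mul0r addr0 => hs; exists s.
have E : ev (fun x => x * (h b - o) <= w x b - w 0 b <= x * (h b + o)).
  have := ev_and (fam_lt_r cu ch hY a0 ab bT hr) (ev_and (rderiv_near WaP' m0) (rderiv_near WbP' m0)).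
  apply: ev_impl => x x0 [hx]; rewrite -/w !ltr_norml => -[n1 n2].
  have [_ k2 [k3|[s sab k3]]] := rm _ (ltW x0) hx; first lra.
  have u1 := k2 _ s0ab.
  have := h2 _ sab; rewrite mul0r addr0 => l1.
  have := ho _ s0ab; have := ho _ sab; rewrite !ler_norml => o1 o2.
  have : x * (h b - o) <= x * h s by rewrite ler_pM2l//; lra.
  have : x * h s0 <= x * (h b + o) by rewrite ler_pM2l//; lra.
  lra.
suff : h b - o <= W b <= h b + o by rewrite ler_norml; lra.
apply/andP; split.
  by apply: (isW_ge WbP'); apply: ev_impl E => x _ /andP[].
by apply: (isW_le WbP'); apply: ev_impl E => x _ /andP[].
Qed.

(** If the play stays constant and [y] does not touch [- r], no perturbed output touches
    either constraint, and nothing happens.  If [y] touches [- r], the perturbed play is either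
    still at its initial value or determined by the perturbed input. *)
Lemma W_dichotomy a b o : 0 <= a -> a <= b -> b <= T ->
  (forall x, a <= x <= b -> Y 0 x < r) -> (forall x, a <= x <= b -> `|h x - h b| <= o) ->
  W b = W a \/ `|W b - h b| <= o.
Proof.
move=> a0 ab bT hr ho; have WaP' := WaP a0 ab bT; have WbP' := WbP a0 ab bT; have rm := runmin a0 ab bT.
have [h1 h2 h3] := rm _ (lexx 0) hr.
have := h1; rewrite le_eqVlt => /predU1P[wab|wab]; last by right; exact: (W_reset a0 ab bT hr wab ho).
have [[s0 s0ab ys0]|ns] := pselect (exists2 s, a <= s <= b & Y 0 s <= - r); last first.
  left; apply: (isW_eq WbP' WaP').
  have := fam_lt_r (ctsN cu) (ctsN ch) (stopfam_opp hY) a0 ab bT.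
  move=> /(_ ltac:(move=> t tab; rewrite ltrNl ltNge; apply/negP => ht; apply: ns; exists t => //)) E.
  have := ev_and (fam_lt_r cu ch hY a0 ab bT hr) E.
  apply: ev_impl => x x0 [hx hx']; rewrite -/w wab; congr (_ - _).
  have [[_ _ d1 d2] _] := hY (ltW x0).
  have := d1 a b a0 ab bT hx; have := d2 a b a0 ab bT.
  by move=> /(_ ltac:(move=> z /hx'; lra)); rewrite /w /wfam; lra.
have [_ yr _ _] := stopfam0 hY.
have ws0 : w 0 b = u s0 + r.
  have [_ k2 _] := rm _ (lexx 0) hr.
  have := k2 _ s0ab; rewrite mul0r addr0 => k1.
  have := yr s0 ltac:(lra) => y1.
  have [_ _ d1 _] := stopfam0 hY.
  have := d1 a s0 a0 ltac:(lra) ltac:(lra) ltac:(move=> z zz; apply: hr; lra).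
  move: wab k1; rewrite /w !wfam0; lra.
have [->|Wab] := eqVneq (W b) (W a); [by left|right].
have e0 : 0 < `|W b - W a| / 4 by rewrite divr_gt0// normr_gt0 subr_eq0.
have E : ev (fun x => x * (h b - o) <= w x b - w 0 b <= x * (h b + o)).
  have := ev_and (fam_lt_r cu ch hY a0 ab bT hr) (ev_and (isW_quotient WaP' e0) (isW_quotient WbP' e0)).
  apply: ev_impl => x x0 [hx]; rewrite -/w => -[n1 n2].
  have [_ k2 k3] := rm _ (ltW x0) hx.
  have u1 := k2 _ s0ab.
  case: k3 => [k3|[s sab k3]].
    exfalso; move: n1 n2; rewrite wab k3.
    set D := w x a - w 0 a => n1 n2.
    have := ler_normB (D - x * W a) (D - x * W b).
    rewrite (_ : D - x * W a - (D - x * W b) = x * (W b - W a)); last ring.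
    rewrite normrM gtr0_norm// => n3.
    have : 0 < x * (`|W b - W a| / 4) by rewrite mulr_gt0.
    by move: n1 n2 n3; set N := `|W b - W a|; lra.
  have := h2 _ sab; rewrite mul0r addr0 => l1.
  have := ho _ s0ab; have := ho _ sab; rewrite !ler_norml => o1 o2.
  have : x * (h b - o) <= x * h s by rewrite ler_pM2l//; lra.
  have : x * h s0 <= x * (h b + o) by rewrite ler_pM2l//; lra.
  lra.
suff : h b - o <= W b <= h b + o by rewrite ler_norml; lra.
apply/andP; split.
  by apply: (isW_ge WbP'); apply: ev_impl E => x _ /andP[].
by apply: (isW_le WbP'); apply: ev_impl E => x _ /andP[].
Qed.

End upper.

Section global.
Variables (T r : R) (u h : R -> R) (Y : R -> R -> R) (W : R -> R).
Hypotheses (T0 : 0 < T) (r0 : 0 < r) (cu : cts 0 T u) (ch : cts 0 T h).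
Hypotheses (hY : stopfam T r u h Y) (hW : isWfun T u h Y W).
Let y := Y 0.
Let w t := u t - y t.

Let wE t : wfam u h Y 0 t = w t. Proof. exact: wfam0. Qed.

Lemma W_nondecr a b : 0 <= a -> a <= b -> b <= T -> (forall x, a <= x <= b -> - r < y x) ->
  w a = w b -> W a <= W b.
Proof.
move=> a0 ab bT hr wab; rewrite -lerN2.
apply: (W_nonincr (ctsN cu) (ctsN ch) (stopfam_opp hY) (isWfun_opp hW) a0 ab bT).
  by move=> x /hr; rewrite ltrNl.
by rewrite !wfam0; move: wab; rewrite /w /y; lra.
Qed.

Lemma W_nonincr' a b : 0 <= a -> a <= b -> b <= T -> (forall x, a <= x <= b -> y x < r) ->
  w a = w b -> W b <= W a.
Proof.
move=> a0 ab bT hr wab.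
by apply: (W_nonincr cu ch hY hW a0 ab bT hr); rewrite !wE.
Qed.

(** The same alternative near any time, whichever constraint can act there. *)
Lemma W_local t : 0 <= t <= T -> exists2 d : R, 0 < d &
  forall a b o, 0 <= a -> a <= b -> b <= T -> t - d < a -> b < t + d ->
    (forall x, a <= x <= b -> `|h x - h b| <= o) ->
    (W b = W a \/ `|W b - h b| <= o) /\ (w a <> w b -> `|W b - h b| <= o).
Proof.
move=> tT; have [d d0 hd] := stopsol_local r0 (stopfam0 hY) tT; exists d => //.
move=> a b o a0 ab bT da db ho; have [_ _ d1 d2] := stopfam0 hY.
case: hd => hd.
  have hr x : a <= x <= b -> Y 0 x < r.
    by move=> xab; apply: hd; [|rewrite ltr_norml]; lra.
  split; first exact: (W_dichotomy cu ch hY hW a0 ab bT hr ho).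
  move=> wab; apply: (W_reset cu ch hY hW a0 ab bT hr _ ho); rewrite !wE.
  have := d1 a b a0 ab bT hr; rewrite -/(w a) -/(w b) le_eqVlt => /predU1P[E|//].
  by case: wab; rewrite E.
have hr x : a <= x <= b -> - Y 0 x < r.
  by move=> xab; rewrite ltrNl; apply: hd; [|rewrite ltr_norml]; lra.
have ho' x : a <= x <= b -> `|- h x - - h b| <= o.
  by rewrite -opprD normrN; exact: ho.
have E : `|- W b - - h b| = `|W b - h b| by rewrite -opprD normrN.
have [cN1 cN2] := (ctsN cu, ctsN ch); have [cN3 cN4] := (stopfam_opp hY, isWfun_opp hW).
split.
  have := W_dichotomy cN1 cN2 cN3 cN4 a0 ab bT hr ho'.
  by rewrite E => -[/oppr_inj|]; [left|right].
move=> wab; rewrite -E; apply: (W_reset cN1 cN2 cN3 cN4 a0 ab bT hr _ ho'); rewrite !wfam0.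
have := d2 a b a0 ab bT ltac:(move=> z /hr; lra).
rewrite -/(w a) -/(w b) le_eqVlt => /predU1P[E'|]; first by case: wab.
by rewrite /w /y; lra.
Qed.

Lemma deltaP t : 0 <= t <= T ->
  right_lim (fun x => (Y x t - Y 0 t) / x) 0 (h t - W t).
Proof.
move=> tT; have := right_limB (@right_lim_cst _ (h t)) (hW tT).
move=> H; apply: (right_lim_ev_eq H); exists 1 => // x /andP[x0 _].
by rewrite /wfam; field; rewrite gt_eqF.
Qed.

Lemma delta_ge0 t : 0 <= t <= T -> y t = - r -> 0 <= h t - W t.
Proof.
move=> tT yt; apply: (right_lim_ge (deltaP tT)); exists 1 => // x /andP[x0 _].
apply: divr_ge0; last exact: ltW.
have [[_ yr _ _] _] := hY (ltW x0); have := yr t tT.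
by rewrite -/y yt; lra.
Qed.

Lemma delta_le0 t : 0 <= t <= T -> y t = r -> h t - W t <= 0.
Proof.
move=> tT yt; apply: (right_lim_le (deltaP tT)); exists 1 => // x /andP[x0 _].
rewrite ler_pdivrMr// mul0r.
have [[_ yr _ _] _] := hY (ltW x0); have := yr t tT.
by rewrite -/y yt; lra.
Qed.

(** The input [u + x * (h - h a)] has the same outputs as [u + x * h], and its distance from [u]
    on [a, b] bounds the gap between the plays. *)
Lemma W_from a b M : 0 <= a -> a <= b -> b <= T -> `|W a - h a| <= M ->
  (forall x, a <= x <= b -> `|h x - h a| <= M) -> `|W b - h a| <= M.
Proof.
move=> a0 ab bT hWa hM; apply/ler_addgt0Pr => e e0.
have Wb : isW u h Y b (W b) by apply: hW; lra.
have Wa : isW u h Y a (W a) by apply: hW; lra.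
have E : ev (fun x => `|wfam u h Y x b - wfam u h Y 0 b - x * h a| <= x * (M + e)).
  apply: ev_impl (isW_quotient Wa e0) => x x0 hx.
  have [s1 _] := hY (ltW x0).
  have s1' : stopsol T r (fun t => u t + x * h t - x * h a) (Y x).
    case: s1 => c1 c2 d1 d2; split => // s t s0 st tT hh.
      by have := d1 s t s0 st tT hh; lra.
    by have := d2 s t s0 st tT hh; lra.
  have c1 : cts 0 T (fun t => u t + x * h t - x * h a).
    by apply: ctsB (@ctsuh _ _ _ _ cu ch x) (@cts_cst _ _ _ _).
  have := stopsol_lip_from c1 cu s1' (stopfam0 hY) a0 ab bT (M := x * (M + e)).
  rewrite !wfam0 /wfam -/y in hx *.
  have E t : u t + x * h t - x * h a - Y x t - (u t - y t) = u t + x * h t - Y x t - (u t - y t) - x * h a by ring.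
  rewrite !E; apply.
    have := ler_normD (u a + x * h a - Y x a - (u a - y a) - x * W a) (x * (W a - h a)).
    rewrite (_ : _ + x * (W a - h a) = u a + x * h a - Y x a - (u a - y a) - x * h a); last ring.
    rewrite normrM gtr0_norm// => h1.
    have : x * `|W a - h a| <= x * M by rewrite ler_pM2l.
    by lra.
  move=> s sab; rewrite (_ : _ - _ = x * (h s - h a)); last ring.
  rewrite normrM gtr0_norm// ler_pM2l//.
  by have := hM s sab; lra.
suff : h a - (M + e) <= W b <= h a + (M + e) by rewrite ler_norml; lra.
apply/andP; split.
  by apply: (isW_ge Wb); apply: ev_impl E => x x0; rewrite ler_norml; lra.
by apply: (isW_le Wb); apply: ev_impl E => x x0; rewrite ler_norml; lra.
Qed.

(** [W] moves only when it is reset to [h]; such a move is paid for by the decrease of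
    [|h - W|] and by the variation of [h]. *)
Lemma W_control V : control 0 T V h -> control 0 T (fun t => 3 * V t - `|h t - W t|) W.
Proof.
move=> hV a b a0 ab bT.
have := ab; rewrite le_eqVlt => /predU1P[->|altb]; first by rewrite !subrr normr0.
pattern a, b.
apply: (@chain_trans _ (fun a b =>
  `|W b - W a| <= 3 * V b - `|h b - W b| - (3 * V a - `|h a - W a|)) a b altb).
  move=> x xab; have [|d d0 hd] := W_local (t := x); first lra.
  exists d => // s t as_ sx xt tb ds dt st.
  have Vst : forall z, s <= z <= t -> `|h z - h t| <= V t - V s.
    move=> z zst; have := hV z t ltac:(lra) ltac:(lra) ltac:(lra).
    have := control_mono hV (s := s) (t := z) ltac:(lra) ltac:(lra) ltac:(lra).
    by rewrite (distrC (h z)); lra.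
  have [H _] := hd s t (V t - V s) ltac:(lra) ltac:(lra) ltac:(lra) ds dt Vst.
  have := Vst s ltac:(lra) => h1.
  have V0 : 0 <= V t - V s by apply: le_trans h1.
  case: H => H.
    rewrite H subrr normr0.
    have := ler_normD (h s - W s) (h t - h s).
    rewrite (_ : h s - W s + (h t - h s) = h t - W s); last ring.
    by rewrite (distrC (h t) (h s)); lra.
  have := ler_normD (W t - h t + (h t - h s)) (h s - W s).
  rewrite (_ : W t - h t + (h t - h s) + (h s - W s) = W t - W s); last ring.
  have := ler_normD (W t - h t) (h t - h s).
  by rewrite (distrC (h t) (h s)) (distrC (h t) (W t)); lra.
move=> x z ax xz zb h1 h2.
have := ler_normD (W z - W x) (W x - W a).
by rewrite addrA subrK; lra.
Qed.

End global.

Section two_directions.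
Variables (T r : R) (u h h' : R -> R) (Y Y' : R -> R -> R) (W W' : R -> R).
Hypotheses (cu : cts 0 T u) (ch : cts 0 T h) (ch' : cts 0 T h').
Hypotheses (hY : stopfam T r u h Y) (hW : isWfun T u h Y W).
Hypotheses (hY' : stopfam T r u h' Y') (hW' : isWfun T u h' Y' W').
Hypothesis YY' : forall t, 0 <= t <= T -> Y 0 t = Y' 0 t.

Lemma delta_lip M : 0 <= T -> (forall t, 0 <= t <= T -> `|h t - h' t| <= M) ->
  forall t, 0 <= t <= T -> `|(h t - W t) - (h' t - W' t)| <= 2 * M.
Proof.
move=> T0 hM t tT.
have := right_limB (deltaP hW tT) (deltaP hW' tT) => H.
apply: (right_lim_norm_le H); exists 1 => // x /andP[x0 _].
have [s1 s2] := hY (ltW x0); have [s1' s2'] := hY' (ltW x0).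
have y0 : Y x 0 = Y' x 0 by rewrite s2 s2'; apply: YY'; lra.
have := stopsol_lip (@ctsuh _ _ _ _ cu ch x) (@ctsuh _ _ _ _ cu ch' x) s1 s1' y0 (M := x * M).
move=> /(_ _ t tT) h1; rewrite -mulrBl YY'// opprB addrA subrK normrM normfV (gtr0_norm x0).
rewrite ler_pdivrMr// (_ : 2 * M * x = 2 * (x * M)); last ring.
apply: h1 => z zT; rewrite (_ : _ - _ = x * (h z - h' z)); last ring.
by rewrite normrM gtr0_norm// ler_pM2l//; exact: hM.
Qed.

Lemma delta_le : 0 <= T ->
  (forall s t, 0 <= s -> s <= t -> t <= T -> h' s - h s <= h' t - h t) ->
  forall t, 0 <= t <= T -> h t - W t <= h' t - W' t.
Proof.
move=> T0 hM t tT; rewrite -subr_ge0.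
apply: (right_lim_ge (right_limB (deltaP hW' tT) (deltaP hW tT))); exists 1 => // x /andP[x0 _].
have [s1 s2] := hY (ltW x0); have [s1' s2'] := hY' (ltW x0).
have y0 : Y x 0 = Y' x 0 by rewrite s2 s2'; apply: YY'; lra.
have := stopsol_le (@ctsuh _ _ _ _ cu ch x) (@ctsuh _ _ _ _ cu ch' x) s1 s1' y0.
move=> /(_ _ t tT) h1; rewrite -mulrBl YY'//; apply: divr_ge0; last exact: ltW.
suff : Y x t <= Y' x t by lra.
apply: h1 => s s' s0 ss sT.
have : x * (h' s - h s) <= x * (h' s' - h s') by rewrite ler_pM2l//; exact: hM.
by lra.
Qed.

End two_directions.

End derivative_structure.

(** * Right-continuous versions *)

Section right_limits.
Variable R : realType.
Implicit Types (a b c d e s t x l k T r M : R) (f g h u v w y z V W p q : R -> R).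

Lemma rlimT T v : rlim T v T = v T.
Proof. by rewrite /rlim eqxx. Qed.

Lemma rlim_lim T v t l : t < T -> right_lim v t l -> rlim T v t = l.
Proof. by move=> tT hl; rewrite /rlim lt_eqF//; exact: right_lim_lim. Qed.

Lemma rlimP T v t : t < T -> (exists l, right_lim v t l) -> right_lim v t (rlim T v t).
Proof. by move=> tT [l hl]; rewrite (rlim_lim tT hl). Qed.

Lemma llimP v t : 0 < t -> (exists l, left_lim v t l) -> left_lim v t (llim v t).
Proof.
by move=> t0 [l hl]; rewrite /llim gt_eqF// (left_lim_lim hl).
Qed.

Lemma llim_lim v t l : 0 < t -> left_lim v t l -> llim v t = l.
Proof. by move=> t0 hl; rewrite /llim gt_eqF//; exact: left_lim_lim. Qed.

Lemma llim0 v : llim v 0 = v 0.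
Proof. by rewrite /llim eqxx. Qed.

Lemma right_approx T v t l e c : right_lim v t l -> 0 < e -> t < c -> t < T ->
  exists x, [/\ t < x, x < c, x < T & `|v x - l| < e].
Proof.
move=> hl e0 tc tT; have [d d0 hd] := hl e e0.
pose m := Num.min d (Num.min (c - t) (T - t)).
have m0 : 0 < m by rewrite !lt_min d0 !subr_gt0 tc.
have [m1 m2 m3] : [/\ m <= d, m <= c - t & m <= T - t].
  by split; rewrite /m !ge_min lexx ?orbT.
exists (t + m / 2); split; [lra..|apply: hd; lra].
Qed.

Lemma right_lim_le_at v t l k : right_lim v t l ->
  (exists2 d : R, 0 < d & forall x, t < x < t + d -> v x <= k) -> l <= k.
Proof.
move=> hl [d d0 hd]; apply/ler_addgt0Pr => e e0.
have td : t < t + d by rewrite ltrDl.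
have [x [tx xd _ xl]] := right_approx hl e0 td td.
have /(le_trans _) := hd x (ltac:(by rewrite tx)) => H.
by rewrite -lerBlDr; apply: H; move: xl; rewrite ltr_norml ltrBrDl => /andP[/ltW].
Qed.

Lemma right_limN_at v t l : right_lim v t l -> right_lim (fun x => - v x) t (- l).
Proof. by move=> hl e /hl[d d0 hd]; exists d => // x /hd; rewrite -opprD normrN. Qed.

Lemma rlim_noninc T v c d : (forall t, 0 <= t < T -> exists l, right_lim v t l) ->
  (forall s t, 0 <= s -> s <= t -> t <= T -> c < s -> t < d -> v t <= v s) ->
  forall s t, 0 <= s -> s <= t -> t <= T -> c < s -> t < d -> rlim T v t <= rlim T v s.
Proof.
move=> hr hv s t s0 st tT cs td.
move: st; rewrite le_eqVlt => /predU1P[->|st]; first exact: lexx.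
have sT : s < T by exact: lt_le_trans tT.
have hs := rlimP sT (hr s (ltac:(by rewrite s0))).
have key x : s < x -> x <= T -> x < d -> v x <= rlim T v s.
  move=> sx xT xd; rewrite -lerN2; apply: (right_lim_le_at (right_limN_at hs)).
  exists (x - s) => [|z]; first by rewrite subr_gt0.
  rewrite addrC subrK lerN2 => /andP[sz zx].
  by apply: hv => //; [rewrite (le_trans s0)// ltW|exact: ltW|exact: lt_trans cs sz].
move: tT; rewrite le_eqVlt => /predU1P[tT|tT].
  have -> : rlim T v t = v t by rewrite tT rlimT.
  by apply: key => //; rewrite tT.
apply: (right_lim_le_at (rlimP tT (hr t (ltac:(by rewrite (le_trans s0 (ltW st))))))).
exists (Num.min d T - t) => [|x]; first by rewrite subr_gt0 lt_min td.
rewrite addrC subrK lt_min => /andP[tx /andP[xd xT]].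
by apply: key => //; [exact: lt_trans tx|exact: ltW].
Qed.

Lemma rlimN T v t : (forall t, 0 <= t < T -> exists l, right_lim v t l) -> 0 <= t <= T ->
  rlim T (fun x => - v x) t = - rlim T v t.
Proof.
move=> hr tT; have [t_T|tT'] := eqVneq t T; first by rewrite t_T !rlimT.
have {}tT' : t < T by rewrite lt_neqAle tT'; lra.
have hl := rlimP tT' (hr t ltac:(lra)).
by apply: rlim_lim => // e /hl[d d0 hd]; exists d => // x /hd; rewrite -opprD normrN.
Qed.

Lemma rlim_nondec T v c d : (forall t, 0 <= t < T -> exists l, right_lim v t l) ->
  (forall s t, 0 <= s -> s <= t -> t <= T -> c < s -> t < d -> v s <= v t) ->
  forall s t, 0 <= s -> s <= t -> t <= T -> c < s -> t < d -> rlim T v s <= rlim T v t.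
Proof.
move=> hr hv s t s0 st tT cs td.
have hr' t' : 0 <= t' < T -> exists l, right_lim (fun x => - v x) t' l.
  move=> /hr[l hl]; exists (- l) => e /hl[e' e'0 he']; exists e' => // x /he'.
  by rewrite -opprD normrN.
have := rlim_noninc hr' (c := c) (d := d) _ s0 st tT cs td.
have tT' : 0 <= t <= T by rewrite (le_trans s0).
have sT' : 0 <= s <= T by rewrite s0 (le_trans st).
rewrite !rlimN// lerN2; apply => s' t' s'0 st' t'T cs' t'd; rewrite lerN2; exact: hv.
Qed.

Lemma rlimD T f g t : (forall t, 0 <= t < T -> exists l, right_lim f t l) ->
  (forall t, 0 <= t < T -> exists l, right_lim g t l) -> 0 <= t <= T ->
  rlim T (fun x => f x + g x) t = rlim T f t + rlim T g t.
Proof.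
move=> hf hg /andP[t0]; rewrite le_eqVlt => /predU1P[->|tT]; first by rewrite !rlimT.
have tT' : 0 <= t < T by rewrite t0.
apply: rlim_lim => //; apply/right_limP; apply: cvgD; apply/right_limP; apply: rlimP => //.
  exact: hf.
exact: hg.
Qed.

(** [V] controls [v] exactly when [V + v] and [V - v] are nondecreasing, and monotonicity passes
    to right limits. *)
Lemma control_rlim T V v : control 0 T V v -> control 0 T (rlim T V) (rlim T v).
Proof.
move=> hV s t s0 st tT.
have sT' : 0 <= s <= T by rewrite s0 (le_trans st).
have tT' : 0 <= t <= T by rewrite (le_trans s0).
have rV := control_right_lim (control_self hV).
have mono f : control 0 T V f -> rlim T V s + rlim T f s <= rlim T V t + rlim T f t.
  move=> hf; have rf := control_right_lim hf; rewrite -!rlimD//.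
  have rVf := control_right_lim (controlD (control_self hV) hf).
  apply: (rlim_nondec (c := -1) (d := T + 1) rVf _ s0 st tT).
  - move=> a b a0 ab bT _ _; have := hf a b a0 ab bT; rewrite ler_norml lerBrDr => /andP[h _].
    by rewrite /= -lerBlDl (le_trans _ h)// opprB addrAC.
  - by apply: lt_le_trans s0; rewrite ltrN10.
  - by apply: le_lt_trans tT _; rewrite ltrDl.
have h1 := mono _ hV; have := mono _ (controlN hV); have rv := control_right_lim hV.
rewrite !rlimN// ler_norml; move: h1.
by move: (rlim T V s) (rlim T V t) (rlim T v s) (rlim T v t) => k1 k2 k3 k4; lra.
Qed.

Lemma right_lim_rlim T v : (forall t, 0 <= t < T -> exists l, right_lim v t l) ->
  forall t, 0 <= t < T -> right_lim (rlim T v) t (rlim T v t).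
Proof.
move=> hr t tT e e0; have tT' : t < T by lra.
have e20 : 0 < e / 2 by rewrite divr_gt0.
have [d d0 hd] := rlimP tT' (hr t tT) e20.
exists (Num.min d (T - t)); first by rewrite lt_min d0 subr_gt0.
move=> x /andP[tx]; rewrite -ltrBlDl lt_min ltrBlDl ltrD2r => /andP[xtd xT].
have xT' : 0 <= x < T by rewrite xT andbT ltW//; case/andP: tT => t0 _; exact: le_lt_trans tx.
have [x' [xx' x'd _ x'l]] := right_approx (rlimP xT (hr x xT')) e20 xtd xT.
have := hd x'; rewrite x'd (lt_trans tx xx') => /(_ isT) h.
rewrite -(subrKA (v x')) [e]splitr (le_lt_trans (ler_normD _ _))//.
by rewrite [X in X + _]distrC ltrD.
Qed.

Lemma rlim_Gr T V v : 0 < T -> control 0 T V v -> Gr T (rlim T v).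
Proof.
move=> T0 hV; split; first exact: control_regulated (control_rlim hV).
move=> t; rewrite in_itv/= => tT; have [->|tT'] := eqVneq t T; first by rewrite !rlimT.
have t_T : t < T by rewrite lt_neqAle tT'; lra.
rewrite [RHS](rlim_lim t_T (l := rlim T v t))//.
apply: right_lim_rlim; last lra.
by move=> x xT; exact: control_right_lim hV xT.
Qed.

End right_limits.

(** * Critical times and constancy of the play *)

Section constancy.
Variable R : realType.
Implicit Types (a b c d e s t x l k T r M : R) (f g h u v w y z V W p q : R -> R).

Lemma right_const_eq T w a b : a <= b -> b <= T -> cts a b w ->
  (forall t, a <= t < b -> const_right T w t) -> w b = w a.
Proof.
move=> ab bT cw hw.
pose S := [set x | a <= x <= b /\ w x = w a].
have Sa : S a by split => //; rewrite lexx.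
have uS : ubound S b by move=> x [/andP[]].
have hS : has_sup S by split; [exists a|exists b].
set c := sup S.
have ac : a <= c by apply: ub_le_sup => //; exists b.
have cb : c <= b by apply: ge_sup => //; exists a.
have wc : w c = w a.
  apply/eqP; rewrite -subr_eq0 -normr_le0; apply/ler_addgt0Pr => e e0; rewrite add0r.
  have [|d d0 hd] := cw c _ e e0; first lra.
  have [s [sab ws] cs] := sup_adherent d0 hS; rewrite -/c in cs.
  have sc : s <= c by apply: ub_le_sup; [exists b|split].
  by rewrite -ws distrC; apply: ltW; apply: hd => //; rewrite ltr_norml; lra.
move: cb; rewrite le_eqVlt => /predU1P[<-|cb]; first exact: wc.
have [d d0 hd] := hw c ltac:(lra).
pose x := c + Num.min d (b - c) / 2.
have m0 : 0 < Num.min d (b - c) by rewrite lt_min d0 subr_gt0.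
have m1 : Num.min d (b - c) <= d by rewrite ge_min lexx.
have m2 : Num.min d (b - c) <= b - c by rewrite ge_min lexx orbT.
have xc : x <= c.
  apply: ub_le_sup; [by exists b|split; first by rewrite /x; lra].
  by rewrite hd ?wc// /x; lra.
by exfalso; move: xc; rewrite /x; lra.
Qed.

(** Off the strictly active times the play is constant to the right: when [|y| < r] because no
    constraint acts, and at biactive times by definition. *)
Lemma Kptw_const_right T r y u t k : 0 < r -> stopsol T r u y -> Kptw T r y u t k -> k != 0 ->
  t < T -> const_right T (y \- u) t.
Proof.
move=> r0 sy hK k0 tT.
case: hK => [[]|[[_ _ [h|//]] _]|[[_ _ [h|//]] _]|[_ kE]].
- rewrite in_itv/= => t0 yt.
  have [d1 d10 hd1] := stopsol_near_lt sy t0 (le_lt_trans (ler_norm _) yt).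
  have yt' : - r < y t by move: yt; rewrite ltr_norml => /andP[].
  have [d2 d20 hd2] := stopsol_near_gt sy t0 yt'.
  exists (Num.min d1 d2); first by rewrite lt_min d10.
  move=> s /andP[ts]; rewrite -ltrBlDl lt_min => /andP[s1 s2] sT /=.
  have [_ h1] := hd1 t s ltac:(lra) ts sT ltac:(lra) ltac:(lra).
  have [_ h2] := hd2 t s ltac:(lra) ts sT ltac:(lra) ltac:(lra).
  lra.
- by move: tT; rewrite h ltxx.
- by move: tT; rewrite h ltxx.
- by rewrite kE eqxx in k0.
Qed.

Lemma Kptw_gt0 T r y u t k : 0 < r -> Kptw T r y u t k -> 0 < k -> y t < r.
Proof.
move=> r0 [[_ yt]|[[_ _ _] kE]|[[_ -> _] kE]|[_ kE]] k0; [|lra..].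
by move: yt; rewrite ltr_norml => /andP[].
Qed.

Lemma Kptw_lt0 T r y u t k : 0 < r -> Kptw T r y u t k -> k < 0 -> - r < y t.
Proof.
move=> r0 [[_ yt]|[[_ -> _] kE]|[[_ _ _] kE]|[_ kE]] k0; [|lra..].
by move: yt; rewrite ltr_norml => /andP[].
Qed.

(** The play is monotone near [t], so that a single return to its value at [t] would freeze it
    in between. *)
Lemma stopsol_not_const T r u y t : 0 < r -> stopsol T r u y -> 0 <= t < T ->
  ~ const_right T (y \- u) t ->
  exists2 d : R, 0 < d & forall x, t < x < t + d -> x <= T -> u t - y t <> u x - y x.
Proof.
move=> r0 sy tT nc.
wlog yr : u y sy nc / y t < r => [H|].
  case: (ltP (y t) r) => yr; first exact: (H u y).
  have [| |d d0 hd] := H _ _ (stopsol_opp sy); [|lra|].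
    move=> [d d0 hd]; apply: nc; exists d => // s h1 h2; have := hd s h1 h2 => /=; lra.
  by exists d => // x xd xT; have := hd x xd xT; lra.
have [d d0 hd] := stopsol_near_lt sy ltac:(lra) yr (t := t).
exists d => // x xd xT E; apply: nc; exists (x - t); first lra.
move=> s sx sT /=; have [_ h1] := hd t s ltac:(lra) ltac:(lra) sT ltac:(lra) ltac:(lra).
have [_ h2] := hd s x ltac:(lra) ltac:(lra) xT ltac:(lra) ltac:(lra).
lra.
Qed.

End constancy.

(** * The right-continuous derivative as a critical direction *)

Section adjoint_sign.
Variable R : realType.
Implicit Types (a b c d e s t x l k M : R) (f g v V p q : R -> R).
Variables (T r : R) (u h : R -> R) (Y : R -> R -> R) (W VW : R -> R).
Hypotheses (cu : cts 0 T u) (ch : cts 0 T h).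
Hypotheses (hY : stopfam T r u h Y) (hW : isWfun T u h Y W) (hV : control 0 T VW W).
Let y := Y 0.
Let f := rlim T W.

Let Wr t : 0 <= t < T -> exists l, right_lim W t l.
Proof. exact: control_right_lim hV. Qed.

Let fP t : 0 <= t < T -> right_lim W t (f t).
Proof. by move=> /[dup] /andP[_ tT] /Wr; exact: rlimP. Qed.

Let delta_right_lim t : 0 <= t < T -> right_lim (fun x => h x - W x) t (h t - f t).
Proof.
move=> tT e e0.
have [|d d0 hd] := cts_right_lim ch tT (e := e / 2); first lra.
have [|d' d'0 hd'] := fP tT (e := e / 2); first lra.
exists (Num.min d d'); first by rewrite lt_min d0.
move=> x /andP[tx]; rewrite -ltrBlDl lt_min => /andP[xd xd'].
have := hd x; have := hd' x.
rewrite tx/= => /(_ ltac:(lra)) + /(_ ltac:(lra)).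
by rewrite !ltr_norml; lra.
Qed.

Lemma rlim_deltaE t : 0 <= t <= T -> rlim T (fun t => h t - W t) t = h t - f t.
Proof.
move=> tT; have [->|tT'] := eqVneq t T; first by rewrite /f !rlimT.
have t_T : t < T by rewrite lt_neqAle tT'; case/andP: tT.
by apply: rlim_lim => //; apply: delta_right_lim; rewrite t_T; case/andP: tT => ->.
Qed.

(** Just after a strictly active time the play has moved, so that [W] has been reset to [h]. *)
Lemma rlim_W_reset t : 0 < r -> 0 <= t < T -> ~ const_right T (y \- u) t -> f t = h t.
Proof.
move=> r0 tT nc; have [d d0 hd] := stopsol_not_const r0 (stopfam0 hY) tT nc.
have tT' : 0 <= t <= T by lra.
have [d' d'0 hd'] := W_local r0 cu ch hY hW tT'.
apply: right_lim_uniq (fP tT) _ => e e0.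
have [|d2 d20 hd2] := cts_right_lim ch tT (e := e / 4); first lra.
exists (Num.min d (Num.min d' (Num.min d2 (T - t)))); first by rewrite !lt_min d0 d'0 d20; lra.
move=> x /andP[tx]; rewrite -ltrBlDl !lt_min => /and4P[xd xd' xd2 xT].
have hx := hd2 x ltac:(lra).
have osc z : t <= z <= x -> `|h z - h x| <= e / 2.
  move=> /andP[]; rewrite le_eqVlt => /predU1P[<-|tz] zx; first by rewrite distrC; lra.
  by have := hd2 z ltac:(lra); move: hx; rewrite ltr_norml ltr_norml ler_norml; lra.
have [_ H] := hd' t x (e / 2) ltac:(lra) ltac:(lra) ltac:(lra) ltac:(lra) ltac:(lra) osc.
have := H (hd x ltac:(lra) ltac:(lra)).
by move: hx; rewrite ltr_norml ler_norml ltr_norml; lra.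
Qed.

Lemma rlim_W_0 : 0 < T -> f 0 = h 0.
Proof.
move=> T0; have T00 : 0 <= (0:R) < T by rewrite lexx.
apply: right_lim_uniq (fP T00) _ => e e0.
have [|d d0 hd] := cts_right_lim ch T00 (e := e / 2); first lra.
exists (Num.min d T); first by rewrite lt_min d0.
move=> x /andP[x0]; rewrite add0r lt_min => /andP[xd xT].
have W0 : W 0 = h 0.
  have W0' := hW (t := 0) ltac:(rewrite lexx; lra).
  exact: right_lim_uniq W0' (isW_0 hY).
suff : `|W x - h 0| <= e / 2 by lra.
apply: (W_from cu ch hY hW (a := 0)); [by []|lra|lra|by rewrite W0 subrr normr0; lra|].
move=> z /andP[]; rewrite le_eqVlt => /predU1P[<-|z0] zx; first by rewrite subrr normr0; lra.
by apply/ltW/hd; lra.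
Qed.

(** Off the jumps to zero, the right-limit regularisation of the derivative is left
    continuous: a nonzero value excludes a reset nearby. *)
Lemma rlim_delta_jump t : 0 < T -> 0 < r -> 0 < t <= T -> h t - f t != 0 ->
  left_lim (fun x => h x - f x) t (h t - f t).
Proof.
move=> T0 r0 tT; set c := h t - f t => c0.
have tT' : 0 <= t <= T by lra.
have [d d0 hd] := W_local r0 cu ch hY hW tT'.
have c4 : 0 < `|c| / 4 by rewrite divr_gt0// normr_gt0.
have [d1 d10 hd1] := ch tT' c4.
pose D := Num.min d d1.
have D0 : 0 < D by rewrite lt_min d0.
have Dd : D <= d by rewrite /D ge_min lexx.
have Dd1 : D <= d1 by rewrite /D ge_min lexx orbT.
clearbody D.
have osc a b : 0 <= a -> a <= b -> b <= T -> t - D < a -> b < t + D ->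
    forall x, a <= x <= b -> `|h x - h b| <= `|c| / 2.
  move=> a0 ab bT ta bt x xab.
  have h1 := hd1 x ltac:(lra) ltac:(rewrite ltr_norml; lra).
  have h2 := hd1 b ltac:(lra) ltac:(rewrite ltr_norml; lra).
  by move: h1 h2; rewrite ltr_norml ltr_norml ler_norml; lra.
have Weq a b : 0 <= a -> a <= b -> b <= T -> t - D < a -> b < t + D ->
    `|c| / 2 < `|h b - W b| -> W b = W a.
  move=> a0 ab bT ta bt hb.
  have [H _] := hd a b (`|c| / 2) a0 ab bT ltac:(lra) ltac:(lra) (osc a b a0 ab bT ta bt).
  by case: H => // H; exfalso; move: H; rewrite distrC; lra.
(* a point [b >= t] arbitrarily close to [t] with the value [W b] close to [f t] *)
have near e : 0 < e -> exists b, [/\ t <= b, b <= T, b < t + D, `|W b - f t| < e &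
  `|c| / 2 < `|h b - W b|].
  move=> e0; have [tE|tE] := eqVneq t T.
    exists t; split; [lra|lra|lra|by rewrite /f tE rlimT subrr normr0|].
    have -> : h t - W t = c by rewrite /c /f {4}tE rlimT tE.
    by move: c4; lra.
  have tltT : t < T by rewrite lt_neqAle tE; lra.
  have [|d2 d20 hd2] := delta_right_lim (t := t) _ c4; first by lra.
  have tt2 : t < t + Num.min D d2 by rewrite ltrDl lt_min D0.
  have [b [tb btD bT bl]] := right_approx (fP (t := t) ltac:(lra)) e0 tt2 tltT.
  have m1 : Num.min D d2 <= D by rewrite ge_min lexx.
  have m2 : Num.min D d2 <= d2 by rewrite ge_min lexx orbT.
  exists b; split => //; [lra|lra|lra|].
  have := hd2 b ltac:(lra); rewrite -/c => k1.
  have := ler_normB (h b - W b) (h b - W b - c); rewrite opprB addrC subrK.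
  by move: k1 c4; lra.
have fE x : 0 <= x -> t - D < x -> x < t -> f x = f t.
  move=> x0 tx xt; apply/eqP; rewrite -subr_eq0 -normr_le0; apply/ler_addgt0Pr => e e0; rewrite add0r.
  have [b [tb bT bD bl bc]] := near (e / 2) (divr_gt0 e0 (ltr0n R 2)).
  have xT : x < T by apply: lt_le_trans xt _; case/andP: tT'.
  have e20 : 0 < e / 2 by rewrite divr_gt0.
  have [x' [xx' x't _ x'l]] := right_approx (fP (t := x) (ltac:(by rewrite x0))) e20 xt xT.
  have := Weq x' b (ltW (le_lt_trans x0 xx')) (ltW (lt_le_trans x't tb)) bT (lt_trans tx xx') bD bc => E.
  move: bl x'l; rewrite E; move: (W x') (f x) (f t) => k1 k2 k3.
  by rewrite distrC => bl x'l;
    rewrite [e]splitr -(subrKA k1) (le_trans (ler_normD _ _))// addrC lerD// ltW// distrC.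
move=> e e0; have [d2 d20 hd2] := ch tT' e0.
exists (Num.min (Num.min D d2) t); first by rewrite !lt_min D0 d20; lra.
move=> x /andP[]; rewrite ltrBlDr -ltrBlDl !lt_min => /andP[/andP[x1 x2] x3] xt.
rewrite fE; [|lra..].
rewrite (_ : h x - f t - c = h x - h t); last by rewrite /c; ring.
by apply: hd2; [|rewrite ltr_norml]; lra.
Qed.

(** At a biactive time [W] is monotone to the right, in the direction that preserves the sign
    that the active constraint imposes on [h - W]. *)
Lemma rlim_delta_Kred V : 0 < T -> 0 < r -> control 0 T V h ->
  Kred T r y u (rlim T (fun t => h t - W t)).
Proof.
move=> T0 r0 hVh; set z := rlim T _.
have zE t : 0 <= t <= T -> z t = h t - f t := @rlim_deltaE t.
have [cy yr d1 d2] := stopfam0 hY; rewrite -/y in cy yr d1 d2.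
have interior t : 0 <= t < T -> const_right T (y \- u) t ->
    (y t < r -> f t <= W t) /\ (- r < y t -> W t <= f t).
  move=> tT [d d0 hd]; have tT' : 0 <= t <= T by lra.
  have cst x : t < x -> x < t + d -> x < T -> u t - y t = u x - y x.
    by move=> tx xd xT; have := hd x ltac:(lra) ltac:(lra) => /=; lra.
  split=> yE.
    have [d' d'0 hd'] := stopsol_near_lt (stopfam0 hY) tT' yE.
    apply: (right_lim_le_at (fP tT)); exists (Num.min d (Num.min d' (T - t))).
      by rewrite !lt_min d0 d'0; lra.
    move=> x /andP[tx]; rewrite -ltrBlDl !lt_min => /and3P[xd xd' xT].
    have [yx _] := hd' t x ltac:(lra) ltac:(lra) ltac:(lra) ltac:(lra) ltac:(lra).
    by apply: (W_nonincr' cu ch hY hW _ _ _ yx (cst x _ _ _)); lra.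
  have [d' d'0 hd'] := stopsol_near_gt (stopfam0 hY) tT' yE.
  rewrite -lerN2; apply: (right_lim_le_at (right_limN_at (fP tT))).
  exists (Num.min d (Num.min d' (T - t))).
    by rewrite !lt_min d0 d'0; lra.
  move=> x /andP[tx]; rewrite -ltrBlDl !lt_min => /and3P[xd xd' xT]; rewrite lerN2.
  have [yx _] := hd' t x ltac:(lra) ltac:(lra) ltac:(lra) ltac:(lra) ltac:(lra).
  by apply: (W_nondecr cu ch hY hW _ _ _ yx (cst x _ _ _)); lra.
have T00 : 0 <= (0:R) <= T by lra.
split.
- have hd : control 0 T (fun t => V t + VW t) (fun t => h t - W t).
    exact: controlD hVh (controlN hV).
  exact: rlim_Gr hd.
- move=> t; rewrite in_itv/= => tT; have yt := yr t tT; have zt := zE t tT.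
  have [yE|yE] := ltP `|y t| r; first by constructor 1; split => //; rewrite in_itv.
  have [t_T|t_T] := eqVneq t T.
    have zd : z t = h t - W t by rewrite /z {1}t_T rlimT t_T.
    move: yE; rewrite ler_normr => /orP[yE|yE].
      have yE' : y t = r by lra.
      constructor 2; split; first by split; [rewrite in_itv|by []|left].
      by rewrite zd; exact: (delta_le0 hY hW tT yE').
    have yE' : y t = - r by lra.
    constructor 3; split; first by split; [rewrite in_itv|by []|left].
    by rewrite zd; exact: (delta_ge0 hY hW tT yE').
  have t_T' : 0 <= t < T by rewrite lt_neqAle t_T; lra.
  have [cr|nc] := pselect (const_right T (y \- u) t).
    have [i1 i2] := interior t t_T' cr.
    move: yE; rewrite ler_normr => /orP[yE|yE].
      have yE' : y t = r by lra.
      constructor 2; split; first by split; [rewrite in_itv|by []|right].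
      have := delta_le0 hY hW tT yE'; have := i2 ltac:(lra).
      by rewrite zt; lra.
    have yE' : y t = - r by lra.
    constructor 3; split; first by split; [rewrite in_itv|by []|right].
    have := delta_ge0 hY hW tT yE'; have := i1 ltac:(lra).
    by rewrite zt; lra.
  constructor 4; split; last by rewrite zt (rlim_W_reset r0 t_T' nc) subrr.
  split => //.
  by apply/eqP; rewrite eq_le yE andbT ler_norml.
- by rewrite zE// rlim_W_0// subrr.
- move=> t; rewrite in_itv/= => tT lz; apply/eqP/negPn/negP => zn; apply: lz.
  have [->|t0] := eqVneq t 0; first by rewrite llim0.
  have t0' : 0 < t by rewrite lt_neqAle eq_sym t0; lra.
  apply: llim_lim => //; rewrite zE//.
  have := rlim_delta_jump T0 r0 (t := t) ltac:(lra); rewrite -zE// => /(_ zn) H e /H[d d0 hd].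
  exists (Num.min d t); first by rewrite lt_min d0.
  move=> x /andP[]; rewrite ltrBlDr -ltrBlDl lt_min => /andP[xd x0] xt.
  by rewrite zE; [apply: hd; lra|lra].
Qed.

(** Near a time at which the left limit of [p] is not zero the play is constant, so that [W] is
    monotone there, in the direction that the sign of [p] prescribes. *)
Lemma rlim_W_sign p : 0 < r -> (forall t, 0 < t <= T -> exists l, left_lim p t l) ->
  p 0 = 0 -> (forall t, 0 <= t < T -> p t = llim p t) ->
  (forall t, 0 <= t <= T -> Kptw T r y u t (llim p t)) ->
  forall t, 0 <= t <= T -> exists2 d : R, 0 < d & forall s x, 0 <= s -> s <= t -> t <= x -> x <= T ->
    t - d < s -> x < t + d -> llim p t * (f x - f s) <= 0.
Proof.
move=> r0 pl p0 pE hK t tT; have sy := stopfam0 hY; have [cy _ _ _] := sy.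
have cw : cts 0 T (y \- u) by exact: ctsB.
have [->|pn] := eqVneq (llim p t) 0; first by exists 1 => // *; rewrite mul0r.
have t0 : 0 < t.
  rewrite lt_neqAle eq_sym; apply/andP; split; last by lra.
  by apply/eqP => t0; move: pn; rewrite t0 llim0 p0 eqxx.
have [dr dr0 hdr] : exists2 d : R, 0 < d & forall x, t <= x < t + d -> x <= T -> (y \- u) x = (y \- u) t.
  have [t_T|t_T] := eqVneq t T.
    by exists 1 => // x xt xT; congr (_ _); lra.
  by apply: (Kptw_const_right r0 sy (hK t tT) pn); rewrite lt_neqAle t_T; lra.
have [dl dl0 hdl] : exists2 d : R, 0 < d & forall x, 0 <= x -> t - d < x <= t -> (y \- u) x = (y \- u) t.
  have hl := llimP t0 (pl t ltac:(lra)).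
  have np : 0 < `|llim p t| by rewrite normr_gt0.
  have [d d0 hd] := hl _ np.
  exists d => // x x0 xt; symmetry.
  apply: (@right_const_eq _ T); [lra|lra|apply: cts_sub cw; lra|].
  move=> s sxt; have sT : 0 <= s < T by lra.
  have ps : p s != 0.
    by apply/eqP => ps; have := hd s ltac:(lra); rewrite ps sub0r normrN ltxx.
  apply: (Kptw_const_right r0 sy (hK s ltac:(lra))); last by lra.
  by rewrite -pE.
pose d := Num.min dr dl.
have d0 : 0 < d by rewrite lt_min dr0.
have ddr : d <= dr by rewrite /d ge_min lexx.
have ddl : d <= dl by rewrite /d ge_min lexx orbT.
clearbody d.
have cst x : 0 <= x -> x <= T -> t - d < x -> x < t + d -> u x - y x = u t - y t.
  move=> x0 xT tx xt; case: (leP x t) => xt'.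
    by have := hdl x x0 ltac:(lra) => /=; lra.
  by have := hdr x ltac:(lra) xT => /=; lra.
case: (ltP 0 (llim p t)) => ps.
  have [d' d'0 hd'] := stopsol_near_lt sy tT (Kptw_gt0 r0 (hK t tT) ps).
  exists (Num.min d d'); first by rewrite lt_min d0.
  move=> s x s0 st tx xT; rewrite ltrBlDr -ltrBlDl -ltrBlDl !lt_min => /andP[s1 s2] /andP[x1 x2].
  rewrite pmulr_rle0// subr_le0.
  apply: (rlim_noninc Wr (c := t - Num.min d d') (d := t + Num.min d d')) => //; last 3 first.
  - exact: le_trans st tx.
  - by rewrite ltrBlDr -ltrBlDl lt_min s1.
  - by rewrite -ltrBlDl lt_min x1.
  move=> a b a0 ab bT; rewrite ltrBlDr -ltrBlDl -ltrBlDl !lt_min => /andP[a1 a2] /andP[b1 b2].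
  have bd : b < t + d by rewrite -ltrBlDl.
  have ad : t - d < a by rewrite ltrBlDr -ltrBlDl.
  have bd' : b < t + d' by rewrite -ltrBlDl.
  have ad' : t - d' < a by rewrite ltrBlDr -ltrBlDl.
  have [yab _] := hd' a b a0 ab bT ad' bd'.
  apply: (W_nonincr' cu ch hY hW a0 ab bT yab); rewrite -/y.
  rewrite (cst a a0 (le_trans ab bT) ad (le_lt_trans ab bd)).
  by rewrite (cst b (le_trans a0 ab) bT (lt_le_trans ad ab) bd).
have {}ps : llim p t < 0 by rewrite lt_neqAle pn.
have [d' d'0 hd'] := stopsol_near_gt sy tT (Kptw_lt0 r0 (hK t tT) ps).
exists (Num.min d d'); first by rewrite lt_min d0.
move=> s x s0 st tx xT; rewrite ltrBlDr -ltrBlDl -ltrBlDl !lt_min => /andP[s1 s2] /andP[x1 x2].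
rewrite nmulr_rle0// subr_ge0.
apply: (rlim_nondec Wr (c := t - Num.min d d') (d := t + Num.min d d')) => //; last 3 first.
- exact: le_trans st tx.
- by rewrite ltrBlDr -ltrBlDl lt_min s1.
- by rewrite -ltrBlDl lt_min x1.
move=> a b a0 ab bT; rewrite ltrBlDr -ltrBlDl -ltrBlDl !lt_min => /andP[a1 a2] /andP[b1 b2].
have bd : b < t + d by rewrite -ltrBlDl.
have ad : t - d < a by rewrite ltrBlDr -ltrBlDl.
have bd' : b < t + d' by rewrite -ltrBlDl.
have ad' : t - d' < a by rewrite ltrBlDr -ltrBlDl.
have [yab _] := hd' a b a0 ab bT ad' bd'.
apply: (W_nondecr cu ch hY hW a0 ab bT yab); rewrite -/y.
rewrite (cst a a0 (le_trans ab bT) ad (le_lt_trans ab bd)).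
by rewrite (cst b (le_trans a0 ab) bT (lt_le_trans ad ab) bd).
Qed.

(** Integration by parts at the level of Stieltjes sums: [p] is left continuous and [f] is
    right continuous, so no jump terms appear. *)
Lemma KSint_rlim_W_ge0 p V I : 0 < T -> 0 < r -> control 0 T V p ->
  p 0 = 0 -> p T = 0 -> (forall t, 0 <= t < T -> p t = llim p t) ->
  (forall t, 0 <= t <= T -> Kptw T r y u t (llim p t)) ->
  is_KSint 0 T f p I -> 0 <= I.
Proof.
move=> T0 r0 hVp p0 pT pE hK hI.
have pl t : 0 < t <= T -> exists l, left_lim p t l by exact: control_left_lim hVp.
have E : f T * p T - f 0 * p 0 = 0 by rewrite p0 pT !mulr0 subrr.
rewrite -E; have hF := control_rlim hV; set F := rlim T VW in hF.
apply: (@KSint_ge_telescope _ 0 T f p (fun t => f t * p t) (V T + F T - (V 0 + F 0)) I T0 hI) => e e0.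
have /local_choice[d1 [d10 hd1]] := rlim_W_sign r0 pl p0 pE hK.
have /local_choice[d2 [d20 hd2]] : forall t, 0 <= t <= T -> exists2 d : R, 0 < d &
    forall s, 0 <= s -> s < t -> t - d < s -> `|p s - llim p t| <= e.
  move=> t tT; case: (ltP 0 t) => t0; last by exists 1 => // s s0 st; exfalso; lra.
  have [d d0 hd] := llimP t0 (pl t ltac:(lra)) e0.
  by exists d => // s s0 st ts; apply/ltW/hd; rewrite ts.
have /local_choice[d3 [d30 hd3]] : forall t, 0 <= t <= T -> exists2 d : R, 0 < d &
    forall x, x <= T -> t < x -> x < t + d -> `|f x - f t| <= e.
  move=> t tT; case: (ltP t T) => t_T; last by exists 1 => // x xT tx; exfalso; lra.
  have [|d d0 hd] := right_lim_rlim Wr (t := t) _ e0; first by lra.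
  by exists d => // x xT tx xd; apply/ltW/hd; rewrite tx.
exists (fun x => Num.min (d1 x) (Num.min (d2 x) (d3 x))).
  by move=> x xT; rewrite !lt_min d10 ?d20 ?d30.
exists (fun t => V t + F t) => // x s t [[s0 sx xt tT] [st]].
rewrite ltrBlDr -ltrBlDl -ltrBlDl !lt_min => /and3P[s1 s2 s3] /and3P[t1 t2 t3].
have xT : 0 <= x <= T by rewrite (le_trans s0 sx) (le_trans xt tT).
have H1 : llim p x * (f t - f s) <= 0.
  by apply: hd1 => //; rewrite ?ltrBlDr -?ltrBlDl.
have x0 : 0 <= x by case/andP: xT.
have xT' : x <= T by case/andP: xT.
have V1 := hVp s x s0 sx xT'; have V2 := hVp x t x0 xt tT.
have F1 := hF s x s0 sx xT'; have F2 := hF x t x0 xt tT.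
have H2 : `|(p t - llim p x) * (f t - f x)| <= e * (V t - V x).
  move: xt; rewrite le_eqVlt => /predU1P[<-|xt].
    by rewrite !subrr !mulr0 normr0.
  rewrite normrM mulrC; apply: ler_pM => //.
    by apply: hd3 => //; rewrite -ltrBlDl.
  by rewrite -pE// x0 (lt_le_trans xt).
have H3 : `|(p s - llim p x) * (f x - f s)| <= e * (F x - F s).
  move: sx; rewrite le_eqVlt => /predU1P[<-|sx].
    by rewrite !subrr !mulr0 normr0.
  rewrite normrM; apply: ler_pM => //.
  by apply: hd2 => //; rewrite ltrBlDr -ltrBlDl.
have V1' : e * (V s) <= e * (V x) by rewrite ler_pM2l//; move: (le_trans (normr_ge0 _) V1);
  rewrite subr_ge0.
have F2' : e * (F x) <= e * (F t) by rewrite ler_pM2l//; move: (le_trans (normr_ge0 _) F2);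
  rewrite subr_ge0.
move: H1 H2 H3 V1' F2';
  move: (f x) (f s) (f t) (llim p x) (p s) (p t) (V t) (V x) (V s) (F t) (F x) (F s).
move=> fx fs ft lx ps pt Vt Vx Vs Ft Fx Fs H1 H2 H3 V1' F2'.
have -> : fx * (pt - ps) = ft * pt - fs * ps - (pt - lx) * (ft - fx)
     - (ps - lx) * (fx - fs) - lx * (ft - fs) by ring.
by move: H1 H2 H3 V1' F2'; rewrite !ler_norml; lra.
Qed.

End adjoint_sign.

(** * Directions in which the stop operator is affine *)

Section exact_direction.
Variable R : realType.
Implicit Types (a b c d e s t x l k M T r : R) (f g h u v y z V p q : R -> R).

(** Soft thresholding of [x] at level [e]. *)
Definition soft e x := Num.max (x - e) 0 + Num.min (x + e) 0.

Lemma softP e x : 0 < e ->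
  [/\ e < x -> soft e x = x - e, x < - e -> soft e x = x + e & - e <= x <= e -> soft e x = 0].
Proof.
move=> e0; rewrite /soft; case: (leP (x - e) 0) => h1; case: (leP (x + e) 0) => h2; split; lra.
Qed.

Lemma softN e x : 0 < e -> soft e (- x) = - soft e x.
Proof.
by move=> e0; rewrite /soft; case: (leP (x - e) 0) => h1; case: (leP (x + e) 0) => h2;
  case: (leP (- x - e) 0) => h3; case: (leP (- x + e) 0) => h4; lra.
Qed.

Lemma soft_gt0 e x : 0 < e -> 0 < soft e x -> e < x.
Proof.
move=> e0; have [h1 h2 h3] := softP x e0; rewrite ltNge => /negP h; rewrite ltNge; apply/negP => xe.
apply: h; case: (ltP x (- e)) => xe'; [rewrite h2//|rewrite h3//]; lra.
Qed.

Lemma soft_lip e x x' : 0 < e -> `|soft e x - soft e x'| <= `|x - x'|.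
Proof.
move=> e0; wlog xx : x x' / x <= x' => [H|].
  by case: (leP x x') => xx; [|rewrite distrC (distrC x)]; apply: H => //; exact: ltW.
rewrite (ler0_norm (_ : x - x' <= 0)); last by rewrite subr_le0.
have [h1 h2 h3] := softP x e0; have [h1' h2' h3'] := softP x' e0.
rewrite ler_norml; apply/andP.
case: (ltP e x) => c1; [rewrite h1//|case: (ltP x (- e)) => c2; [rewrite h2//|rewrite h3; last lra]];
(case: (ltP e x') => c1'; [rewrite h1'//|case: (ltP x' (- e)) => c2'; [rewrite h2'//|rewrite h3';
  last lra]]); split; lra.
Qed.

Lemma soft_dist e x : 0 < e -> `|x - soft e x| <= e.
Proof.
move=> e0; have [h1 h2 h3] := softP x e0; rewrite ler_norml; apply/andP.
case: (ltP e x) => c1; [rewrite h1//|case: (ltP x (- e)) => c2; [rewrite h2//|rewrite h3;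
  last lra]]; split; lra.
Qed.

Lemma soft0 e : 0 < e -> soft e 0 = 0.
Proof. by move=> e0; have [_ _ ->//] := softP 0 e0; lra. Qed.

Lemma cts_soft T e z : 0 < e -> cts 0 T z -> cts 0 T (fun t => soft e (z t)).
Proof.
move=> e0 cz t tT e' e'0; have [d d0 hd] := cz t tT e' e'0; exists d => // s sT sd.
exact: le_lt_trans (soft_lip _ _ e0) (hd s sT sd).
Qed.

Lemma cts_max T f g : cts 0 T f -> cts 0 T g -> cts 0 T (fun t => Num.max (f t) (g t)).
Proof.
move=> cf cg t tT e e0; have [d d0 hd] := cf t tT e e0; have [d' d'0 hd'] := cg t tT e e0.
exists (Num.min d d'); first by rewrite lt_min d0.
move=> s sT; rewrite lt_min => /andP[/(hd s sT) h1 /(hd' s sT) h2].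
move: h1 h2; rewrite !ltr_norml.
by case: (leP (f s) (g s)) => h3; case: (leP (f t) (g t)) => h4; lra.
Qed.

Lemma Kptw_opp T r y u t k : Kptw T r y u t k ->
  Kptw T r (fun t => - y t) (fun t => - u t) t (- k).
Proof.
have cN s : const_right T (y \- u) s -> const_right T ((fun t => - y t) \- (fun t => - u t)) s.
  by move=> [d d0 hd]; exists d => // x h1 h2; have := hd x h1 h2 => /=; lra.
have cN' s : const_right T ((fun t => - y t) \- (fun t => - u t)) s -> const_right T (y \- u) s.
  by move=> [d d0 hd]; exists d => // x h1 h2; have := hd x h1 h2 => /=; lra.
case=> [[tT yt]|[[tT yt ct] kE]|[[tT yt ct] kE]|[[tT yt ct] kE]].
- by constructor 1; split => //; rewrite normrN.
- constructor 3; split; last by lra.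
  by split => //; [rewrite yt|case: ct; [left|right; exact: cN]].
- constructor 2; split; last by lra.
  by split => //; [rewrite yt opprK|case: ct; [left|right; exact: cN]].
- constructor 4; split; last by rewrite kE oppr0.
  by split => //; [rewrite normrN|move=> /cN'].
Qed.

(** By compactness the upper constraint keeps a positive margin wherever [z > e].  Wherever
    [z < - e], nearby times are not strictly active, and the play is locally constant. *)
Lemma exact_direction_up T r u y z e : 0 < T -> 0 < r -> 0 < e -> cts 0 T u -> stopsol T r u y ->
  cts 0 T z -> (forall t, 0 <= t <= T -> Kptw T r y u t (z t)) ->
  ev (fun x : R => (forall t, 0 <= t <= T -> y t + x * soft e (z t) <= r) /\
    forall s t, 0 <= s -> s <= t -> t <= T -> (forall a, s <= a <= t -> y a + x * soft e (z a) < r) ->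
      u t - y t <= u s - y s).
Proof.
move=> T0 r0 e0 cu sy cz hK; have [cy yr d1 d2] := sy.
have [M M0 hM] := cts_bounded (cts_soft e0 cz).
have cpsi : cts 0 T (fun t => Num.max (r - y t) (e - z t)).
  by apply: cts_max; apply: ctsB => //; exact: cts_cst.
have [t0 t0T ht0] := cts_argmin (ltW T0) cpsi.
set c := Num.max _ _ in ht0.
have c0 : 0 < c.
  rewrite /c lt_max; case: (ltP (y t0) r) => yt; first by rewrite subr_gt0 yt.
  apply/orP; right; rewrite subr_gt0; case: (ltP 0 (z t0)) => zt; last by lra.
  by have := Kptw_gt0 r0 (hK t0 t0T) zt; lra.
exists (c / M); first by rewrite divr_gt0.
move=> x /andP[x0]; rewrite ltr_pdivlMr// => xM; split.
  move=> t tT; have yt := yr t tT; case: (leP (soft e (z t)) 0) => zt.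
    have : x * soft e (z t) <= 0 by rewrite pmulr_rle0.
    lra.
  have ez := soft_gt0 e0 zt.
  have hc := ht0 t tT; have hc' : c <= r - y t.
    by move: hc; rewrite le_max => /orP[//|]; lra.
  have : x * soft e (z t) <= x * M.
    by rewrite ler_pM2l//; apply: le_trans (ler_norm _) (hM t tT).
  lra.
move=> s t s0 st tT hlt.
move: st; rewrite le_eqVlt => /predU1P[->//|st].
apply: (@chain_trans _ (fun a b => u b - y b <= u a - y a) s t st); last by move=> ? ? *; lra.
move=> a ast; have aT : 0 <= a <= T by lra.
case: (ltP (y a) r) => ya.
  have [d d0 hd] := stopsol_near_lt sy aT ya; exists d => // s' t' ss' s'a at' t't ds dt st'.
  by have [_] := hd s' t' ltac:(lra) ltac:(lra) ltac:(lra) ds dt.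
have zneg : soft e (z a) < 0.
  have := hlt a ast; rewrite -(pmulr_rlt0 _ x0); lra.
have zae : z a < - e.
  have : 0 < soft e (- z a) by rewrite softN// oppr_gt0.
  by move=> /(soft_gt0 e0); lra.
have [|d d0 hd] := cz a aT (- e - z a); first lra.
exists d => // s' t' ss' s'a at' t't ds dt st'.
suff : (y \- u) t' = (y \- u) s' by move=> /=; lra.
apply: (@right_const_eq _ T); [lra|lra|by apply: (@cts_sub _ 0 T); [lra|lra|exact: ctsB]|].
move=> b bst; apply: (Kptw_const_right r0 sy (hK b _)); [lra| |lra].
have := hd b ltac:(lra) ltac:(rewrite ltr_norml; lra); rewrite ltr_norml => zb.
by rewrite lt_eqF//; lra.
Qed.

(** Thresholding keeps the direction zero near strictly active times, by continuity of [z].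
    The play then does not react at all, and the output moves with the input. *)
Lemma exact_direction T r u y z e : 0 < T -> 0 < r -> 0 < e -> cts 0 T u -> stopsol T r u y ->
  cts 0 T z -> (forall t, 0 <= t <= T -> Kptw T r y u t (z t)) ->
  ev (fun x : R => stopsol T r (fun t => u t + x * soft e (z t)) (fun t => y t + x * soft e (z t))).
Proof.
move=> T0 r0 e0 cu sy cz hK.
have up := exact_direction_up T0 r0 e0 cu sy cz hK.
have dn := exact_direction_up T0 r0 e0 (ctsN cu) (stopsol_opp sy) (ctsN cz)
  (fun t tT => Kptw_opp (hK t tT)).
have [cy _ _ _] := sy.
apply: ev_impl (ev_and up dn) => x x0 [[h1 h2] [h3 h4]]; split.
- by apply: ctsD => //; apply: ctsZ; exact: cts_soft.
- move=> t tT; have := h1 t tT; have := h3 t tT; rewrite softN//.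
  by set S := soft e (z t); lra.
- move=> s t s0 st tT hh; have := h2 s t s0 st tT hh.
  by set S := soft e (z t); set S' := soft e (z s); lra.
- move=> s t s0 st tT hh; have := h4 s t s0 st tT.
  move=> /(_ ltac:(move=> a ast; have := hh a ast; rewrite softN//; set S := soft e (z a); lra)).
  by set S := soft e (z t); set S' := soft e (z s); lra.
Qed.

End exact_direction.

(** * Riesz representation of functionals on continuous functions *)

Section Riesz.
Variable R : realType.
Implicit Types (a b c e s t x k M T : R) (f g h V p phi psi : R -> R).

(** Continuous approximation, as [x] tends to [0+], of the indicator of the points below [t];
    it vanishes near [t], so that the approximations for [t] are dominated by those for
    points slightly below [t]. *)
Definition cutoff x t s := Num.max 0 (Num.min 1 ((t - s) / x - 1)).

Lemma cutoff01 x t s : 0 <= cutoff x t s <= 1.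
Proof. by rewrite /cutoff le_max lexx/= ge_max ler01/= ge_min lexx. Qed.

Lemma cutoff_eq1 x t s : 0 < x -> s <= t - 2 * x -> cutoff x t s = 1.
Proof.
move=> x0 h; rewrite /cutoff min_l ?max_r//.
by rewrite lerBrDr ler_pdivlMr//; lra.
Qed.

Lemma cutoff_eq0 x t s : 0 < x -> t - x <= s -> cutoff x t s = 0.
Proof.
move=> x0 h; rewrite /cutoff max_l// ge_min; apply/orP; right.
by rewrite subr_le0 ler_pdivrMr//; lra.
Qed.

Lemma cutoff_le x x' t t' s : 0 < x -> 0 < x' -> (t - s) / x <= (t' - s) / x' ->
  cutoff x t s <= cutoff x' t' s.
Proof.
move=> x0 x'0 h; rewrite /cutoff; set A := _ / x - 1; set B := _ / x' - 1.
have AB : A <= B by rewrite lerB.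
case: (leP 1 A) => hA; case: (leP 1 B) => hB; rewrite ?(max_r (@ler01 R));
  case: (leP 0 A) => hA'; case: (leP 0 B) => hB'; lra.
Qed.

Lemma cutoff_antitone x x' t s : 0 < x -> x <= x' -> cutoff x' t s <= cutoff x t s.
Proof.
move=> x0 xx; have x'0 : 0 < x' by lra.
case: (leP t s) => ts; last first.
  by apply: cutoff_le => //; rewrite ler_pM2l ?subr_gt0// lef_pV2.
by rewrite (cutoff_eq0 (x := x')); [case/andP: (cutoff01 x t s)|lra|lra].
Qed.

Lemma cutoff_monotone x t t' s : 0 < x -> t <= t' -> cutoff x t s <= cutoff x t' s.
Proof.
by move=> x0 tt; apply: cutoff_le => //; rewrite ler_pM2r ?invr_gt0//; lra.
Qed.

Lemma cutoff_lip x t s s' : 0 < x -> `|cutoff x t s - cutoff x t s'| <= x^-1 * `|s - s'|.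
Proof.
move=> x0; have xV : 0 < x^-1 by rewrite invr_gt0.
rewrite -{1}(gtr0_norm xV) -normrM /cutoff.
have -> : x^-1 * (s - s') = ((t - s') / x - 1) - ((t - s) / x - 1) by ring.
set A := _ / x - 1; set B := _ / x - 1; clearbody A B; clear.
wlog AB : A B / A <= B => [H|].
  by case: (leP A B) => AB; [|rewrite distrC (distrC B)]; apply: H => //; exact: ltW.
rewrite (ger0_norm (_ : 0 <= B - A)); last by rewrite subr_ge0.
rewrite ler_norml; apply/andP.
case: (leP 1 A) => hA; case: (leP 1 B) => hB; try lra;
  rewrite ?(max_r (@ler01 R)); case: (leP 0 A) => hA'; case: (leP 0 B) => hB'; split; lra.
Qed.

Lemma cts_cutoff T x t : 0 < x -> cts 0 T (cutoff x t).
Proof. by move=> x0; apply: (cts_lip (k := x^-1)) => s s' _ _; exact: cutoff_lip. Qed.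

Lemma right_lim_sum n (X : nat -> R -> R) (l : nat -> R) :
  (forall i, (i < n)%N -> right_lim (X i) 0 (l i)) ->
  right_lim (fun x => \sum_(i < n) X i x) 0 (\sum_(i < n) l i).
Proof.
elim: n => [|n ih] h.
  by rewrite big_ord0 => e e0; exists 1 => // x _; rewrite big_ord0 subrr normr0.
have := right_limB (ih (fun i iN => h i (ltnW iN))) (right_limN (h n (ltnSn n))).
rewrite big_ord_recr/= opprK => H e /H[d d0 hd]; exists d => // x xd.
by have := hd x xd; rewrite big_ord_recr/= opprK.
Qed.

Lemma cts_sum T n (c : nat -> R) (F : nat -> R -> R) : (forall i, (i < n)%N -> cts 0 T (F i)) ->
  cts 0 T (fun s => \sum_(i < n) c i * F i s).
Proof.
elim: n => [|n ih] h.
  by apply: cts_ext (@cts_cst _ 0 T 0) => s _; rewrite big_ord0.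
have := ctsD (ih (fun i iN => h i (ltnW iN))) (ctsZ (c n) (h n (ltnSn n))).
by apply: cts_ext => s _; rewrite big_ord_recr.
Qed.

Section functional.
Variables (T C : R) (L : (R -> R) -> R).
Hypothesis (T0 : 0 < T) (C0 : 0 <= C).
Hypothesis L_lin : forall k f g, cts 0 T f -> cts 0 T g ->
  L (fun t => k * f t + g t) = k * L f + L g.
Hypothesis L_bd : forall f M, cts 0 T f -> (forall t, 0 <= t <= T -> `|f t| <= M) ->
  `|L f| <= C * M.

Lemma L_sub f g : cts 0 T f -> cts 0 T g -> L (fun t => f t - g t) = L f - L g.
Proof.
move=> cf cg; rewrite (_ : (fun t => _) = fun t => -1 * g t + f t); last by apply/funext => t; ring.
by rewrite L_lin//; ring.
Qed.

Lemma L_eq0 f : cts 0 T f -> (forall t, 0 <= t <= T -> f t = 0) -> L f = 0.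
Proof.
move=> cf f0; apply/eqP; rewrite -normr_le0.
have := @L_bd f 0 cf; rewrite mulr0; apply => t tT.
by rewrite f0// normr0.
Qed.

Lemma L_sum n (c : nat -> R) (F : nat -> R -> R) : (forall i, (i < n)%N -> cts 0 T (F i)) ->
  L (fun s => \sum_(i < n) c i * F i s) = \sum_(i < n) c i * L (F i).
Proof.
elim: n => [|n ih] h.
  rewrite big_ord0; apply: L_eq0; first exact: (@cts_sum T 0 c F h).
  by move=> t _; rewrite big_ord0.
have h' i : (i < n)%N -> cts 0 T (F i) by move=> /ltnW; exact: h.
rewrite big_ord_recr/= -ih// addrC -(L_lin (c n) (h n (ltnSn n)) (@cts_sum T n c F h')).
by congr L; apply/funext => s; rewrite big_ord_recr/= addrC.
Qed.

(** The total variation of the measure that [L] represents, tested against [phi]. *)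
Definition tvL phi := sup [set `|L psi| | psi in [set psi | cts 0 T psi /\
  forall t, 0 <= t <= T -> `|psi t| <= phi t]].

Let tvL_has_ub phi M : (forall t, 0 <= t <= T -> phi t <= M) ->
  ubound [set `|L psi| | psi in [set psi | cts 0 T psi /\
    forall t, 0 <= t <= T -> `|psi t| <= phi t]] (C * M).
Proof.
move=> hM _ [psi [cp hp] <-]; apply: L_bd => // t tT; exact: le_trans (hp t tT) (hM t tT).
Qed.

Lemma tvL_ge phi psi M : (forall t, 0 <= t <= T -> phi t <= M) -> cts 0 T psi ->
  (forall t, 0 <= t <= T -> `|psi t| <= phi t) -> `|L psi| <= tvL phi.
Proof.
move=> hM cp hp; apply: ub_le_sup; first by exists (C * M); exact: tvL_has_ub.
by exists psi.
Qed.

Lemma tvL_le phi M : (forall t, 0 <= t <= T -> phi t <= M) -> (forall t, 0 <= t <= T -> 0 <= phi t) ->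
  tvL phi <= C * M.
Proof.
move=> hM h0; apply: ge_sup; last exact: tvL_has_ub.
exists `|L (fun=> 0)|, (fun=> 0) => //; split; first exact: cts_cst.
by move=> t tT; rewrite normr0; exact: h0.
Qed.

(** Competitors for [phi] and [phi'] can be given signs such that their values under [L] add up. *)
Lemma tvL_superadditive phi phi' M : (forall t, 0 <= t <= T -> 0 <= phi t) ->
  (forall t, 0 <= t <= T -> 0 <= phi' t) -> (forall t, 0 <= t <= T -> phi t + phi' t <= M) ->
  tvL phi + tvL phi' <= tvL (fun t => phi t + phi' t).
Proof.
move=> h0 h0' hM.
have ne f : (forall t, 0 <= t <= T -> 0 <= f t) -> [set `|L psi| | psi in [set psi | cts 0 T psi /\
    forall t, 0 <= t <= T -> `|psi t| <= f t]] !=set0.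
  move=> hf; exists `|L (fun=> 0)|, (fun=> 0) => //; split; first exact: cts_cst.
  by move=> t tT; rewrite normr0; exact: hf.
rewrite -lerBrDr; apply: ge_sup; first exact: ne.
move=> _ [psi [cp hp] <-]; rewrite lerBrDr -lerBrDl; apply: ge_sup; first exact: ne.
move=> _ [psi' [cp' hp'] <-]; rewrite lerBrDl.
have key k : `|k| <= 1 -> `|k * L psi' + L psi| <= tvL (fun t => phi t + phi' t).
  move=> k1; rewrite -L_lin//; apply: (tvL_ge hM).
    by apply: ctsD => //; exact: ctsZ.
  move=> t tT; apply: le_trans (ler_normD _ _) _; rewrite addrC; apply: lerD; first exact: hp.
  by rewrite normrM; apply: le_trans (hp' t tT); exact: ler_piMl.
have := key 1; have := key (-1); rewrite normrN normr1 => /(_ (lexx _)) + /(_ (lexx _)).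
have [hL|hL] := ger0P (L psi); have [hL'|hL'] := ger0P (L psi');
  rewrite !ler_norml; set N := tvL _; lra.
Qed.

Lemma tvL_incr phi phi' M : cts 0 T phi -> cts 0 T phi' ->
  (forall t, 0 <= t <= T -> 0 <= phi t <= phi' t) -> (forall t, 0 <= t <= T -> phi' t <= M) ->
  `|L phi' - L phi| <= tvL phi' - tvL phi.
Proof.
move=> cp cp' h hM; rewrite -L_sub//.
have := @tvL_superadditive phi (fun t => phi' t - phi t) M.
rewrite (_ : (fun t => phi t + (phi' t - phi t)) = phi'); last by apply/funext => t; ring.
move=> H; have {}H : tvL phi + tvL (fun t => phi' t - phi t) <= tvL phi'.
  apply: H => t tT; have := h t tT; have := hM t tT; lra.
suff : `|L (fun t => phi' t - phi t)| <= tvL (fun t => phi' t - phi t) by lra.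
apply: (@tvL_ge _ _ M); [|exact: ctsB|] => t tT; have := h t tT; have := hM t tT; first lra.
by move=> _ ?; rewrite ger0_norm; lra.
Qed.

Let c01 x t s : 0 <= s <= T -> cutoff x t s <= 1. Proof. by case/andP: (cutoff01 x t s). Qed.

Let N x t := tvL (cutoff x t).
(** The total variation on [0, t[ of the measure that [L] represents. *)
Definition massL t := sup [set N x t | x in [set x | 0 < x]].

Lemma N_le_mass x t : 0 < x -> N x t <= massL t.
Proof.
move=> x0; apply: ub_le_sup; last by exists x.
exists (C * 1) => _ [x' _ <-]; apply: tvL_le; first exact: c01.
by move=> s _; case/andP: (cutoff01 x' t s).
Qed.

Lemma mass_approx t e : 0 < e -> exists2 x : R, 0 < x & massL t - e < N x t.
Proof.
move=> e0; have : has_sup [set N x t | x in [set x | 0 < x]].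
  split; first by exists (N 1 t), 1 => //=; exact: ltr01.
  exists (C * 1) => _ [x' _ <-]; apply: tvL_le; first exact: c01.
  by move=> s _; case/andP: (cutoff01 x' t s).
by move=> /(sup_adherent e0)[_ [x x0 <-] h]; exists x.
Qed.

Lemma L_cutoff_incr x x' t t' : 0 < x -> 0 < x' ->
  (forall s, 0 <= s <= T -> cutoff x t s <= cutoff x' t' s) ->
  `|L (cutoff x' t') - L (cutoff x t)| <= N x' t' - N x t.
Proof.
move=> x0 x'0 h; apply: (@tvL_incr _ _ 1); [exact: cts_cutoff|exact: cts_cutoff| |exact: c01].
by move=> s sT; case/andP: (cutoff01 x t s) => -> _ /=; exact: h.
Qed.

(** Once the total variation of the cutoffs has nearly reached its supremum, their values
    under [L] can hardly change any more. *)
Lemma L_cutoff_lim t : exists l, right_lim (fun x => L (cutoff x t)) 0 l.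
Proof.
apply: right_lim_cauchy => e e0; have [|x0 x00 hx0] := mass_approx t (e := e / 2); first lra.
exists x0 => // x x'; rewrite add0r => /andP[xp xx0] /andP[xp' xx0'].
have h z : 0 < z -> z < x0 -> `|L (cutoff z t) - L (cutoff x0 t)| <= e / 2.
  move=> z0 zx; have := L_cutoff_incr (t := t) (t' := t) x00 z0
    (fun s _ => cutoff_antitone t s z0 (ltW zx)).
  by have := N_le_mass t z0; lra.
by have := h x xp xx0; have := h x' xp' xx0'; rewrite !ler_norml; lra.
Qed.

(** The measure of [0, t[. *)
Definition primL t : R := lim (L (cutoff x t) @[x --> 0^'+]).

Lemma primLP t : right_lim (fun x => L (cutoff x t)) 0 (primL t).
Proof. by have [l hl] := L_cutoff_lim t; rewrite /primL (right_lim_lim hl). Qed.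

Lemma primL_control a b : a <= b -> `|primL b - primL a| <= massL b - massL a.
Proof.
move=> ab; apply/ler_addgt0Pr => e e0.
have [x0 x00 hx0] := mass_approx a e0.
apply: (right_lim_norm_le (right_limB (primLP b) (primLP a))); exists x0 => // x /andP[xp xx].
have h1 := L_cutoff_incr (t := a) (t' := b) xp xp (fun s _ => cutoff_monotone s xp ab).
have h2 := L_cutoff_incr (t := a) (t' := a) x00 xp (fun s _ => cutoff_antitone a s xp (ltW xx)).
have := le_trans (normr_ge0 _) h2; have := N_le_mass b xp.
lra.
Qed.

Lemma primL_left t : left_lim primL t (primL t).
Proof.
move=> e e0; have [|x0 x00 hx0] := mass_approx t (e := e / 2); first lra.
exists (x0 / 2); first lra.
move=> s sxt; rewrite distrC; apply: le_lt_trans (primL_control (a := s) (b := t) ltac:(lra)) _.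
have x4 : 0 < x0 / 4 by lra.
have h z : 0 <= z <= T -> cutoff x0 t z <= cutoff (x0 / 4) s z.
  move=> _; case: (leP (t - x0) z) => zt.
    by rewrite cutoff_eq0//; case/andP: (cutoff01 (x0 / 4) s z).
  by rewrite (cutoff_eq1 (t := s))//; [case/andP: (cutoff01 x0 t z)|lra].
have := le_trans (normr_ge0 _) (L_cutoff_incr x00 x4 h).
have := N_le_mass s x4; lra.
Qed.

Lemma primL0 : primL 0 = 0.
Proof.
apply: right_lim_uniq (primLP 0) _; apply: (right_lim_ev_eq (@right_lim_cst _ 0)).
exists 1 => // x /andP[x0 _]; symmetry; apply: L_eq0; first exact: cts_cutoff.
by move=> s sT; rewrite cutoff_eq0//; lra.
Qed.

(** The distribution function of the measure that [L] represents.  Its value at [T] is the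
    total mass [L 1], which is [0] for the functionals of interest here. *)
Definition riesz t := if t < T then primL t else 0.

Lemma riesz_left t : 0 < t <= T -> left_lim riesz t (primL t).
Proof.
move=> tT e e0; have [d d0 hd] := @primL_left t e e0; exists d => // x xd.
by rewrite /riesz ifT; [exact: hd|lra].
Qed.

Lemma riesz_BV : BV T riesz.
Proof.
apply: (@control_BV _ T (fun t => massL t + if t < T then 0 else `|primL T|)) => //.
move=> a b a0 ab bT; rewrite /riesz /=.
have mab := primL_control ab; have m0 := le_trans (normr_ge0 _) mab.
case: (ltP b T) => bT'; first by have aT := le_lt_trans ab bT'; rewrite aT; lra.
have bE : b = T by apply/le_anti; rewrite bT.
case: (ltP a T) => aT; last by rewrite subrr normr0; lra.
rewrite sub0r normrN; have := ler_normB (primL T) (primL T - primL a).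
by rewrite opprB addrC subrK -bE; lra.
Qed.

(** The increments of the cutoffs at the partition points form a partition of unity, with which
    Stieltjes sums are values of [L] at functions that are uniformly close to [f]. *)
Lemma riesz_KSint f : L (fun=> 1) = 0 -> cts 0 T f -> is_KSint 0 T f riesz (L f).
Proof.
move=> L1 cf e e0.
have C1 : 0 < C + 1 by rewrite (le_lt_trans C0)// ltrDl.
have e1 : 0 < e / 2 / (C + 1) by rewrite !divr_gt0.
have [d d0 hd] := cts_uniform T0 cf e1.
exists (fun=> d / 4) => [x _|n t tau tp fp]; first lra.
have tT i : (i <= n)%N -> 0 <= t i <= T.
  have mono := tagged_partition_nondecr tp; case: (tp) => t0 tn _ _ iN.
  by apply/andP; split; [rewrite -t0|rewrite -tn]; apply: mono.
pose F x i : R -> R := if t i < T then cutoff x (t i) else fun=> 1.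
have cF x i : 0 < x -> cts 0 T (F x i).
  by move=> x0; rewrite /F; case: ifP => _; [exact: cts_cutoff|exact: cts_cst].
have limF i : right_lim (fun x => L (F x i)) 0 (riesz (t i)).
  by rewrite /riesz /F; case: ifP => _; [exact: primLP|rewrite L1; exact: right_lim_cst].
have E x : 0 < x -> L (fun s => \sum_(i < n) f (tau i) * (F x i.+1 s - F x i s)) =
    \sum_(i < n) f (tau i) * (L (F x i.+1) - L (F x i)).
  move=> x0; rewrite (@L_sum n (fun i => f (tau i)) (fun i s => F x i.+1 s - F x i s)).
    by apply: eq_bigr => i _; rewrite L_sub//; exact: cF.
  by move=> i _; apply: ctsB; exact: cF.
set S := \sum_(i < n) _.
suff : `|S - L f| <= e / 2 by lra.
have limS : right_lim (fun x => \sum_(i < n) f (tau i) * (L (F x i.+1) - L (F x i))) 0 S.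
  apply: (@right_lim_sum n (fun i x => f (tau i) * (L (F x i.+1) - L (F x i)))
    (fun i => f (tau i) * (riesz (t i.+1) - riesz (t i)))) => i _.
  have H := right_limB (limF i.+1) (limF i).
  move=> e' e'0; have k1 : 0 < `|f (tau i)| + 1 by rewrite ltr_wpDl.
  have [|d' d'0 hd'] := H (e' / (`|f (tau i)| + 1)); first by rewrite divr_gt0.
  exists d' => // x /hd'; rewrite ltr_pdivlMr// -mulrBr normrM => h; apply: le_lt_trans h.
  by rewrite mulrC ler_wpM2l//; lra.
apply: (right_lim_norm_le (right_limB limS (@right_lim_cst _ (L f)))).
exists (d / 4); first lra.
move=> x /andP[x0 xd]; rewrite -E// -L_sub//; last first.
  by apply: (@cts_sum _ _ (fun i => f (tau i)) (fun i s => F x i.+1 s - F x i s)) => i _;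
    apply: ctsB; exact: cF.
have -> : e / 2 = (C + 1) * (e / 2 / (C + 1)) by field; rewrite gt_eqF.
apply: (@le_trans _ _ (C * (e / 2 / (C + 1)))); last by rewrite ler_pM2r// lerDl.
apply: L_bd.
  apply: ctsB => //.
  by apply: (@cts_sum _ _ (fun i => f (tau i)) (fun i s => F x i.+1 s - F x i s)) => i _;
    apply: ctsB; exact: cF.
move=> s sT.
(* the increments of the cutoffs form a partition of unity on [0, T] *)
have Fn : F x n s = 1 by rewrite /F; case: (tp) => _ -> _ _; rewrite ltxx.
have F0 : F x 0%N s = 0.
  by rewrite /F; case: (tp) => -> _ _ _; rewrite T0 cutoff_eq0//; lra.
have Finc i : (i < n)%N -> 0 <= F x i.+1 s - F x i s.
  move=> iN; have [h1 h2 h3 h4] := tagged_partition_in tp iN.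
  rewrite subr_ge0 /F; case: (ltP (t i.+1) T) => h5.
    by rewrite ifT; [apply: cutoff_monotone => //; lra|lra].
  by case: ifP => // _; case/andP: (cutoff01 x (t i) s).
have sum1 : \sum_(i < n) (F x i.+1 s - F x i s) = 1.
  rewrite -[RHS]subr0 -[in RHS]F0 -[in RHS]Fn; elim: (n) => [|m ih].
    by rewrite big_ord0 subrr.
  by rewrite big_ord_recr/= ih; ring.
rewrite -[f s]mulr1 -[X in f s * X]sum1 mulr_sumr -sumrB.
apply: le_trans (ler_norm_sum _ _ _) _.
rewrite -[leRHS]mulr1 -[X in _ <= _ * X]sum1 mulr_sumr; apply: ler_sum => i _.
rewrite -mulrBl normrM (ger0_norm (Finc i (ltn_ord i))).
have [D0|Dn] := eqVneq (F x i.+1 s - F x i s) 0; first by rewrite D0 !mulr0.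
apply: ler_wpM2r; first exact: Finc.
have [[h1 h2 h3 h4] [h5 h6 h7]] := fine_atP tp fp (ltn_ord i).
have sl : t i - 2 * x < s.
  rewrite ltNge; apply/negP => sl; move/eqP: Dn; apply.
  have F1 j : t i <= t j -> F x j s = 1.
    by move=> tij; rewrite /F; case: ifP => // _; apply: cutoff_eq1 => //; lra.
  by rewrite !F1 ?subrr//; lra.
have sr : s <= t i.+1.
  rewrite leNgt; apply/negP => sr; move/eqP: Dn; apply.
  have h8 : t i.+1 < T by lra.
  have h9 : t i < T by lra.
  by rewrite /F h8 h9 !cutoff_eq0 ?subrr//; lra.
by apply/ltW/hd; [lra|lra|rewrite ltr_norml; lra].
Qed.

End functional.

End Riesz.

(** * Integrable functionals on bounded measurable functions *)

Section Linf_functional.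
Variables (R : realType) (T : R).
Implicit Types (M k : R) (f phi psi : R -> R).
Let nu : {measure set (measurableTypeR R) -> \bar R} := leb0T T.

(** Representatives of elements of L^oo(0, T). *)
Definition bdmeas M phi := measurable_fun (`]0, T[ : set (measurableTypeR R)) phi /\
  forall t, 0 < t < T -> `|phi t| <= M.

Let P phi : measurableTypeR R -> R := phi \_ `]0, T[.

Let P_in phi (t : R) : 0 < t < T -> P phi t = phi t.
Proof. by move=> tT; rewrite /P patchE mem_set//= in_itv. Qed.

Let P_out phi (t : R) : ~ (0 < t < T) -> P phi t = 0.
Proof. by move=> tT; rewrite /P patchE memNset//= in_itv. Qed.

Lemma bdmeas_ge0 M phi : 0 < T -> bdmeas M phi -> 0 <= M.
Proof. by move=> T0 [_ h]; apply: le_trans (h (T / 2) _) => //; lra. Qed.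

Let mP M phi : bdmeas M phi -> measurable_fun setT (P phi).
Proof.
move=> [mf _]; have [+ _] := @measurable_restrictT _ _ (measurableTypeR R) R `]0, T[ phi
  (measurable_itv _).
exact.
Qed.

Let P_bd M phi : 0 <= M -> bdmeas M phi -> forall t, `|P phi t| <= M.
Proof.
move=> M0 [_ h] t; have [tT|tT] := pselect (0 < t < T); first by rewrite P_in//; exact: h.
by rewrite P_out// normr0.
Qed.

Lemma bdmeasD M M' k phi psi : bdmeas M phi -> bdmeas M' psi ->
  bdmeas (`|k| * M + M') (fun t => k * phi t + psi t).
Proof.
move=> [m1 b1] [m2 b2]; split.
  apply: measurable_funD => //; apply: measurable_funM => //; exact: measurable_cst.
move=> t tT; apply: le_trans (ler_normD _ _) _; rewrite normrM; apply: lerD; last exact: b2.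
by rewrite ler_wpM2l//; exact: b1.
Qed.

Let nu_countable (N : set R) : countable N -> nu N = 0%E.
Proof.
move=> cN; apply/eqP; rewrite eq_le measure_ge0 andbT -(countable_lebesgue_measure0 cN).
have mN : measurable (N : set (measurableTypeR R)) by exact: countable_measurable.
by rewrite /nu /leb0T/= /mrestr; apply: le_measure; rewrite ?inE//; exact: measurableI.
Qed.

Variables (g : measurableTypeR R -> R) (D : Linf T -> R).
Hypotheses (T0 : 0 < T) (ig : nu.-integrable setT (EFin \o g)).
Hypothesis hD : forall z : Linf T, D z = \int[nu]_t (g t * z t).

Let mg : measurable_fun setT g.
Proof. by apply/measurable_EFinP; exact: measurable_int ig. Qed.

Let igM (h : measurableTypeR R -> R) M : measurable_fun setT h -> (forall t, `|h t| <= M) ->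
  nu.-integrable setT (EFin \o (fun t => g t * h t)).
Proof.
move=> mh hM; rewrite (_ : EFin \o _ = ((EFin \o g) \* (EFin \o h))%E); last first.
  by apply/funext => t /=; rewrite EFinM.
apply: integrableMl => //.
by exists M; split; [exact: num_real|move=> x Mx t _; apply: le_trans (hM t) (ltW Mx)].
Qed.

Let DE M phi : bdmeas M phi -> D (to_Linf T phi) = \int[nu]_t (g t * P phi t).
Proof.
move=> hphi; rewrite hD /Rintegral; congr fine.
have mz : measurable_fun (setT : set (measurableTypeR R)) (to_Linf T phi : measurableTypeR R -> R).
  by have /andP[+ _] := Lspace_repr_Lfun (to_Linf T phi); rewrite inE.
apply: ae_eq_integral => //.
- apply/measurable_EFinP; exact: measurable_funM.
- apply/measurable_EFinP; apply: measurable_funM => //; exact: mP hphi.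
have h1 := to_LinfE hphi.1 (M := M) ltac:(by move=> t; rewrite in_itv/=; exact: hphi.2).
have h2 : (P phi : R -> R) = phi %[ae nu].
  exists (~` `]0, T[); split; first exact: measurableC.
    by rewrite /nu /leb0T/= /mrestr setICl measure0.
  by move=> t /= + tT; apply => _; rewrite P_in//; move: tT; rewrite in_itv.
apply: (@filterS2 _ _ (ae_filter_ringOfSetsType (leb0T T)) _ _ _ _ h1 h2) => t {}h1 {}h2 _.
by have := h1 Logic.I; have := h2 Logic.I => /= -> ->.
Qed.

Definition normD : R := \int[nu]_t `|g t|.

Lemma normD_ge0 : 0 <= normD.
Proof. by apply: Rintegral_ge0. Qed.

Lemma D_bd M phi : bdmeas M phi -> `|D (to_Linf T phi)| <= normD * M.
Proof.
move=> hphi; have M0 := bdmeas_ge0 T0 hphi; have mp := mP hphi; have bp := P_bd M0 hphi.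
rewrite (DE hphi); apply: le_trans (le_normr_Rintegral _ (igM mp bp)) _ => //.
rewrite /normD -RintegralZr//; last first.
  by have := integrable_abse ig; apply: eq_integrable => //.
apply: le_Rintegral => //.
- by have := integrable_abse (igM mp bp); apply: eq_integrable => //.
- have : nu.-integrable setT (EFin \o (fun t => `|g t|)).
    by have := integrable_abse ig; apply: eq_integrable => //.
  move=> /(integrableZr measurableT M); apply: eq_integrable => //.
- by move=> t _; rewrite normrM ler_wpM2l.
Qed.

Lemma D_lin M M' k phi psi : bdmeas M phi -> bdmeas M' psi ->
  D (to_Linf T (fun t => k * phi t + psi t)) = k * D (to_Linf T phi) + D (to_Linf T psi).
Proof.
move=> h1 h2; rewrite (DE (bdmeasD k h1 h2)) (DE h1) (DE h2).
have M0 := bdmeas_ge0 T0 h1; have M'0 := bdmeas_ge0 T0 h2.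
have i1 := igM (mP h1) (P_bd M0 h1); have i2 := igM (mP h2) (P_bd M'0 h2).
rewrite -RintegralZl// -RintegralD//; last first.
  by have := integrableZl measurableT k i1; apply: eq_integrable => // t _ /=; rewrite EFinM.
apply: eq_Rintegral => t _.
have [tT|tT] := pselect (0 < t < T); first by rewrite !P_in//; ring.
by rewrite !P_out//; ring.
Qed.

Lemma D_ae_eq M M' phi psi : bdmeas M phi -> bdmeas M' psi ->
  countable [set t | 0 < t < T /\ phi t <> psi t] -> D (to_Linf T phi) = D (to_Linf T psi).
Proof.
move=> h1 h2 cN; rewrite (DE h1) (DE h2) /Rintegral; congr fine.
apply: ae_eq_integral => //.
- by apply/measurable_EFinP; apply: measurable_funM => //; exact: mP h1.
- by apply/measurable_EFinP; apply: measurable_funM => //; exact: mP h2.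
set N := [set t | _] in cN.
exists N; split; [exact: countable_measurable|exact: nu_countable|].
move=> t /= ht; have [tT|tT] := pselect (0 < t < T); last first.
  by exfalso; apply: ht => _; rewrite !P_out.
by split => // E; apply: ht => _; rewrite !P_in// E.
Qed.

Lemma D_cvg M phi (phin : nat -> R -> R) (N : set R) :
  (forall n, bdmeas M (phin n)) -> bdmeas M phi -> countable N ->
  (forall t, 0 < t < T -> ~ N t -> phin^~ t @ \oo --> phi t) ->
  D (to_Linf T (phin n)) @[n --> \oo] --> D (to_Linf T phi).
Proof.
move=> hn hphi cN hcv; have M0 := bdmeas_ge0 T0 hphi.
have [|||||_ _ H] := @dominated_convergence _ _ _ nu setT measurableT
  (fun n t => (g t * P (phin n) t)%:E) (fun t => (g t * P phi t)%:E)
  (fun t => (`|g t| * M)%:E).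
- move=> n; apply/measurable_EFinP; apply: measurable_funM => //; exact: mP (hn n).
- apply/measurable_EFinP; apply: measurable_funM => //; exact: mP hphi.
- exists N; split; [exact: countable_measurable|exact: nu_countable|].
  move=> t /= ht; have [//|nN] := pselect (N t); exfalso; apply: ht => _.
  apply: cvg_EFin; first exact: nearW.
  have -> : fine \o (fun n => (g t * P (phin n) t)%:E) = (fun n => g t * P (phin n) t) by [].
  apply: cvgMr.
  have [tT|tT] := pselect (0 < t < T).
    rewrite P_in// (_ : (fun n => P (phin n) t) = phin^~ t); first exact: (hcv t tT nN).
    by apply/funext => n; rewrite P_in.
  rewrite P_out// (_ : (fun n => P (phin n) t) = fun=> 0); first exact: cvg_cst.
  by apply/funext => n; rewrite P_out.
- have : nu.-integrable setT (EFin \o (fun t => `|g t|)).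
    by have := integrable_abse ig; apply: eq_integrable => //.
  move=> /(integrableZr measurableT M); apply: eq_integrable => //.
- apply/aeW => t n _; rewrite /= lee_fin normrM ler_wpM2l//.
  exact: P_bd (hn n) t.
have fin : (\int[nu]_t (g t * P phi t)%:E)%E \is a fin_num.
  by apply: integrable_fin_num => //; exact: (igM (mP hphi) (P_bd M0 hphi)).
rewrite (DE hphi) /Rintegral (_ : (fun n => _) = fun n =>
  fine (\int[nu]_t (g t * P (phin n) t)%:E)%E); last first.
  by apply/funext => n; rewrite (DE (hn n)).
apply: fine_cvg; rewrite fineK//; exact: H.
Qed.

End Linf_functional.

(** * Cutting off regulated functions near their zeros *)

Section regulated_tools.
Variable R : realType.
Implicit Types (a b c d e s t x l k M T : R) (f g h z V p phi : R -> R) (F : seq R).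

Lemma regulated_measurable T v : regulated T v ->
  measurable_fun (`]0, T[ : set (measurableTypeR R)) v.
Proof.
move: v; apply: regulated_ind.
- by move=> k; exact: measurable_cst.
- move=> f c k mf; apply: measurable_funD => //; apply: measurable_funM; first exact: measurable_cst.
  rewrite (_ : (fun x => _) = \1_(`]-oo, c[ : set (measurableTypeR R))); first exact: measurable_indic.
  by apply/funext => x; rewrite indicE mem_setE in_itv/=; case: ifP.
- move=> f c k mf; apply: measurable_funD => //; apply: measurable_funM; first exact: measurable_cst.
  rewrite (_ : (fun x => _) = \1_(`]-oo, c] : set (measurableTypeR R))); first exact: measurable_indic.
  by apply/funext => x; rewrite indicE mem_setE in_itv/=; case: ifP.
- move=> f h.
  have /choice[g hg] : forall n : nat, exists g, measurable_fun (`]0, T[ : set (measurableTypeR R)) g /\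
      forall x, 0 <= x <= T -> `|f x - g x| <= n.+1%:R^-1.
    by move=> n; have [|g mg fg] := h (n.+1%:R^-1); [rewrite invr_gt0|exists g].
  apply: (@measurable_fun_cvg _ _ _ _ g) => [n|x]; first by case: (hg n).
  rewrite /= in_itv/= => xT; apply/cvgrPdist_lt => e e0.
  have [N _ hN] := near_infty_natSinv_lt (PosNum e0).
  exists N => // n /hN /=; apply: le_lt_trans.
  by case: (hg n) => _; apply; lra.
Qed.

Lemma regulated_bdmeas T M v : regulated T v -> (forall t, 0 <= t <= T -> `|v t| <= M) ->
  bdmeas T M v.
Proof. by move=> rv vM; split; [exact: regulated_measurable|move=> t tT; apply: vM; lra]. Qed.

(** Every such time is a discontinuity of the monotone function [V]. *)
Lemma countable_rlim_neq T V v : 0 < T -> control 0 T V v ->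
  countable [set t | 0 < t < T /\ v t <> rlim T v t].
Proof.
move=> T0 hV.
apply: (sub_countable _ (discontinuity_countable (a := 0) (b := T) (F := V) _)).
  apply: subset_card_le => t /= [tT vt]; split; first by rewrite in_itv.
  have [l hl] := control_left_lim (control_self hV) (t := t) ltac:(lra).
  have [l' hl'] := control_right_lim (control_self hV) (t := t) ltac:(lra).
  split; [by apply/cvg_ex; exists l; apply/left_limP|by apply/cvg_ex; exists l'; apply/right_limP|].
  rewrite (left_lim_lim hl) (right_lim_lim hl'); apply/eqP => ll; apply: vt.
  have mono := control_mono hV.
  have Vl : V t <= l'.
    apply/ler_addgt0Pr => e e0; have tT' : t < T by lra.
    have [x [tx xT _ xl]] := right_approx hl' e0 tT' tT'.
    by have := mono t x ltac:(lra) ltac:(lra) ltac:(lra); move: xl; rewrite ltr_norml; lra.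
  have lV : l <= V t.
    apply/ler_addgt0Pr => e e0; have [d d0 hd] := hl e e0.
    pose x := t - Num.min d t / 2.
    have m0 : 0 < Num.min d t by rewrite lt_min d0; lra.
    have m1 : Num.min d t <= d by rewrite ge_min lexx.
    have m2 : Num.min d t <= t by rewrite ge_min lexx orbT.
    have := hd x ltac:(rewrite /x; lra).
    by have := mono x t ltac:(rewrite /x; lra) ltac:(rewrite /x; lra) ltac:(lra); rewrite ltr_norml; lra.
  symmetry; apply: rlim_lim; first lra.
  move=> e e0; have [d d0 hd] := hl' e e0; exists (Num.min d (T - t)); first by rewrite lt_min d0; lra.
  move=> x /andP[tx]; rewrite -ltrBlDl lt_min => /andP[xd xT].
  apply: le_lt_trans (hV t x ltac:(lra) ltac:(lra) ltac:(lra)) _.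
  by have := hd x ltac:(lra); rewrite ltr_norml; lra.
move=> x y; rewrite !in_itv/= => xT yT xy.
by apply: (control_mono hV); lra.
Qed.

(** [G] follows [V] next to [c], but only within [e / 2] of its one-sided limits at [c]. *)
Lemma punctured_variation T V c e : 0 < T -> control 0 T V V -> 0 <= c <= T -> 0 < e ->
  exists2 d : R, 0 < d & exists2 G, (forall s t, 0 <= s -> s <= t -> t <= T -> G s <= G t) &
    G T - G 0 <= e /\ forall s t, 0 <= s -> s <= t -> t <= T ->
      (c < s /\ t < c + d) \/ (c - d < s /\ t < c) -> V t - V s <= G t - G s.
Proof.
move=> T0 hV cT e0; have mono := control_mono hV; have e20 : 0 < e / 2 by lra.
have [d1 d10 [G1 m1 [b1 h1]]] : exists2 d : R, 0 < d & exists2 G, (forall s t, 0 <= s -> s <= t ->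
  t <= T -> G s <= G t) &
    G T - G 0 <= e / 2 /\ forall s t, 0 <= s -> s <= t -> t <= T -> c < s -> t < c + d ->
      V t - V s <= G t - G s.
  case: (ltP c T) => cT'; last first.
    exists 1 => //; exists (fun=> 0) => //; split; first by lra.
    by move=> s t s0 st tT cs; exfalso; lra.
  have [l hl] := control_right_lim hV (t := c) ltac:(lra).
  have [d d0 hd] := hl _ e20; exists d => //.
  have lV t : c < t -> t <= T -> l <= V t.
    move=> ct tT; apply/ler_addgt0Pr => e' e'0.
    have [x [cx xt xT xl]] := right_approx hl e'0 ct cT'.
    by have := mono x t ltac:(lra) ltac:(lra) ltac:(lra); move: xl; rewrite ltr_norml; lra.
  exists (fun t => if t <= c then l else Num.min (V t) (l + e / 2)).
    move=> s t s0 st tT; case: (leP s c) => sc; case: (leP t c) => tc; [by []| |lra|].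
      by rewrite le_min lV//=; lra.
    by rewrite le_min !ge_min mono// lexx orbT.
  split.
    have -> : (T <= c) = false by apply/negbTE; rewrite -ltNge.
    have -> : 0 <= c by case/andP: cT.
    have m : Num.min (V T) (l + e / 2) <= l + e / 2 by rewrite ge_min lexx orbT.
    by rewrite lerBlDr (addrC (e / 2) l).
  move=> s t s0 st tT cs td.
  rewrite !leNgt cs (lt_le_trans cs st)/=.
  by rewrite !min_l//; have := hd s ltac:(lra); have := hd t ltac:(lra); rewrite !ltr_norml; lra.
have [d2 d20 [G2 m2 [b2 h2]]] : exists2 d : R, 0 < d & exists2 G, (forall s t, 0 <= s -> s <= t ->
  t <= T -> G s <= G t) &
    G T - G 0 <= e / 2 /\ forall s t, 0 <= s -> s <= t -> t <= T -> c - d < s -> t < c ->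
      V t - V s <= G t - G s.
  case: (ltP 0 c) => cT'; last first.
    exists 1 => //; exists (fun=> 0) => //; split; first by lra.
    by move=> s t s0 st tT cs tc; exfalso; lra.
  have [l hl] := control_left_lim hV (t := c) ltac:(lra).
  have [d d0 hd] := hl _ e20; exists d => //.
  have lV t : 0 <= t -> t < c -> V t <= l.
    move=> t0 tc; apply/ler_addgt0Pr => e' e'0; have [d' d'0 hd'] := hl e' e'0.
    pose x := c - Num.min d' (c - t) / 2.
    have n0 : 0 < Num.min d' (c - t) by rewrite lt_min d'0; lra.
    have n1 : Num.min d' (c - t) <= d' by rewrite ge_min lexx.
    have n2 : Num.min d' (c - t) <= c - t by rewrite ge_min lexx orbT.
    have := hd' x ltac:(rewrite /x; lra).
    by have := mono t x ltac:(lra) ltac:(rewrite /x; lra) ltac:(rewrite /x; lra); rewrite ltr_norml; lra.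
  exists (fun t => if t < c then Num.max (V t) (l - e / 2) else l).
    move=> s t s0 st tT; case: (ltP s c) => sc; case: (ltP t c) => tc; [|rewrite ge_max lV//=;
      lra|lra|by []].
    by rewrite ge_max !le_max mono// lexx orbT.
  split.
    have -> : (T < c) = false by apply/negbTE; rewrite -leNgt; case/andP: cT.
    rewrite cT'.
    have m : l - e / 2 <= Num.max (V 0) (l - e / 2) by rewrite le_max lexx orbT.
    by rewrite lerBlDr -lerBlDl.
  move=> s t s0 st tT cs td.
  rewrite td (le_lt_trans st td) !max_l//.
    by have := hd s ltac:(lra); rewrite ltr_norml; lra.
  by have := hd t ltac:(lra); rewrite ltr_norml; lra.
exists (Num.min d1 d2); first by rewrite lt_min d10.
exists (fun t => G1 t + G2 t).
  by move=> s t s0 st tT; apply: lerD; [exact: m1|exact: m2].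
split; first lra.
have e1 : Num.min d1 d2 <= d1 by rewrite ge_min lexx.
have e2 : Num.min d1 d2 <= d2 by rewrite ge_min lexx orbT.
move=> s t s0 st tT [[cs td]|[sd tc]].
  have td1 : t < c + d1 by apply: lt_le_trans td _; rewrite lerD2l.
  have := h1 s t s0 st tT cs td1; have := m2 s t s0 st tT; lra.
have sd1 : c - d2 < s by apply: le_lt_trans sd; rewrite lerD2l lerN2.
have := h2 s t s0 st tT sd1 tc; have := m1 s t s0 st tT; lra.
Qed.

Lemma punctured_variation_seq T V F e : 0 < T -> control 0 T V V ->
  (forall c, c \in F -> 0 <= c <= T) -> 0 < e ->
  exists2 d : R, 0 < d & exists2 G, (forall s t, 0 <= s -> s <= t -> t <= T -> G s <= G t) &
    G T - G 0 <= e /\ forall c s t, c \in F -> 0 <= s -> s <= t -> t <= T ->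
      (c < s /\ t < c + d) \/ (c - d < s /\ t < c) -> V t - V s <= G t - G s.
Proof.
move=> T0 hV; elim: F e => [|c F ih] e hF e0.
  by exists 1 => //; exists (fun=> 0) => //; split; [lra|].
have [|d d0 [G mG [bG hG]]] := punctured_variation T0 hV (hF c (mem_head _ _)) (e := e / 2).
  lra.
have [||d' d'0 [G' mG' [bG' hG']]] := ih (e / 2); [|lra|].
  by move=> x xF; apply: hF; rewrite inE xF orbT.
exists (Num.min d d'); first by rewrite lt_min d0.
exists (fun t => G t + G' t).
  by move=> s t s0 st tT; apply: lerD; [exact: mG|exact: mG'].
split; first lra.
have e1 : Num.min d d' <= d by rewrite ge_min lexx.
have e2 : Num.min d d' <= d' by rewrite ge_min lexx orbT.
have near D x s t : Num.min d d' <= D ->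
    (x < s /\ t < x + Num.min d d') \/ (x - Num.min d d' < s /\ t < x) ->
    (x < s /\ t < x + D) \/ (x - D < s /\ t < x).
  move=> hD [[h1 h2]|[h1 h2]]; [left|right]; split=> //.
    by apply: lt_le_trans h2 _; rewrite lerD2l.
  by apply: le_lt_trans h1; rewrite lerD2l lerN2.
move=> x s t; rewrite inE => /orP[/eqP ->|xF] s0 st tT h.
  have := hG s t s0 st tT (near _ _ _ _ e1 h); have := mG' s t s0 st tT; lra.
have := hG' x s t xF s0 st tT (near _ _ _ _ e2 h); have := mG s t s0 st tT; lra.
Qed.

(** The gauge keeps intervals whose tag is outside [F] away from [F], where the variation of
    [p] is that of [punctured_variation_seq]; terms whose tag is in [F] vanish. *)
Lemma KSint_small_support T V p F M e : 0 < T -> control 0 T V p ->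
  (forall c, c \in F -> 0 <= c <= T) -> 0 < e -> 0 <= M ->
  exists2 d : R, 0 < d & forall phi I, (forall t, 0 <= t <= T -> `|phi t| <= M) ->
    (forall c, c \in F -> phi c = 0) ->
    (forall t, 0 <= t <= T -> (forall c, c \in F -> d <= `|t - c|) -> phi t = 0) ->
    is_KSint 0 T phi p I -> `|I| <= M * e.
Proof.
move=> T0 hV hF e0 M0.
have [d d0 [G mG [bG hG]]] := punctured_variation_seq T0 (control_self hV) hF e0.
exists (d / 2); first lra.
move=> phi I phiM phiF phi0 hI.
apply: (@le_trans _ _ (M * G T - M * G 0)); last by rewrite -mulrBr ler_wpM2l.
apply: (KSint_bound_telescope (H := fun x => M * G x) T0 hI).
have /local_choice[d1 [d10 hd1]] : forall x, 0 <= x <= T -> exists2 d1 : R, 0 < d1 &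
    phi x != 0 -> d1 <= d / 2 /\ exists2 c, c \in F & d1 <= `|x - c| < d / 2.
  move=> x xT; have [_|px] := eqVneq (phi x) 0; first by exists 1.
  have [[c cF cx]|nc] := pselect (exists2 c, c \in F & `|x - c| < d / 2); last first.
    move/eqP: px; case; apply: phi0 => // c cF.
    by rewrite leNgt; apply/negP => h; apply: nc; exists c.
  have xc : 0 < `|x - c|.
    by rewrite normr_gt0 subr_eq0; apply: contra px => /eqP ->; rewrite phiF.
  exists (Num.min (d / 2) `|x - c|); first by rewrite lt_min xc; lra.
  move=> _; split; first by rewrite ge_min lexx.
  by exists c => //; rewrite cx ge_min lexx orbT.
exists d1 => // x s t [[s0 sx xt tT] [st ds dt]].
have xT : 0 <= x <= T by lra.
have stl : s <= t by lra.
have Gst := mG s t s0 stl tT.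
rewrite -mulrBr; have [p0|px] := eqVneq (phi x) 0.
  by rewrite p0 mul0r normr0 mulr_ge0// subr_ge0.
rewrite normrM; apply: ler_pM => //; first exact: phiM.
apply: le_trans (hV s t s0 stl tT) _.
have [d1d [c cF /andP[d1c cd]]] := hd1 x xT px.
apply: (hG c) => //; move: d1c cd; case: (ltP x c) => xc.
  rewrite ltr0_norm ?subr_lt0// => d1c cd; right; split; lra.
rewrite ger0_norm ?subr_ge0// => d1c cd; left; split; lra.
Qed.

(** A continuous cutoff that is [0] on [F] and [1] at distance at least [k^-1] from [F]. *)
Definition chi k F t := foldr (fun c m => Num.min (Num.min 1 (k * `|t - c|)) m) 1 F.

Lemma chi01 k F t : 0 <= k -> 0 <= chi k F t <= 1.
Proof.
move=> k0; elim: F => [|c F /= /andP[ih1 ih2]] /=; first by rewrite ler01 lexx.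
by rewrite !le_min ler01 ih1 mulr_ge0//= ge_min ih2 orbT.
Qed.

Lemma chi_F k F c : 0 <= k -> c \in F -> chi k F c = 0.
Proof.
move=> k0; elim: F => // c' F ih; rewrite inE => /orP[/eqP <-|cF] /=.
  rewrite subrr normr0 mulr0 (min_r ler01) min_l//.
  by case/andP: (chi01 F c k0).
by rewrite ih// min_r// le_min ler01 mulr_ge0.
Qed.

Lemma chi_far k F t : (forall c, c \in F -> 1 <= k * `|t - c|) -> chi k F t = 1.
Proof.
elim: F => // c F ih h /=; rewrite ih; first by rewrite [X in Num.min X]min_l ?minxx// h// mem_head.
by move=> x xF; apply: h; rewrite inE xF orbT.
Qed.

Lemma cts_min T f g : cts 0 T f -> cts 0 T g -> cts 0 T (fun t => Num.min (f t) (g t)).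
Proof.
move=> cf cg; have := ctsN (cts_max (ctsN cf) (ctsN cg)).
by apply: cts_ext => t _; rewrite -oppr_min opprK.
Qed.

Lemma cts_chi T k F : cts 0 T (chi k F).
Proof.
elim: F => [|c F ih]; first exact: cts_cst.
apply: cts_min => //; apply: cts_min; first exact: cts_cst.
apply: (cts_lip (k := `|k|)) => s t _ _; rewrite -mulrBr normrM ler_wpM2l//.
by apply: le_trans (ler_dist_dist _ _) _; rewrite opprB addrA subrK.
Qed.

Lemma Gr_right_lim T z t : Gr T z -> 0 <= t < T -> right_lim z t (z t).
Proof.
move=> [rz hz] tT; have -> : z t = rlim T z t by apply: hz; rewrite in_itv/=; lra.
by apply: rlimP; [lra|exact: regulated_right_lim rz _ tT].
Qed.

(** In a punctured neighbourhood of any time, [z] is close to its one-sided limits there, so that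
    a zero in it has only small values around it.  By compactness only finitely many zeros
    remain. *)
Lemma regulated_zeros T z e : 0 < T -> 0 < e -> regulated T z ->
  exists2 F : seq R, (forall c, c \in F -> 0 <= c <= T /\ z c = 0) &
    forall t, 0 <= t <= T -> z t = 0 -> t \in F \/
      exists2 d : R, 0 < d & forall x, 0 <= x <= T -> `|x - t| < d -> `|z x| <= e.
Proof.
move=> T0 e0 rz.
pose Q c := exists2 F : seq R, (forall c, c \in F -> 0 <= c <= T /\ z c = 0) &
    forall t, 0 <= t <= c -> z t = 0 -> t \in F \/
      exists2 d : R, 0 < d & forall x, 0 <= x <= T -> `|x - t| < d -> `|z x| <= e.
have step x : 0 <= x <= T -> exists2 d : R, 0 < d & forall t, 0 <= t <= T -> `|t - x| < d ->
  t != x -> z t = 0 ->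
    exists2 d : R, 0 < d & forall y, 0 <= y <= T -> `|y - t| < d -> `|z y| <= e.
  move=> xT.
  have [d1 d10 hd1] : exists2 d : R, 0 < d & forall s t, x < s < x + d -> x < t < x + d ->
    t <= T -> `|z t - z s| < e.
    case: (ltP x T) => xT'; last by exists 1 => // s t _ h1 h2; exfalso; lra.
    have [|l hl] := regulated_right_lim rz (t := x); first lra.
    have [|d d0 hd] := hl (e / 2); first lra.
    exists d => // s t sd td _; have := hd s sd; have := hd t td; rewrite !ltr_norml; lra.
  have [d2 d20 hd2] : exists2 d : R, 0 < d & forall s t, x - d < s < x -> x - d < t < x ->
    0 <= t -> `|z t - z s| < e.
    case: (ltP 0 x) => xT'; last by exists 1 => // s t _ h1 h2; exfalso; lra.
    have [|l hl] := regulated_left_lim rz (t := x); first lra.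
    have [|d d0 hd] := hl (e / 2); first lra.
    exists d => // s t sd td _; have := hd s sd; have := hd t td; rewrite !ltr_norml; lra.
  exists (Num.min d1 d2); first by rewrite lt_min d10.
  move=> t tT; rewrite lt_min => /andP[]; case: (ltgtP t x) => // tx.
    rewrite ltr0_norm ?subr_lt0// => t1 t2 _ zt.
    exists (Num.min (x - t) (t - (x - d2))); first by rewrite lt_min; lra.
    move=> y yT; rewrite lt_min !ltr_norml => /andP[y1 y2].
    by have := hd2 t y ltac:(lra) ltac:(lra) ltac:(lra); rewrite zt subr0 => /ltW.
  rewrite gtr0_norm ?subr_gt0// => t1 t2 _ zt.
  exists (Num.min (t - x) (x + d1 - t)); first by rewrite lt_min; lra.
  move=> y yT; rewrite lt_min !ltr_norml => /andP[y1 y2].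
  by have := hd1 t y ltac:(lra) ltac:(lra) ltac:(lra); rewrite zt subr0 => /ltW.
suff : Q T by [].
apply: (@chain_induction _ Q 0 T T0); last first.
  have [z0|z0] := eqVneq (z 0) 0.
    exists [:: 0]; first by move=> c; rewrite inE => /eqP ->; split; lra.
    by move=> t t0 _; left; rewrite inE; apply/eqP; lra.
  exists [::] => // t t0 zt; exfalso; move/eqP: z0; apply.
  by rewrite -zt; congr (z _); lra.
move=> x xT; have [d d0 hd] := step x xT; exists d => // s t s0 sx xt tT ds dt st [F hF1 hF2].
exists (if z x == 0 then x :: F else F).
  case: eqVneq => [zx|_] c; last exact: hF1.
  by rewrite inE => /orP[/eqP ->|]; [split|exact: hF1].
move=> q qt zq; case: (leP q s) => qs.
  have [qF|h] := hF2 q ltac:(lra) zq; [left|by right].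
  by case: ifP => _ //; rewrite inE qF orbT.
have [qx|qx] := eqVneq q x; first by left; rewrite -qx zq eqxx inE eqxx.
by right; apply: (hd q) => //; [lra|rewrite ltr_norml; lra].
Qed.

(** Off its zeros [z] is continuous by hypothesis; at a zero in [F] the factor [chi] vanishes,
    and at any other zero [soft e z] vanishes nearby. *)
Lemma cts_soft_chi T z e F k : 0 < T -> 0 < e -> 0 <= k -> Gr T z ->
  (forall t, 0 <= t <= T -> llim z t <> z t -> z t = 0) ->
  (forall t, 0 <= t <= T -> z t = 0 -> t \in F \/
      exists2 d : R, 0 < d & forall x, 0 <= x <= T -> `|x - t| < d -> `|z x| <= e) ->
  cts 0 T (fun t => soft e (z t) * chi k F t).
Proof.
move=> T0 e0 k0 Gz jz hF t tT e' e'0; have [rz _] := Gz.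
have [M M0 hM] := regulated_bounded rz.
have M1 : 0 < M + 1 by lra.
have sM x : 0 <= x <= T -> `|soft e (z x)| <= M + 1.
  move=> xT; have := soft_lip (z x) 0 e0; rewrite soft0// !subr0 => h.
  by have := hM x xT; lra.
have [zt|zt] := eqVneq (z t) 0; last first.
  have [d d0 hd] : exists2 d : R, 0 < d &
      forall s, 0 <= s <= T -> `|s - t| < d -> `|z s - z t| < e' / 2.
    have [d1 d10 hd1] : exists2 d : R, 0 < d & forall s, t < s < t + d -> s <= T ->
      `|z s - z t| < e' / 2.
      case: (ltP t T) => tT'; last by exists 1 => // s h1 h2; exfalso; lra.
      have tT2 : 0 <= t < T by rewrite tT'; case/andP: tT => ->.
      have [d d0 hd] := Gr_right_lim Gz tT2 (divr_gt0 e'0 (ltr0n R 2)).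
      by exists d => // s sd _; exact: hd.
    have [d2 d20 hd2] : exists2 d : R, 0 < d & forall s, t - d < s < t -> 0 <= s ->
      `|z s - z t| < e' / 2.
      case: (ltP 0 t) => tT'; last by exists 1 => // s h1 h2; exfalso; lra.
      have ll : llim z t = z t by apply: contrapT => /(jz t tT) z0; move/eqP: zt; apply.
      have hl := llimP tT' (regulated_left_lim rz (t := t) ltac:(lra)).
      have [d d0 hd] := hl _ (divr_gt0 e'0 (ltr0n R 2)).
      by exists d => // s sd _; rewrite -ll; exact: hd.
    exists (Num.min d1 d2); first by rewrite lt_min d10.
    move=> s sT; rewrite lt_min !ltr_norml => /andP[s1 s2].
    case: (ltgtP s t) => st.
    - by have := hd2 s ltac:(lra) ltac:(lra); rewrite ltr_norml.
    - by have := hd1 s ltac:(lra) ltac:(lra); rewrite ltr_norml.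
    - by rewrite st subrr; lra.
  have e20 : 0 < e' / 2 / (M + 1) by rewrite !divr_gt0.
  have [d' d'0 hd'] := @cts_chi T k F t tT _ e20.
  exists (Num.min d d'); first by rewrite lt_min d0.
  move=> s sT; rewrite lt_min => /andP[s1 s2].
  have h1 := le_lt_trans (soft_lip (z s) (z t) e0) (hd s sT s1).
  have h2 := hd' s sT s2.
  rewrite (_ : _ - _ = (soft e (z s) - soft e (z t)) * chi k F s + soft e (z t) * (chi k F s - chi k F t)); last ring.
  apply: le_lt_trans (ler_normD _ _) _; rewrite !normrM.
  have c1 : `|chi k F s| <= 1 by rewrite ger0_norm; case/andP: (chi01 F s k0).
  have h3 : `|soft e (z s) - soft e (z t)| * `|chi k F s| <= `|soft e (z s) - soft e (z t)|.
    exact: ler_piMr.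
  have h4 : `|soft e (z t)| * `|chi k F s - chi k F t| <= (M + 1) * `|chi k F s - chi k F t|.
    by rewrite ler_wpM2r//; exact: sM.
  have : (M + 1) * `|chi k F s - chi k F t| < e' / 2 by rewrite mulrC -ltr_pdivlMr.
  lra.
have [tF|[d d0 hd]] := hF t tT zt.
  have e20 : 0 < e' / (M + 1) by rewrite !divr_gt0.
  have [d' d'0 hd'] := @cts_chi T k F t tT _ e20.
  exists d' => // s sT sd; rewrite zt soft0// mul0r subr0 normrM.
  have := hd' s sT sd; rewrite (chi_F k0 tF) subr0 ltr_pdivlMr// => h.
  by apply: le_lt_trans h; rewrite mulrC ler_wpM2l//; exact: sM.
exists d => // s sT sd; rewrite zt soft0// mul0r subr0.
have := hd s sT sd; rewrite ler_norml => h; have [_ _ s0] := softP (z s) e0.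
by rewrite s0// mul0r normr0.
Qed.

End regulated_tools.

(** * Test directions, and extension of the control functional *)

Section directional_derivatives.
Variable R : realType.
Implicit Types (a b c e s t x k l T r M : R) (f g h d u y z V p : R -> R).

(** [d] is on [0, T] the derivative at [u] in direction [h] of the stop operator with
    initial value [y 0], where [y] is the state of [u]. *)
Definition isdelta T r u y h d := exists Y, exists W,
  [/\ stopfam T r u h Y, isWfun T u h Y W, Y 0 = y & forall t, 0 <= t <= T -> d t = h t - W t].

Section fixed_state.
Variables (T r : R) (u y : R -> R).
Hypotheses (T0 : 0 < T) (r0 : 0 < r) (cu : cts 0 T u) (sy : stopsol T r u y).

Let T00 : 0 <= T. Proof. exact: ltW. Qed.
Let in0T : (0 : R) <= 0 <= T. Proof. by rewrite lexx. Qed.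
Lemma isdelta_ex h : cts 0 T h -> exists d, isdelta T r u y h d.
Proof.
move=> ch; have yr : - r <= y 0 <= r by case: sy => _ + _ _; apply.
have /choice[Y hY] : forall x, exists z, stopsol T r (fun t => u t + x * h t) z /\ z 0 = y 0.
  by move=> x; have [z sz z0] := stopsol_ex T0 r0 yr (@ctsuh _ _ _ _ cu ch x); exists z.
pose Y' x := if x == 0 then y else Y x.
have sY : stopfam T r u h Y'.
  move=> x _; rewrite /Y' eqxx; case: eqVneq => [->|_]; last exact: hY.
  by split=> //; rewrite (_ : (fun t => _) = u)//; apply/funext => t; rewrite mul0r addr0.
have /choice[W hW] : forall t, exists l, 0 <= t <= T -> isW u h Y' t l.
  move=> t; have [tT|tT] := pselect (0 <= t <= T); last by exists 0 => /tT.
  by have [l hl] := isW_ex r0 cu ch sY tT; exists l.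
exists (fun t => h t - W t), Y', W; split => //.
by rewrite /Y' eqxx.
Qed.

Lemma isdelta_lip h h' d d' M : cts 0 T h -> cts 0 T h' ->
  isdelta T r u y h d -> isdelta T r u y h' d' ->
  (forall t, 0 <= t <= T -> `|h t - h' t| <= M) ->
  forall t, 0 <= t <= T -> `|d t - d' t| <= 2 * M.
Proof.
move=> ch ch' [Y [W [sY hW Y0 dE]]] [Y' [W' [sY' hW' Y'0 dE']]] hM t tT.
rewrite dE// dE'//; apply: (delta_lip cu ch ch' sY hW sY' hW' _ T00 hM tT) => s _.
by rewrite Y0 Y'0.
Qed.

Lemma isdelta_le h h' d d' : cts 0 T h -> cts 0 T h' ->
  isdelta T r u y h d -> isdelta T r u y h' d' ->
  (forall s t, 0 <= s -> s <= t -> t <= T -> h' s - h s <= h' t - h t) ->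
  forall t, 0 <= t <= T -> d t <= d' t.
Proof.
move=> ch ch' [Y [W [sY hW Y0 dE]]] [Y' [W' [sY' hW' Y'0 dE']]] hM t tT.
rewrite dE// dE'//; apply: (delta_le cu ch ch' sY hW sY' hW' _ T00 hM tT) => s _.
by rewrite Y0 Y'0.
Qed.

Lemma isdelta_0 : isdelta T r u y (fun=> 0) (fun=> 0).
Proof.
exists (fun=> y), (fun=> 0); split => //; last by move=> t _; rewrite subrr.
  by move=> x _; split=> //; rewrite (_ : (fun t => _) = u)//; apply/funext => t; rewrite mulr0 addr0.
move=> t _; apply: lim_ev => e e0; exists 1 => // x _.
by rewrite /wfam !mulr0 subrr mul0r subrr normr0.
Qed.

(** The stop operator is invariant under constant shifts of its input. *)
Lemma isdelta_cst k d : isdelta T r u y (fun=> k) d -> forall t, 0 <= t <= T -> d t = 0.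
Proof.
move=> hd t tT; have c0 : cts 0 T (fun=> 0 : R) := @cts_cst _ 0 T 0.
have ck : cts 0 T (fun=> k) := @cts_cst _ 0 T k.
have h1 := isdelta_le c0 ck isdelta_0 hd (fun s t _ _ _ => ltac:(by [])) tT.
have h2 := isdelta_le ck c0 hd isdelta_0 (fun s t _ _ _ => ltac:(by [])) tT.
by apply/eqP; rewrite eq_le h1 h2.
Qed.

Lemma isdelta_bd h d M : cts 0 T h -> isdelta T r u y h d ->
  (forall t, 0 <= t <= T -> `|h t| <= M) -> forall t, 0 <= t <= T -> `|d t| <= 2 * M.
Proof.
move=> ch hd hM t tT; have c0 : cts 0 T (fun=> 0 : R) := @cts_cst _ 0 T 0.
rewrite -[d t]subr0; apply: (isdelta_lip ch c0 hd isdelta_0 _ tT) => s sT.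
by rewrite subr0; exact: hM.
Qed.

Lemma isdelta_bdmeas h d M : cts 0 T h -> isdelta T r u y h d ->
  (forall t, 0 <= t <= T -> `|h t| <= M) -> bdmeas T (2 * M) d.
Proof.
move=> ch hd hM; split; last by move=> t tT; apply: (isdelta_bd ch hd hM); lra.
case: hd => Y [W [sY hW Y0 dE]].
apply: (@measurable_fun_cvg _ _ _ _ (fun n t => (Y (n.+1%:R^-1) t - Y 0 t) / n.+1%:R^-1)).
  move=> n; apply: regulated_measurable; apply: cts_regulated => //.
  have [[c1 _ _ _] _] := sY (n.+1%:R^-1) (ltac:(by rewrite invr_ge0)).
  have [[c2 _ _ _] _] := sY 0 (lexx 0).
  have := ctsZ (n.+1%:R^-1)^-1 (ctsB c1 c2).
  by apply: cts_ext => t _; rewrite mulrC.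
move=> t; rewrite /= in_itv/= => tT; have tT' : 0 <= t <= T by lra.
rewrite dE//; apply/cvgrPdist_lt => e e0.
have [d1 d10 hd1] := ev_lim (deltaP hW tT') e0.
have [N _ hN] := near_infty_natSinv_lt (PosNum d10).
exists N => // n /hN /= hn; rewrite distrC; apply: hd1.
by rewrite invr_gt0 ltr0n/=.
Qed.

Lemma isdelta_exact h d : cts 0 T h -> isdelta T r u y h d -> h 0 = 0 ->
  ev (fun x : R => stopsol T r (fun t => u t + x * h t) (fun t => y t + x * h t)) ->
  forall t, 0 <= t <= T -> d t = h t.
Proof.
move=> ch [Y [W [sY hW Y0 dE]]] h0 hx t tT; rewrite dE//.
apply: (right_lim_uniq (deltaP hW tT)); apply: (right_lim_ev_eq (right_lim_cst (h t))).
apply: (ev_impl _ hx) => x x0 sx.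
have [sYx Yx0] := sY x (ltW x0).
rewrite (stopsol_uniq (@ctsuh _ _ _ _ cu ch x) sYx sx _ tT); last by rewrite Yx0 Y0 h0 mulr0 addr0.
by rewrite Y0 addrAC subrr add0r mulrC mulKf// gt_eqF.
Qed.

(** Once the derivative of the play has caught up with a direction, it stays equal to it for
    as long as the direction is constant. *)
Lemma isdelta_from h d a b : cts 0 T h -> isdelta T r u y h d -> 0 <= a -> a <= b -> b <= T ->
  d a = 0 -> (forall t, a <= t <= b -> h t = h a) -> d b = 0.
Proof.
move=> ch [Y [W [sY hW Y0 dE]]] a0 ab bT da hab.
have aT : 0 <= a <= T by lra.
have bT' : 0 <= b <= T by lra.
have Wa : W a = h a by move: da; rewrite dE//; move/subr0_eq.
have := @W_from _ T r u h Y W cu ch sY hW a b 0 a0 ab bT.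
rewrite Wa subrr normr0 lexx => /(_ isT) H.
have : `|W b - h a| <= 0 by apply: H => x xab; rewrite hab// subrr normr0.
by rewrite normr_le0 => /eqP/subr0_eq Wb; rewrite dE// Wb hab ?ab ?lexx// subrr.
Qed.

Lemma isdelta_at0 h d : cts 0 T h -> isdelta T r u y h d -> d 0 = 0.
Proof.
move=> ch [Y [W [sY hW Y0 dE]]]; rewrite dE//.
by rewrite (right_lim_uniq (hW _ in0T) (isW_0 sY)) subrr.
Qed.

(** Right after a strictly active time the derivative forgets its past. *)
Lemma isdelta_strict h d t : cts 0 T h -> isdelta T r u y h d -> 0 <= t < T ->
  ~ const_right T (y \- u) t -> (forall x, t <= x <= T -> h x = h t) ->
  exists2 e, 0 < e & forall x, t < x < t + e -> x <= T -> d x = 0.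
Proof.
move=> ch [Y [W [sY hW Y0 dE]]] tT nc ht.
have [d1 d10 hd1] := stopsol_not_const r0 sy tT nc.
have tT' : 0 <= t <= T by lra.
have [d2 d20 hd2] := W_local r0 cu ch sY hW tT'.
exists (Num.min d1 d2); first by rewrite lt_min d10.
move=> x; rewrite -ltrBlDl lt_min => /andP[tx /andP[x1 x2]] xT.
have [] := hd2 t x 0; [lra|lra|lra|lra|lra| |].
  by move=> s stx; rewrite ht ?(ht x) ?subrr ?normr0//; lra.
move=> _ H; rewrite dE; last lra.
have : `|W x - h x| <= 0 by apply: H; rewrite Y0; apply: hd1; lra.
by rewrite normr_le0 => /eqP/subr0_eq ->; rewrite subrr.
Qed.

Lemma isdelta_upper h d t : isdelta T r u y h d -> 0 <= t <= T -> y t = r -> d t <= 0.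
Proof.
move=> [Y [W [sY hW Y0 dE]]] tT yt; rewrite dE//.
by apply: (delta_le0 sY hW tT); rewrite Y0.
Qed.

Lemma isdelta_lower h d t : isdelta T r u y h d -> 0 <= t <= T -> y t = - r -> 0 <= d t.
Proof.
move=> [Y [W [sY hW Y0 dE]]] tT yt; rewrite dE//.
by apply: (delta_ge0 sY hW tT); rewrite Y0.
Qed.

End fixed_state.
End directional_derivatives.

Section extension.
Variables (R : realType) (T : R) (U : lmodType R) (iota : {linear U -> (R -> R)}).
Variables (ell : U -> R) (K : R).
Implicit Types (f g : R -> R) (h : U) (k t M e : R).

Lemma iotaE k h h' t : iota (k *: h + h') t = k * iota h t + iota h' t.
Proof. by rewrite linearP. Qed.

Definition near_by h f M := forall t, 0 <= t <= T -> `|iota h t - f t| <= M.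

Hypotheses (T0 : 0 < T) (K0 : 0 <= K).
Hypothesis ell_lin : forall k h h', ell (k *: h + h') = k * ell h + ell h'.
Hypothesis ell_bd : forall h M, (forall t, 0 <= t <= T -> `|iota h t| <= M) -> `|ell h| <= K * M.
Hypothesis iota_approx : forall f e, cts 0 T f -> 0 < e -> exists h, near_by h f e.

(** The largest value that the Lipschitz bound imposed by the elements of [U] permits from
    below, as in McShane's extension theorem. *)
Definition extend f : R := sup [set l | exists h, exists2 M, near_by h f M & l = ell h - K * M].

(** For any two elements of [U] close to [f], the lower bound from one is below the upper bound
    from the other. *)
Lemma extend_near h f M : near_by h f M -> `|ell h - extend f| <= K * M.
Proof.
move=> hf; rewrite ler_norml lerBrDr.
have ub : ubound [set l | exists h, exists2 M, near_by h f M & l = ell h - K * M] (ell h + K * M).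
  move=> _ [h' [M' hf' ->]].
  have : `|ell (-1 *: h' + h)| <= K * (M + M').
    apply: ell_bd => t tT; rewrite iotaE (_ : _ + _ = (iota h t - f t) - (iota h' t - f t)); last ring.
    by apply: le_trans (ler_normB _ _) _; apply: lerD; [exact: hf|exact: hf'].
  rewrite ell_lin ler_norml mulrDr; lra.
have h1 : ell h - K * M <= extend f.
  by apply: ub_le_sup; [exists (ell h + K * M)|exists h, M].
have h2 : extend f <= ell h + K * M.
  by apply: ge_sup => //; exists (ell h - K * M), h, M.
by apply/andP; split; lra.
Qed.

Lemma extend_lin k f g : cts 0 T f -> cts 0 T g ->
  extend (fun t => k * f t + g t) = k * extend f + extend g.
Proof.
move=> cf cg; apply/eqP; rewrite -subr_eq0 -normr_le0; apply/ler_addgt0Pr => e e0.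
pose m := e / (2 * (K + 1) * (`|k| + 1)).
have k1 : 0 < `|k| + 1 by have := normr_ge0 k; lra.
have K1 : 0 < K + 1 by rewrite ltr_wpDl.
have m0 : 0 < m by rewrite divr_gt0// !mulr_gt0.
have [h hf] := iota_approx cf m0; have [h' hg] := iota_approx cg m0.
have H : near_by (k *: h + h') (fun t => k * f t + g t) ((`|k| + 1) * m).
  move=> t tT; rewrite iotaE (_ : _ - _ = k * (iota h t - f t) + (iota h' t - g t)); last ring.
  apply: le_trans (ler_normD _ _) _; rewrite mulrDl mul1r normrM; apply: lerD; last exact: hg.
  by rewrite ler_wpM2l//; exact: hf.
have e1 := extend_near H; have e2 := extend_near hf; have e3 := extend_near hg.
rewrite add0r (_ : _ - _ = - (ell (k *: h + h') - extend (fun t => k * f t + g t)) +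
   (k * (ell h - extend f) + (ell h' - extend g))); last by rewrite ell_lin; ring.
apply: le_trans (ler_normD _ _) _; rewrite normrN.
have e4 : `|k * (ell h - extend f) + (ell h' - extend g)| <= `|k| * (K * m) + K * m.
  apply: le_trans (ler_normD _ _) _; rewrite normrM; apply: lerD => //.
  by rewrite ler_wpM2l.
apply: le_trans (lerD e1 e4) _.
rewrite (_ : _ + _ = 2 * K * (`|k| + 1) * m); last ring.
apply: (@le_trans _ _ (2 * (K + 1) * (`|k| + 1) * m)); last first.
  by rewrite /m mulrC divfK// gt_eqF// !mulr_gt0.
by rewrite ler_pM2r// ler_pM2r// ler_pM2l// lerDl.
Qed.

Lemma extend_bd f M : cts 0 T f -> (forall t, 0 <= t <= T -> `|f t| <= M) ->
  `|extend f| <= K * M.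
Proof.
move=> cf fM.
have M0 : 0 <= M by apply: le_trans (fM 0 _) => //; rewrite lexx ltW.
have n0 : near_by 0 f M.
  by move=> t tT; rewrite linear0 sub0r normrN; exact: fM.
have l0 : ell 0 = 0 by have := ell_lin 1 0 0; rewrite scale1r addr0 mul1r; lra.
by have := extend_near n0; rewrite l0 sub0r normrN.
Qed.

Lemma extend_iota h : extend (iota h) = ell h.
Proof.
have : near_by h (iota h) 0 by move=> t _; rewrite subrr normr0.
by move/extend_near; rewrite mulr0 normr_le0 subr_eq0 => /eqP.
Qed.

End extension.

(** * The multiplier *)

Section adjoint.
Variable R : realType.
Implicit Types (a b c e s t x k l M V : R) (f h d z p phi : R -> R).

Lemma Kptw_intro T r u y t k : 0 <= t <= T -> - r <= y t <= r ->
  (y t = r -> t = T \/ const_right T (y \- u) t -> k <= 0) ->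
  (y t = - r -> t = T \/ const_right T (y \- u) t -> 0 <= k) ->
  (t < T -> ~ const_right T (y \- u) t -> `|y t| = r -> k = 0) ->
  Kptw T r y u t k.
Proof.
move=> tT ytr h1 h2 h3; have tin : t \in `[0, T] by rewrite in_itv.
have [ltr|gtr] := ltP `|y t| r; first exact: Or41.
have {gtr} yr : `|y t| = r by apply/eqP; rewrite eq_le gtr andbT ler_norml.
have r0 : 0 <= r by rewrite -yr.
have [cr|nc] := pselect (t = T \/ const_right T (y \- u) t); last first.
  apply: Or44; have tT' : t < T.
    by rewrite lt_neqAle; case/andP: tT => _ ->; rewrite andbT; apply/eqP => E; apply: nc; left.
  have nc' : ~ const_right T (y \- u) t by move=> H; apply: nc; right.
  split; last exact: h3.
  by split=> //; rewrite in_itv/= tT'; case/andP: tT => ->.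
case: (leP 0 (y t)) yr => y0.
  by rewrite ger0_norm// => yr; apply: Or42; split; [split|exact: h1].
rewrite ltr0_norm// => yr; have yr' : y t = - r by rewrite -yr opprK.
by apply: Or43; split; [split|exact: h2].
Qed.

Lemma Kptw_sign T r u y t k k' : Kptw T r y u t k -> (k <= 0 -> k' <= 0) -> (0 <= k -> 0 <= k') ->
  Kptw T r y u t k'.
Proof.
move=> [h|[h k0]|[h k0]|[h k0]] h1 h2; [exact: Or41|by apply: Or42; split=> //; exact: h1| |].
  by apply: Or43; split=> //; exact: h2.
by apply: Or44; split=> //; apply/eqP; rewrite eq_le h1 ?h2// k0.
Qed.

Lemma regulatedD T f g : 0 < T -> regulated T f -> regulated T g ->
  regulated T (fun t => f t + g t).
Proof.
move=> T0 rf rg; apply: lims_regulated => // t tT.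
  have [l /right_limP hl] := regulated_right_lim rf tT.
  have [l' /right_limP hl'] := regulated_right_lim rg tT.
  by exists (l + l'); apply/right_limP; exact: cvgD hl hl'.
have [l /left_limP hl] := regulated_left_lim rf tT.
have [l' /left_limP hl'] := regulated_left_lim rg tT.
by exists (l + l'); apply/left_limP; exact: cvgD hl hl'.
Qed.

Lemma regulated_comp_lip T f (q : R -> R) : 0 < T -> (forall a b, `|q a - q b| <= `|a - b|) ->
  regulated T f -> regulated T (fun t => q (f t)).
Proof.
move=> T0 lq rf; apply: lims_regulated => // t tT.
  have [l hl] := regulated_right_lim rf tT; exists (q l) => e e0.
  by have [d d0 hd] := hl e e0; exists d => // x /hd; exact: le_lt_trans.
have [l hl] := regulated_left_lim rf tT; exists (q l) => e e0.
by have [d d0 hd] := hl e e0; exists d => // x /hd; exact: le_lt_trans.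
Qed.

Lemma regulatedZ T k f : 0 < T -> regulated T f -> regulated T (fun t => k * f t).
Proof.
move=> T0 rf; apply: lims_regulated => // t tT.
  have [l /right_limP hl] := regulated_right_lim rf tT.
  by exists (k * l); apply/right_limP; exact: cvgMr.
have [l /left_limP hl] := regulated_left_lim rf tT.
by exists (k * l); apply/left_limP; exact: cvgMr.
Qed.

Section multiplier_functional.
Variables (T : R) (g : measurableTypeR R -> R) (D : Linf T -> R) (D2 : R) (p : R -> R) (V : R -> R).
Hypotheses (T0 : 0 < T) (ig : (leb0T T).-integrable setT (EFin \o g)).
Hypothesis hD : forall z : Linf T, D z = \int[leb0T T]_t (g t * z t).
Hypothesis hV : control 0 T V p.

Lemma D_0 : D (to_Linf T (fun=> 0)) = 0.
Proof.
have z0 : bdmeas T 0 (fun=> 0 : R).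
  by split; [exact: measurable_cst|move=> x _; rewrite normr0].
by have := D_bd T0 ig hD z0; rewrite mulr0 normr_le0 => /eqP.
Qed.

(** The multiplier that the adjoint equation dictates. *)
Definition multiplier z := D (to_Linf T z) + D2 * z T + KSint 0 T z p.

Lemma KSint_reg z : regulated T z -> is_KSint 0 T z p (KSint 0 T z p).
Proof. by move=> rz; have [I /is_KSintP] := regulated_KSint T0 hV rz; apply. Qed.

Lemma multiplier_lin k z z' : regulated T z -> regulated T z' ->
  multiplier (fun t => k * z t + z' t) = k * multiplier z + multiplier z'.
Proof.
move=> rz rz'; have [M _ hM] := regulated_bounded rz; have [M' _ hM'] := regulated_bounded rz'.
have bz := regulated_bdmeas rz hM; have bz' := regulated_bdmeas rz' hM'.
rewrite /multiplier (D_lin T0 ig hD k bz bz').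
by rewrite (KSintE T0 (is_KSint_lin k (KSint_reg rz) (KSint_reg rz'))); ring.
Qed.

Lemma multiplierB z z' : regulated T z -> regulated T z' ->
  multiplier (fun t => z t - z' t) = multiplier z - multiplier z'.
Proof.
move=> rz rz'; have := multiplier_lin (-1) rz' rz.
rewrite (_ : (fun t => -1 * z' t + z t) = (fun t => z t - z' t)); last by apply/funext => t; ring.
by move=> ->; ring.
Qed.

Lemma multiplier_bd M z : regulated T z -> (forall t, 0 <= t <= T -> `|z t| <= M) ->
  `|multiplier z| <= (normD T g + `|D2| + (V T - V 0)) * M.
Proof.
move=> rz hM; have inT : 0 <= T <= T by rewrite lexx ltW.
rewrite /multiplier (mulrDl (normD T g + _)) (mulrDl (normD T g));
  apply: le_trans (ler_normD _ _) _; apply: lerD; last first.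
  by rewrite mulrC; exact: (KSint_bound T0 hV (KSint_reg rz) hM).
apply: le_trans (ler_normD _ _) _; apply: lerD.
  exact: (D_bd T0 ig hD (regulated_bdmeas rz hM)).
by rewrite normrM ler_wpM2l//; exact: hM.
Qed.

(** The part in [D] is small by dominated convergence, the part in [p] because [z] vanishes at
    the points of [F] themselves, and the part at [T] is eventually [0]. *)
Lemma multiplier_cut z F M e : regulated T z -> (forall c, c \in F -> 0 <= c <= T /\ z c = 0) ->
  (forall t, 0 <= t <= T -> `|z t| <= M) ->
  (forall n, regulated T (fun t => z t * chi n%:R F t)) -> 0 < e ->
  exists n, `|multiplier (fun t => z t - z t * chi n%:R F t)| <= e.
Proof.
move=> rz hF zM rn e0; have inT : 0 <= T <= T by rewrite lexx ltW.
have inTf t : 0 < t < T -> 0 <= t <= T by move=> /andP[h1 h2]; rewrite !ltW.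
have M0 : 0 <= M by apply: le_trans (zM T inT).
pose phi n t := z t - z t * chi n%:R F t.
have rphi n : regulated T (phi n).
  have := regulatedD T0 rz (regulatedZ (-1) T0 (rn n)).
  by rewrite (_ : (fun t => _) = phi n)//; apply/funext => t; rewrite /phi mulN1r.
have phiE n t : phi n t = z t * (1 - chi n%:R F t) by rewrite /phi mulrBr mulr1.
have phiM n t : 0 <= t <= T -> `|phi n t| <= M.
  move=> tT; rewrite phiE normrM; have /andP[c0 c1] := chi01 F t (ler0n R n).
  apply: le_trans (zM t tT); rewrite ler_piMr// ger0_norm; lra.
have phi0 n (q : R) : 0 < q -> n.+1%:R^-1 < q -> forall t, (forall c, c \in F -> q <= `|t - c|) ->
    phi n.+1 t = 0.
  move=> d0 nd t far; rewrite phiE chi_far ?subrr ?mulr0// => c cF.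
  by rewrite -ler_pdivrMl// mulr1; apply: le_trans (ltW nd) (far c cF).
have phiF n c : c \in F -> phi n c = 0 by move=> cF; rewrite phiE (hF c cF).2 mul0r.
have ev0 t : 0 <= t <= T -> \forall n \near \oo, phi n.+1 t = 0.
  move=> tT; have [tF|tF] := boolP (t \in F); first by apply: nearW => n; exact: phiF.
  have [d d0 hd] : exists2 d : R, 0 < d & forall c, c \in F -> d <= `|t - c|.
    elim: F tF {phi rphi phiE phiM phi0 phiF hF rn} => [|c F ih]; first by exists 1.
    rewrite inE negb_or => /andP[tc /ih[d d0 hd]].
    have tc0 : 0 < `|t - c| by rewrite normr_gt0 subr_eq0.
    exists (Num.min d `|t - c|); first by rewrite lt_min d0.
    move=> x; rewrite inE => /orP[/eqP ->|/hd]; first by rewrite ge_min lexx orbT.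
    by apply: le_trans; rewrite ge_min lexx.
  have [N _ hN] := near_infty_natSinv_lt (PosNum d0).
  by exists N => // n /hN /= nd; exact: (phi0 n d d0 nd).
have e20 : 0 < e / 2 by rewrite divr_gt0.
have b0 : bdmeas T M (fun=> 0 : R).
  by split=> [|t _]; [exact: measurable_cst|rewrite normr0].
have cvgE : D (to_Linf T (phi n.+1)) @[n --> \oo] --> D (to_Linf T (fun=> 0)).
  apply: (D_cvg (g := g) T0 ig hD (M := M) (N := set0)) => //.
  - by move=> n; apply: regulated_bdmeas => // t; exact: phiM.
  - by move=> t tT _; apply: cvg_near_cst; apply: ev0; exact: inTf.
rewrite D_0 in cvgE.
have [d d0 hd] := KSint_small_support T0 hV (fun c cF => (hF c cF).1)
  (e := e / 2 / (M + 1)) (M := M) ltac:(by rewrite !divr_gt0// ltr_wpDl) M0.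
have [N1 _ hN1] : \forall n \near \oo, `|D (to_Linf T (phi n.+1))| <= e / 2.
  move/cvgrPdist_le: cvgE => /(_ _ e20); apply: filterS => n.
  by rewrite sub0r normrN.
have [N2 _ hN2] := ev0 T inT.
have [N3 _ hN3] := near_infty_natSinv_lt (PosNum d0).
pose n := maxn N1 (maxn N2 N3).
have n1 : (N1 <= n)%N by exact: leq_maxl.
have n2 : (N2 <= n)%N by rewrite /n !leq_max leqnn orbT.
have n3 : (N3 <= n)%N by rewrite /n !leq_max leqnn !orbT.
exists n.+1; rewrite -/(phi n.+1) /multiplier (hN2 n n2) mulr0 addr0.
apply: le_trans (ler_normD _ _) _; rewrite [e]splitr; apply: lerD; first exact: hN1.
have : `|KSint 0 T (phi n.+1) p| <= M * (e / 2 / (M + 1)).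
  apply: (hd (phi n.+1)); [exact: phiM|exact: phiF| |exact: KSint_reg].
  by move=> t _; exact: (phi0 n d d0 (hN3 n n3)).
move/le_trans; apply; rewrite mulrA ler_pdivrMr ?ltr_wpDl// mulrC ler_pM2l//.
by rewrite lerDl.
Qed.

End multiplier_functional.
End adjoint.

(** * Bouligand stationarity and the adjoint system *)

Section stationarity.
Variable R : realType.
Implicit Types (a b c e s t x k l M : R) (f h d z phi : R -> R).

Lemma cutoff_noninc x t s s' : 0 < x -> s <= s' -> cutoff x t s' <= cutoff x t s.
Proof.
move=> x0 ss; have E a : cutoff x t a = cutoff x (t - a) 0 by rewrite /cutoff subr0.
by rewrite !E; apply: cutoff_monotone => //; rewrite lerD2l lerN2.
Qed.

Lemma isdelta_ext T r (u y : R -> R) h d d' : (forall t, 0 <= t <= T -> d t = d' t) ->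
  isdelta T r u y h d -> isdelta T r u y h d'.
Proof.
move=> E [Y [W [sY hW Y0 dE]]]; exists Y, W; split=> // t tT.
by rewrite -E// dE.
Qed.

Lemma soft_le0 e x : 0 < e -> x <= 0 -> soft e x <= 0.
Proof.
move=> e0 x0; rewrite leNgt; apply/negP => /(soft_gt0 e0) ex.
by have := lt_le_trans (lt_trans e0 ex) x0; rewrite ltxx.
Qed.

Lemma soft_ge0 e x : 0 < e -> 0 <= x -> 0 <= soft e x.
Proof. by move=> e0 x0; rewrite -oppr_le0 -softN// soft_le0// oppr_le0. Qed.

Section fixed_control.
Variables (T r : R) (u y : R -> R) (g : measurableTypeR R -> R) (D : Linf T -> R) (D2 : R).
Hypotheses (T0 : 0 < T) (r0 : 0 < r) (cu : cts 0 T u) (sy : stopsol T r u y).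
Hypothesis ig : (leb0T T).-integrable setT (EFin \o g).
Hypothesis hD : forall z : Linf T, D z = \int[leb0T T]_t (g t * z t).

Local Notation delta := (isdelta T r u y).

(** The part of the derivative of the objective that stems from the state. *)
Definition state_part d := D (to_Linf T d) + D2 * d T.

Lemma state_part_lip h h' d d' M : cts 0 T h -> cts 0 T h' -> delta h d -> delta h' d' ->
  (forall t, 0 <= t <= T -> `|h t - h' t| <= M) ->
  `|state_part d - state_part d'| <= (2 * (normD T g + `|D2|)) * M.
Proof.
move=> ch ch' hd hd' hM; have inT : 0 <= T <= T by rewrite lexx ltW.
have dM := isdelta_lip T0 cu ch ch' hd hd' hM.
have [H _ hH] := cts_bounded ch; have [H' _ hH'] := cts_bounded ch'.
have bd := isdelta_bdmeas T0 cu sy ch hd hH.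
have bd' := isdelta_bdmeas T0 cu sy ch' hd' hH'.
have E := D_lin T0 ig hD (-1) bd' bd.
have b : bdmeas T (2 * M) (fun t => -1 * d' t + d t).
  split; first exact: (bdmeasD (-1) bd' bd).1.
  move=> t /andP[t0 tT]; rewrite mulN1r addrC; apply: dM.
  by rewrite !ltW.
have h1 := D_bd T0 ig hD b.
rewrite /state_part (_ : _ - _ = (-1 * D (to_Linf T d') + D (to_Linf T d)) + D2 * (d T - d' T));
  last ring.
rewrite -E; apply: le_trans (ler_normD _ _) _.
rewrite (_ : _ * M = normD T g * (2 * M) + `|D2| * (2 * M)); last ring.
apply: lerD => //; rewrite normrM ler_wpM2l//; exact: dM.
Qed.

Lemma state_part_0 d : (forall t, 0 <= t <= T -> d t = 0) -> state_part d = 0.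
Proof.
move=> d0; have inT : 0 <= T <= T by rewrite lexx ltW.
have inTf t : 0 < t < T -> 0 <= t <= T by move=> /andP[h1 h2]; rewrite !ltW.
have z0 : bdmeas T 0 (fun=> 0 : R).
  by split; [exact: measurable_cst|move=> x _; rewrite normr0].
have zd : bdmeas T 0 d.
  split; last by move=> x /inTf xT; rewrite d0// normr0.
  apply: (eq_measurable_fun (fun=> 0 : R)); last exact: measurable_cst.
  by move=> x; rewrite inE/= in_itv/= => xT; rewrite d0//; exact: inTf.
have := D_bd T0 ig hD zd; rewrite mulr0 normr_le0 => /eqP E.
by rewrite /state_part E d0// mulr0 addr0.
Qed.

Section linear_part_extends.
Variables (U : lmodType R) (iota : {linear U -> (R -> R)}) (ell : U -> R).
Hypothesis ell_lin : forall k (h h' : U), ell (k *: h + h') = k * ell h + ell h'.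
Hypothesis iota_cts : forall h : U, cts 0 T (iota h).
Hypothesis iota_approx : forall f e, cts 0 T f -> 0 < e -> exists h : U, near_by T iota h f e.
Hypothesis stat : forall (h : U) d, delta (iota h) d -> 0 <= state_part d + ell h.

Local Notation K := (2 * (normD T g + `|D2|)).
Local Notation L := (extend T iota ell K).

Lemma stationary_K_ge0 : 0 <= K.
Proof. by rewrite mulr_ge0// addr_ge0// normD_ge0. Qed.

(** Stationarity in both directions [h] and [- h] bounds the linear part by the Lipschitz
    constant of the part that stems from the state. *)
Lemma stationary_bd (h : U) M : (forall t, 0 <= t <= T -> `|iota h t| <= M) ->
  `|ell h| <= K * M.
Proof.
move=> hM; have c0 := @cts_cst _ 0 T (0 : R).
have d0 := isdelta_0 (T := T) (r := r) (u := u) (y := y) sy.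
have bd (h' : U) : (forall t, 0 <= t <= T -> `|iota h' t| <= M) -> - ell h' <= K * M.
  move=> hM'; have [d hd] := isdelta_ex T0 r0 cu sy (iota_cts h').
  have := state_part_lip (iota_cts h') c0 hd d0 (M := M).
  rewrite (state_part_0 (d := fun=> 0))// subr0 => H.
  have {}H : state_part d <= K * M.
    by apply: (le_trans (ler_norm _)); apply: H => t tT; rewrite subr0; exact: hM'.
  by have := stat hd; rewrite -lerBlDr sub0r => /le_trans; exact.
have l0 : ell 0 = 0 by have := ell_lin 1 0 0; rewrite scale1r addr0 mul1r => /(canLR (addrK _));
  rewrite subrr => <-.
rewrite ler_norml lerNl bd//=.
have -> : ell h = - ell (-1 *: h + 0) by rewrite ell_lin l0 addr0 mulN1r opprK.
apply: bd => t tT; rewrite iotaE (_ : iota 0 t = 0); last by rewrite linear0.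
by rewrite addr0 mulN1r normrN; exact: hM.
Qed.

(** Both parts of the inequality are continuous in the supremum norm of the direction. *)
Lemma stationary_extend f d : cts 0 T f -> delta f d -> 0 <= state_part d + L f.
Proof.
move=> cf hd; apply/ler_addgt0Pr => e e0.
have K0 := stationary_K_ge0; have K1 : 0 < 2 * (K + 1) by rewrite mulr_gt0// ltr_wpDl.
have m0 : 0 < e / (2 * (K + 1)) by rewrite divr_gt0.
have [h hf] := iota_approx cf m0.
have [d' hd'] := isdelta_ex T0 r0 cu sy (iota_cts h).
have h1 := state_part_lip (iota_cts h) cf hd' hd hf.
have h2 := extend_near ell_lin stationary_bd hf.
have h3 := stat hd'.
have h4 : K * (e / (2 * (K + 1))) <= e / 2.
  rewrite (_ : e / (2 * (K + 1)) = e / 2 / (K + 1)); last by rewrite invfM mulrA.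
  rewrite mulrCA; apply: ler_piMr; first by rewrite divr_ge0// ltW.
  by rewrite ler_pdivrMr ?mul1r ?lerDl// ltr_wpDl.
have := ler_normlW h1; have := ler_normlW h2; move: h3 h4 e0 {h1 h2 hd hd' hf cf m0 K0 K1}.
move: (ell h) (state_part d') (state_part d) (L f) (K * _) => A B C E F.
lra.
Qed.

End linear_part_extends.

Section adjoint_state.
Variables (C : R) (L : (R -> R) -> R).
Hypothesis C0 : 0 <= C.
Hypothesis L_lin : forall k f f', cts 0 T f -> cts 0 T f' ->
  L (fun t => k * f t + f' t) = k * L f + L f'.
Hypothesis L_bd : forall f M, cts 0 T f -> (forall t, 0 <= t <= T -> `|f t| <= M) ->
  `|L f| <= C * M.
Hypothesis stat : forall f d, cts 0 T f -> delta f d -> 0 <= state_part d + L f.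

Let inT : 0 <= T <= T. Proof. by rewrite lexx ltW. Qed.
Let c1 : cts 0 T (fun=> 1). Proof. exact: cts_cst. Qed.

(** Constant directions of either sign do not change the state. *)
Lemma stationary_1 : L (fun=> 1) = 0.
Proof.
have h k : 0 <= L (fun=> k).
  have ck : cts 0 T (fun=> k) := @cts_cst _ 0 T k.
  have [d hd] := isdelta_ex T0 r0 cu sy ck.
  have := stat ck hd; rewrite state_part_0 ?add0r//.
  exact: (isdelta_cst T0 cu sy hd).
have := L_lin (-2) c1 c1; rewrite (_ : (fun t => _) = (fun=> -1)); last by apply/funext => t; ring.
have := h 1; have := h (-1); move: (L _) (L _) => A B; lra.
Qed.

(** The test directions approximate [k] times the indicator of [t, T].  Their derivatives vanish
    off shrinking intervals to the left of [t], so that only the value of [L] remains. *)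
Lemma primL_sign t (k : R) : 0 < t <= T -> `|k| = 1 ->
  (forall x d, 0 < x -> delta (fun s => k * (1 - cutoff x t s)) d ->
     forall s, t < s <= T \/ s = T -> d s = 0) ->
  k * primL L t <= 0.
Proof.
move=> tT k1 hk; have inTf s : 0 < s < T -> 0 <= s <= T by move=> /andP[h1 h2]; rewrite !ltW.
pose f x s := k * (1 - cutoff x t s).
have cf x : 0 < x -> cts 0 T (f x).
  by move=> x0; apply: ctsZ; apply: ctsB => //; exact: cts_cutoff.
have fM x s : `|f x s| <= 1.
  by rewrite normrM k1 mul1r; have := cutoff01 x t s; rewrite ler_norml; lra.
have xn n : 0 < n.+1%:R^-1 :> R by rewrite invr_gt0.
have /choice[d hd] : forall n : nat, exists d, delta (f n.+1%:R^-1) d.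
  by move=> n; apply: (isdelta_ex T0 r0 cu sy); exact: cf.
have bd n : bdmeas T (2 * 1) (d n).
  by apply: (isdelta_bdmeas T0 cu sy (cf _ (xn n)) (hd n)) => s _; exact: fM.
have b0 : bdmeas T (2 * 1) (fun=> 0 : R).
  by split; [exact: measurable_cst|move=> s _; rewrite normr0 mulr1].
have cvgE : D (to_Linf T (d n)) @[n --> \oo] --> D (to_Linf T (fun=> 0)).
  apply: (D_cvg (g := g) T0 ig hD bd b0 (countable1 t)) => s sT st; apply: cvg_near_cst.
  have [ts|ts] := ltP t s.
    by apply: nearW => n; apply: (hk _ _ (xn n) (hd n)); left; rewrite ts ltW//; case/andP: sT.
  have {ts}st : s < t by rewrite lt_neqAle ts andbT; apply/eqP => E; apply: st.
  have e0 : 0 < (t - s) / 2 by rewrite divr_gt0// subr_gt0.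
  have [N _ hN] := near_infty_natSinv_lt (PosNum e0).
  exists N => // n /hN /= nd.
  have E a : 0 <= a <= s -> f n.+1%:R^-1 a = 0.
    move=> ha; rewrite /f cutoff_eq1 ?subrr ?mulr0//.
    by case/andP: ha => _ as_; apply: le_trans as_ _; move: nd; rewrite ltr_pdivlMr// => /ltW;
      rewrite lerBrDr mulrC -lerBrDl.
  have s0 : 0 <= s by case/andP: sT => /ltW.
  apply: (isdelta_from cu (cf _ (xn n)) (hd n) (lexx 0) s0).
  - by case/andP: sT => _ /ltW.
  - exact: (isdelta_at0 T0 (cf _ (xn n)) (hd n)).
  - by move=> a ha; rewrite !E// lexx.
rewrite (D_0 T0 ig hD) in cvgE.
have LE n : L (f n.+1%:R^-1) = - (k * L (cutoff n.+1%:R^-1 t)).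
  have cc := @cts_cutoff _ T _ t (xn n).
  rewrite (_ : f _ = (fun s => (- k) * cutoff n.+1%:R^-1 t s + (fun s => k * 1 + (fun=> 0) s) s)).
    have ck : cts 0 T (fun s => k * 1 + (fun=> 0) s) by exact: cts_cst.
    have c0 : cts 0 T (fun=> 0 : R) by exact: cts_cst.
    rewrite L_lin// (L_lin k c1 c0) stationary_1 mulr0 add0r.
    by rewrite (L_eq0 L_bd c0)// addr0 mulNr.
  by apply/funext => s; rewrite /f; ring.
have st n : k * L (cutoff n.+1%:R^-1 t) <= D (to_Linf T (d n)).
  have := stat (cf _ (xn n)) (hd n); rewrite LE /state_part.
  by rewrite (hk _ _ (xn n) (hd n) T (or_intror erefl)) mulr0 addr0 subr_ge0.
apply/ler_addgt0Pr => e e0; rewrite add0r; have e20 : 0 < e / 2 by rewrite divr_gt0.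
have [q q0 hq] := ev_lim (primLP L_lin L_bd t) e20.
have [N1 _ hN1] : \forall n \near \oo, `|D (to_Linf T (d n))| <= e / 2.
  move/cvgrPdist_le: cvgE => /(_ _ e20); apply: filterS => n.
  by rewrite sub0r normrN.
have [N2 _ hN2] := near_infty_natSinv_lt (PosNum q0).
pose n := maxn N1 N2.
have a1 := ler_normlW (hN1 n (leq_maxl _ _)).
have a2 : `|L (cutoff n.+1%:R^-1 t) - primL L t| < e / 2.
  by apply: hq; rewrite xn; exact: (hN2 n (leq_maxr _ _)).
have a3 : k * primL L t - k * L (cutoff n.+1%:R^-1 t) <= e / 2.
  by rewrite -mulrBr; apply: le_trans (ler_norm _) _; rewrite normrM k1 mul1r distrC ltW.
rewrite [e]splitr -lerBlDr; apply: le_trans a3 => //.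
by apply: lerB => //; exact: le_trans (st n) a1.
Qed.

(** The test direction is [0] up to [t - 2 x] and then monotone until it becomes constant.  At
    [t] an active constraint on its side forbids any response, and so does a strictly active
    time just after [t]. *)
Lemma Kptw_primL t : 0 < t <= T -> Kptw T r y u t (primL L t).
Proof.
move=> tT; have tT' : 0 <= t <= T by case/andP: tT => /ltW -> ->.
have yr : - r <= y t <= r by case: sy => _ + _ _; apply.
have c0 : cts 0 T (fun=> 0 : R) by exact: cts_cst.
have d0 := isdelta_0 (T := T) (r := r) (u := u) (y := y) sy.
have cf (k x : R) : 0 < x -> cts 0 T (fun s => k * (1 - cutoff x t s)).
  by move=> x0; apply: ctsZ; apply: ctsB => //; exact: cts_cutoff.
have fk (k x s : R) : 0 < x -> t <= s -> k * (1 - cutoff x t s) = k.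
  move=> x0 ts; rewrite cutoff_eq0 ?subr0 ?mulr1//.
  by apply: le_trans ts; rewrite gerBl ltW.
have after (k x : R) d : 0 < x -> delta (fun s => k * (1 - cutoff x t s)) d ->
    forall a s, t <= a -> a <= s -> s <= T -> d a = 0 -> d s = 0.
  move=> x0 hd a s ta as_ sT da.
  have a0 : 0 <= a by apply: le_trans ta; case/andP: tT'.
  apply: (isdelta_from cu (cf _ _ x0) hd a0 as_ sT da) => q /andP[aq _].
  by rewrite !fk// (le_trans ta aq).
have sT s : t < s <= T \/ s = T -> t <= s <= T.
  by move=> [/andP[/ltW -> ->]//|->]; rewrite lexx andbT; case/andP: tT.
have N1 : `|-1 : R| = 1 by rewrite normrN normr1.
apply: Kptw_intro => //.
- move=> yt _; rewrite -[primL L t]mul1r; apply: primL_sign => //; first exact: normr1.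
  move=> x d x0 hd s /sT/andP[ts ss]; apply: (after _ _ _ x0 hd t s (lexx t) ts ss).
  apply/eqP; rewrite eq_le (isdelta_upper hd tT' yt)/=.
  apply: (isdelta_le T0 cu c0 (cf _ _ x0) d0 hd _ tT') => a b _ ab _.
  by rewrite !subr0 !mul1r lerD2l lerN2; exact: cutoff_noninc.
- move=> yt _; rewrite -oppr_le0 -mulN1r; apply: primL_sign => //.
  move=> x d x0 hd s /sT/andP[ts ss]; apply: (after _ _ _ x0 hd t s (lexx t) ts ss).
  apply/eqP; rewrite eq_le (isdelta_lower hd tT' yt) andbT.
  apply: (isdelta_le T0 cu (cf _ _ x0) c0 hd d0 _ tT') => a b _ ab _.
  by rewrite /= !sub0r !mulN1r !opprK lerD2l lerN2; exact: cutoff_noninc.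
move=> tT2 nc _; have t0T : 0 <= t < T by rewrite tT2; case/andP: tT' => ->.
have van (k x : R) d : 0 < x -> delta (fun s => k * (1 - cutoff x t s)) d ->
     forall s, t < s <= T \/ s = T -> d s = 0.
  move=> x0 hd s hs; have ts : t < s by case: hs => [/andP[]//|->].
  have ss : s <= T by have /andP[] := sT s hs.
  have [|e e0 he] := isdelta_strict r0 cu sy (cf _ _ x0) hd t0T nc.
    by move=> q /andP[tq _]; rewrite !fk.
  have [m [m0 me ms]] : exists m : R, [/\ 0 < m, m < e & m <= s - t].
    exists (Num.min (e / 2) (s - t)).
    rewrite lt_min divr_gt0// subr_gt0 ts gt_min ge_min lexx orbT; split=> //.
    by rewrite ltr_pdivrMr// ltr_pMr// ltr1n.
  have as_ : t + m <= s by rewrite addrC -lerBrDr.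
  apply: (after _ _ _ x0 hd (t + m) s _ as_ ss); first by rewrite lerDl ltW.
  by apply: he; [rewrite ltrDl m0 ltrD2l|exact: le_trans as_ ss].
apply/eqP; rewrite eq_le -oppr_le0 -mulN1r -{1}[primL L t]mul1r.
by rewrite !primL_sign ?normr1//; exact: van.
Qed.

Local Notation p := (riesz T L).

Lemma llim_riesz t : 0 < t <= T -> llim p t = primL L t.
Proof.
move=> tT; apply: llim_lim; first by case/andP: tT.
exact: (riesz_left L_lin L_bd tT).
Qed.

Lemma riesz_0 : p 0 = 0.
Proof. by rewrite /riesz T0 (primL0 L_lin L_bd). Qed.

Lemma riesz_Kptw t : 0 <= t <= T -> Kptw T r y u t (llim p t).
Proof.
move=> /andP[t0 tT]; have [->|t_neq0] := eqVneq t 0.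
  have yr : - r <= y 0 <= r by case: sy => _ + _ _; apply; rewrite lexx ltW.
  by rewrite llim0 riesz_0; apply: Kptw_intro => //; rewrite lexx ltW.
have t0' : 0 < t <= T by rewrite tT lt_def t_neq0 t0.
by rewrite llim_riesz//; exact: Kptw_primL.
Qed.

Lemma riesz_left_cts t : 0 <= t < T -> p t = llim p t.
Proof.
move=> /andP[t0 tT]; have [->|t_neq0] := eqVneq t 0; first by rewrite llim0.
by rewrite llim_riesz /riesz ?tT// lt_def t_neq0 t0 ltW.
Qed.

(** [z] is approximated by continuous directions along which the stop operator is affine. *)
Lemma multiplier_ge0 z : Kred T r y u z -> 0 <= multiplier D D2 p z.
Proof.
move=> [Gz Kz z0 jz]; have rz : regulated T z by case: Gz.
have [V hV] := BV_control T0 (riesz_BV T0 L_lin L_bd).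
pose B := normD T g + `|D2| + (V T - V 0).
have B0 : 0 <= B.
  apply: addr_ge0; first by rewrite addr_ge0// normD_ge0.
  by rewrite subr_ge0; apply: (control_mono hV) => //; exact: ltW.
apply/ler_addgt0Pr => e' e'0; have B1 : 0 < 2 * B + 1 by rewrite ltr_wpDl// mulr_ge0.
have [e e0 eE] : exists2 e : R, 0 < e & e' = B * e + B * e + e.
  exists (e' / (2 * B + 1)); first by rewrite divr_gt0.
  by rewrite -{1}[e'](divfK (lt0r_neq0 B1)); ring.
have [F hF1 hF2] := regulated_zeros T0 e0 rz.
pose f t := soft e (z t).
have rf : regulated T f by apply: regulated_comp_lip => // a b; exact: soft_lip.
have cz n : cts 0 T (fun t => f t * chi n%:R F t).
  apply: (cts_soft_chi T0 e0 (ler0n _ n) Gz _ hF2) => t tT.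
  by apply: jz; rewrite in_itv.
have [M _ fM] := regulated_bounded rf.
have fF c : c \in F -> 0 <= c <= T /\ f c = 0.
  by move=> /hF1[cT zc]; rewrite /f zc soft0.
have [n hn] := multiplier_cut D2 T0 ig hD hV rf fF fM (fun n => cts_regulated T0 (cz n)) e0.
pose zn t := f t * chi n%:R F t.
pose h t := soft e (zn t).
have ch : cts 0 T h by exact: cts_soft e0 (cz n).
have Kzn t : 0 <= t <= T -> Kptw T r y u t (zn t).
  move=> tT; have /andP[chi0 _] := chi01 F t (ler0n R n).
  apply: (Kptw_sign (Kz t ltac:(by rewrite in_itv))) => zt.
    by apply: mulr_le0_ge0 => //; exact: soft_le0.
  by apply: mulr_ge0 => //; exact: soft_ge0.
have h0 : h 0 = 0 by rewrite /h /zn /f z0 soft0// mul0r soft0.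
have hex := exact_direction T0 r0 e0 cu sy (cz n) Kzn.
have hh : delta h h.
  have [d hd] := isdelta_ex T0 r0 cu sy ch.
  exact: (isdelta_ext (isdelta_exact cu ch hd h0 hex) hd).
have st := stat ch hh.
have Lh : L h = KSint 0 T h p.
  by rewrite (KSintE T0 (riesz_KSint T0 C0 L_lin L_bd stationary_1 ch)).
have rh := cts_regulated T0 ch; have rzn := cts_regulated T0 (cz n).
have m1 : `|multiplier D D2 p z - multiplier D D2 p f| <= B * e.
  rewrite -(multiplierB D2 T0 ig hD hV)//; apply: (multiplier_bd D2 T0 ig hD hV).
    by have := regulatedD T0 rz (regulatedZ (-1) T0 rf);
      rewrite (_ : (fun t => _) = (fun t => z t - f t))//; apply/funext => t; rewrite mulN1r.
  by move=> t _; exact: soft_dist.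
have m2 : `|multiplier D D2 p zn - multiplier D D2 p h| <= B * e.
  rewrite -(multiplierB D2 T0 ig hD hV)//; apply: (multiplier_bd D2 T0 ig hD hV).
    exact: (cts_regulated T0 (ctsB (cz n) ch)).
  by move=> t _; exact: soft_dist.
have m3 : `|multiplier D D2 p f - multiplier D D2 p zn| <= e.
  by rewrite -(multiplierB D2 T0 ig hD hV).
have mh : 0 <= multiplier D D2 p h by rewrite /multiplier -Lh.
move: m1 m2 m3 mh; rewrite eE !ler_norml.
move: (multiplier _ _ _ z) (multiplier _ _ _ f) (multiplier _ _ _ zn) (multiplier _ _ _ h) (B * e).
by move=> x1 x2 x3 x4 x5; lra.
Qed.

End adjoint_state.

(** The right-continuous version of the derivative in direction [h] is an admissible test for the
    multiplier, and what it misses of [h] has the right sign against [p]. *)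
Lemma stationary_of_adjoint p V h Vh d : control 0 T V p -> control 0 T Vh h -> cts 0 T h ->
  p 0 = 0 -> p T = 0 -> (forall t, 0 <= t < T -> p t = llim p t) ->
  (forall t, 0 <= t <= T -> Kptw T r y u t (llim p t)) ->
  (forall z, Kred T r y u z -> 0 <= multiplier D D2 p z) ->
  delta h d -> 0 <= state_part d + KSint 0 T h p.
Proof.
move=> hV hVh ch p0 pT pl pK mu0 hd; have [Y [W [sY hW Y0 dE]]] := hd.
have inT : 0 <= T <= T by rewrite lexx ltW.
have inTf s : 0 < s < T -> 0 <= s <= T by move=> /andP[h1 h2]; rewrite !ltW.
have cW := W_control r0 cu ch sY hW hVh.
have cdd := controlD hVh (controlN cW).
pose dd t := h t - W t; pose z := rlim T dd.
have Kz : Kred T r y u z by rewrite -Y0; exact: (rlim_delta_Kred cu ch sY hW cW T0 r0 hVh).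
have rz : regulated T z by case: Kz => [[]].
have [H _ hH] := cts_bounded ch; have bd := isdelta_bdmeas T0 cu sy ch hd hH.
have [M _ hM] := regulated_bounded rz; have bz := regulated_bdmeas rz hM.
have Ez : D (to_Linf T d) = D (to_Linf T z).
  apply: (D_ae_eq ig hD bd bz).
  apply: sub_countable (countable_rlim_neq T0 cdd); apply: subset_card_le => t /= [tT dz].
  by split=> // E; apply: dz; rewrite dE ?inTf.
have zT : z T = d T by rewrite /z rlimT dE.
have hI := is_KSint_lin (-1) (KSint_reg T0 hV rz) (KSint_reg T0 hV (cts_regulated T0 ch)).
have hI' : is_KSint 0 T (rlim T W) p (-1 * KSint 0 T z p + KSint 0 T h p).
  apply: is_KSint_ext hI => t tT.
  by rewrite /z (rlim_deltaE ch cW tT); ring.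
have pK' t : 0 <= t <= T -> Kptw T r (Y 0) u t (llim p t) by rewrite Y0; exact: pK.
have I0 := KSint_rlim_W_ge0 cu ch sY hW cW T0 r0 hV p0 pT pl pK' hI'.
have := mu0 z Kz; rewrite /multiplier /state_part Ez -zT.
move: I0; move: (KSint _ _ z p) (KSint _ _ h p) (D _) (D2 * _) => a b c e; lra.
Qed.

End fixed_control.
End stationarity.

(** * The optimal control problem *)

Section control_problem.
Variable R : realType.
Implicit Types (a b c e s t x k M T r : R) (f h u v : R -> R).

Lemma supnorm_ge T v M t : (forall s, 0 <= s <= T -> `|v s| <= M) -> 0 <= t <= T ->
  `|v t| <= supnorm T v.
Proof.
move=> vM tT; apply: ub_le_sup; last by exists t => //=; rewrite in_itv.
by exists M => _ [s /= sT <-]; apply: vM; move: sT; rewrite in_itv.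
Qed.

Lemma CBV_lin T u h x : 0 < T -> CBV T u -> CBV T h -> CBV T (fun s => u s + x * h s).
Proof.
move=> T0 /CBVP[/(BV_control T0)[V hV] cu] /CBVP[/(BV_control T0)[V' hV'] ch].
apply/CBVP; split; last exact: ctsuh.
exact: (control_BV T0 (controlD hV (controlZ x hV'))).
Qed.

Lemma stop_dd_isdelta T r (y0 : R) u h : 0 < T -> 0 < r -> - r <= y0 <= r ->
  CBV T u -> CBV T h -> isdelta T r u (stop T r y0 u) h (stop_dd T r y0 u h).
Proof.
move=> T0 r0 y0r Cu Ch; have [_ cu] := (CBVP T u).1 Cu; have [_ ch] := (CBVP T h).1 Ch.
pose Y x := stop T r y0 (fun s => u s + x * h s).
have Y0 : Y 0 = stop T r y0 u.
  by rewrite /Y (_ : (fun s => _) = u)//; apply/funext => t; rewrite mul0r addr0.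
have sY : stopfam T r u h Y.
  move=> x _; have [_ sx x0] := stopP T0 r0 y0r (CBV_lin x T0 Cu Ch).
  have [_ _ y00] := stopP T0 r0 y0r Cu.
  by split=> //; rewrite Y0 y00.
have /choice[W hW] : forall t, exists l, 0 <= t <= T -> isW u h Y t l.
  move=> t; have [tT|tT] := pselect (0 <= t <= T); last by exists 0 => /tT.
  by have [l hl] := isW_ex r0 cu ch sY tT; exists l.
exists Y, W; split=> // t tT; rewrite -(right_lim_lim (deltaP hW tT)).
by rewrite /stop_dd /= Y0.
Qed.

End control_problem.

Lemma dense_nbhs (T : topologicalType) (S A : set T) (x : T) : dense S -> nbhs x A ->
  exists2 z, A z & S z.
Proof.
move=> dS; rewrite nbhsE => -[B [oB Bx] BA].
by have [z [Bz Sz]] := dS B (ex_intro _ x Bx) oB; exists z => //; exact: BA.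
Qed.

Theorem theorem7p1 (R : realType) (T r y0 : R)
  (U : normedModType R) (iota : {linear U -> (R -> R)})
  (Uad : set U) (J : Linf T * R * U -> R) (ubar : U)
  (T_gt0 : 0 < T) (r_gt0 : 0 < r) (y0_Z : y0 \in `[- r, r])
  (iota_inj : forall u v : U,
     {in `[0, T], forall t, iota u t = iota v t} -> u = v)
  (iota_CBV : forall u : U, CBV T (iota u))
  (iota_continuous : exists C : R,
     forall u : U, supnorm T (iota u) <= C * `|u|)
  (iota_dense : forall f : R -> R, contC T f -> forall e : R, 0 < e ->
     exists u : U, supnorm T (iota u \- f) < e)
  (Uad_neq0 : Uad !=set0) (Uad_convex : convex_set Uad)
  (J_differentiable : forall x, differentiable J x)
  (partial1_L1 : forall (y : R -> R) (u : U), CBV T y ->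
     exists2 g : R -> R, (leb0T T).-integrable setT (EFin \o g) &
       forall z : Linf T, partial1 J (to_Linf T y) (y T) u z =
         \int[leb0T T]_t (g t * z t))
  (Uad_ubar : Uad ubar)
  (cone_dense : dense (cone_of Uad ubar)) :
  let S' := fun h : U => stop_dd T r y0 (iota ubar) (iota h) in
  let ybar := stop T r y0 (iota ubar) in
  let D1 := partial1 J (to_Linf T ybar) (ybar T) ubar in
  let D2 := partial2 J (to_Linf T ybar) (ybar T) ubar in
  let D3 := partial3 J (to_Linf T ybar) (ybar T) ubar in
  (forall h : U, cone_of Uad ubar h ->
     0 <= D1 (to_Linf T (S' h)) + D2 * S' h T + D3 h)
  <->
  exists p : R -> R, exists mu : (R -> R) -> R,
    [/\ BV T p, Gr_dual T mu &
    [/\ [/\ p 0 = 0, p T = 0 & {in `[0, T[, forall t, p t = llim p t}],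
        {in `[0, T], forall t, Kptw T r ybar (iota ubar) t (llim p t)},
        forall z, Kred T r ybar (iota ubar) z -> 0 <= mu z,
        forall h : U, KSint 0 T (iota h) p = D3 h &
        forall z, Gr T z ->
          - KSint 0 T z p = D1 (to_Linf T z) + D2 * z T - mu z]].
Proof.
move=> S' ybar D1 D2 D3.
have y0r : - r <= y0 <= r by move: y0_Z; rewrite in_itv.
have Cu := iota_CBV ubar; have [_ cu] := (CBVP T (iota ubar)).1 Cu.
have [By sy _] := stopP T_gt0 r_gt0 y0r Cu.
have Cy : CBV T ybar by apply/CBVP; split=> //; case: sy.
have [g ig hD] := partial1_L1 ybar ubar Cy.
have ci (h : U) : cts 0 T (iota h) by have [_ ch] := (CBVP T (iota h)).1 (iota_CBV h).
have hS (h : U) : isdelta T r (iota ubar) ybar (iota h) (S' h).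
  exact: stop_dd_isdelta.
pose K := 2 * (normD T g + `|D2|).
have K0 : 0 <= K by rewrite mulr_ge0// addr_ge0// normD_ge0.
split=> [stat|[p [mu [Bp _ [[p0 pT pl] pK mu0 D3E muE]]]] h _]; last first.
  have [V hV] := BV_control T_gt0 Bp.
  have /CBVP[/(BV_control T_gt0)[Vh hVh] _] := iota_CBV h.
  rewrite -D3E; apply: (stationary_of_adjoint T_gt0 r_gt0 cu sy ig hD hV hVh (ci h) p0 pT _ _ _ (hS h)).
  - by move=> t tT; apply: pl; rewrite in_itv.
  - by move=> t tT; apply: pK; rewrite in_itv.
  move=> z Kz; have [Gz _ _ _] := Kz; rewrite /multiplier -[KSint _ _ _ _]opprK (muE z Gz).
  by rewrite opprB addrC subrK; exact: mu0.
have ell_lin k (h h' : U) : D3 (k *: h + h') = k * D3 h + D3 h'.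
  by rewrite /D3 /partial3 linearP.
have D3_cont : continuous D3.
  apply: diff_continuous.
  pose F := (fun w : U => (to_Linf T ybar, ybar T, w)).
  have dF : differentiable F ubar.
    by apply: differentiable_pair; [exact: differentiable_cst|exact: ex_diff].
  exact: (@differentiable_comp _ _ _ _ F J ubar dF (J_differentiable _)).
have iota_approx f e : cts 0 T f -> 0 < e -> exists h : U, near_by T iota h f e.
  move=> cf e0; have [h hf] := iota_dense f ((ctsP 0 T f).2 cf) e e0.
  exists h => t tT; apply: le_trans (ltW hf).
  have [M _ hM] := cts_bounded (ctsB (ci h) cf).
  exact: (supnorm_ge (v := iota h \- f) hM tT).
(* The inequality extends from the cone to its closure, which is the whole space. *)
have statU (h : U) d : isdelta T r (iota ubar) ybar (iota h) d ->
    0 <= state_part D1 D2 d + D3 h.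
  move=> hd; apply/ler_addgt0Pr => e e0.
  have [C hC] := iota_continuous; have e20 : 0 < e / 2 by rewrite divr_gt0.
  have c0 : 0 < `|C| + 1 by rewrite ltr_wpDl.
  have K1 : 0 < K + 1 by rewrite ltr_wpDl.
  have m0 : 0 < e / 2 / (K + 1) / (`|C| + 1) by rewrite !divr_gt0.
  have near_h : nbhs h [set h' | `|h - h'| < e / 2 / (K + 1) / (`|C| + 1) /\ `|D3 h - D3 h'| < e / 2].
    apply: filterI; first by have := nbhsx_ballx h _ m0; rewrite -ball_normE.
    by have /cvgrPdist_lt := D3_cont h; apply.
  have [h' [hh' Dh] ch'] := dense_nbhs cone_dense near_h.
  have close t : 0 <= t <= T -> `|iota h' t - iota h t| <= e / 2 / (K + 1).
    move=> tT; have [M _ hM] := cts_bounded (ci (h' - h)).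
    have := supnorm_ge hM tT; rewrite linearB/= => /le_trans; apply.
    rewrite -linearB; apply: le_trans (hC _) _.
    apply: (@le_trans _ _ ((`|C| + 1) * `|h' - h|)).
      by rewrite ler_wpM2r//; apply: le_trans (ler_norm _) _; rewrite lerDl.
    by rewrite mulrC -ler_pdivlMr// distrC ltW.
  have h1 := state_part_lip D2 T_gt0 cu sy ig hD (ci h') (ci h) (hS h') hd close.
  have h2 : 0 <= state_part D1 D2 (S' h') + D3 h' := stat h' ch'.
  have h3 : K * (e / 2 / (K + 1)) <= e / 2.
    rewrite mulrCA; apply: ler_piMr; first exact: ltW.
    by rewrite ler_pdivrMr// mul1r lerDl.
  have h4 := ltW (le_lt_trans (ler_norm _) (eq_rect _ (fun a => a < e / 2) Dh _ (distrC _ _))).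
  have h5 := le_trans (le_trans (ler_norm _) h1) h3.
  move: (state_part _ _ (S' h')) (state_part _ _ d) (D3 h) (D3 h') h2 h4 h5 e0.
  by move=> x1 x2 x3 x4 h2 h4 h5 e0; lra.
have ell_bd := stationary_bd T_gt0 r_gt0 cu sy ig hD ell_lin ci statU.
pose L := extend T iota D3 K.
have L_lin := extend_lin K0 ell_lin ell_bd iota_approx.
have L_bd := extend_bd T_gt0 ell_lin ell_bd.
have statL := stationary_extend T_gt0 r_gt0 cu sy ig hD ell_lin ci iota_approx statU.
have L1 := stationary_1 T_gt0 r_gt0 cu sy ig hD L_lin statL.
have BVp := riesz_BV T_gt0 L_lin L_bd.
have [V hV] := BV_control T_gt0 BVp.
exists (riesz T L), (multiplier D1 D2 (riesz T L)); split => //.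
  split.
    by move=> k z w [rz _] [rw _]; exact: (multiplier_lin D2 T_gt0 ig hD hV).
  exists (normD T g + `|D2| + (V T - V 0)) => z [rz _].
  apply: (multiplier_bd D2 T_gt0 ig hD hV rz) => t tT.
  by have [M _ hM] := regulated_bounded rz; exact: supnorm_ge hM tT.
split.
- split; first exact: (riesz_0 T_gt0 L_lin L_bd).
    by rewrite /riesz ltxx.
  by move=> t; rewrite in_itv/=; exact: (riesz_left_cts L_lin L_bd).
- by move=> t; rewrite in_itv/=; exact: (riesz_Kptw T_gt0 r_gt0 cu sy ig hD L_lin L_bd statL).
- exact: (multiplier_ge0 T_gt0 r_gt0 cu sy ig hD K0 L_lin L_bd statL).
- move=> h; rewrite (KSintE T_gt0 (riesz_KSint T_gt0 K0 L_lin L_bd L1 (ci h))).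
  exact: extend_iota.
by move=> z _; rewrite /multiplier; ring.
Qed.
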